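(* Let $\alpha=(0,0,0,0,0,0)$ and let $\beta$ be any one of the following seven parameters in $\mathbb{Q}^6$: (1) $\left(\tfrac12,\tfrac12,\tfrac12,\tfrac12,\tfrac12,\tfrac12\right)$; (2) $\left(\tfrac12,\tfrac12,\tfrac12,\tfrac12,\tfrac13,\tfrac23\right)$; (3) $\left(\tfrac12,\tfrac12,\tfrac12,\tfrac12,\tfrac14,\tfrac34\right)$; (4) $\left(\tfrac12,\tfrac12,\tfrac12,\tfrac12,\tfrac16,\tfrac56\right)$; (5) $\left(\tfrac12,\tfrac12,\tfrac13,\tfrac23,\tfrac13,\tfrac23\right)$; (6) $\left(\tfrac12,\tfrac12,\tfrac13,\tfrac23,\tfrac14,\tfrac34\right)$; (7) $\left(\tfrac12,\tfrac12,\tfrac15,\tfrac25,\tfrac35,\tfrac45\right)$. Then the hypergeometric group $\Gamma(\alpha,\beta)$ is thin.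
   Context: Hypergeometric group: let $\alpha=(\alpha_1,\dots,\alpha_n),\beta=(\beta_1,\dots,\beta_n)\in\mathbb{C}^n$ with $\alpha_j-\beta_k\notin\mathbb{Z}$ for all $1\le j,k\le n$. The hypergeometric group $\Gamma(\alpha,\beta)$ is the subgroup of $\mathrm{GL}_n(\mathbb{C})$ generated by the companion matrices $A$ and $B$ of the polynomials $$f(x)=\prod_{j=1}^n\left(x-e^{2\pi i\alpha_j}\right)\quad\text{and}\quad g(x)=\prod_{j=1}^n\left(x-e^{2\pi i\beta_j}\right),$$ respectively. Here the companion matrix of a monic polynomial $x^n+c_{n-1}x^{n-1}+\dots+c_1x+c_0$ is the $n\times n$ matrix $C$ with $Ce_j=e_{j+1}$ for $1\le j\le n-1$ and $Ce_n=-(c_0e_1+c_1e_2+\dots+c_{n-1}e_n)$, where $e_1,\dots,e_n$ is the standard basis. In the cases considered, $n=6$, $f(x)=(x-1)^6$, and $g$ is a product of cyclotomic polynomials with $g(0)=1$ and $g(1)\ne 0$, so $\Gamma(\alpha,\beta)\subseteq \mathrm{GL}_6(\mathbb{Z})$. By a theorem of Beukers and Heckman, $\Gamma(\alpha,\beta)$ preserves a non-degenerate symplectic form $\Omega$ on the 6-dimensional space and is a Zariski dense subgroup of the integral symplectic group $\mathrm{Sp}_\Omega(\mathbb{Z})$. Arithmetic/thin: let $\mathbf{G}$ be the Zariski closure of $\Gamma(\alpha,\beta)$ in $\mathrm{GL}_n(\mathbb{C})$, and suppose $\Gamma(\alpha,\beta)\subseteq\mathbf{G}(\mathbb{Z})$,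 where $\mathbf{G}(\mathbb{Z})=\mathbf{G}\cap\mathrm{GL}_n(\mathbb{Z})$. The group $\Gamma(\alpha,\beta)$ is called arithmetic if its index in $\mathbf{G}(\mathbb{Z})$ is finite, and thin otherwise (i.e. if the index is infinite). In the cases considered, $\mathbf{G}=\mathrm{Sp}_\Omega$ and $\mathbf{G}(\mathbb{Z})=\mathrm{Sp}_\Omega(\mathbb{Z})$. *)

(* Defs.v *)
From HB Require Import structures.
From mathcomp Require Import all_boot all_order all_algebra.
From mathcomp Require Import boolp classical_sets functions cardinality reals.
From mathcomp Require Import sequences exp trigo complex.
From mathcomp Require mpoly.

Set Implicit Arguments.
Unset Strict Implicit.
Unset Printing Implicit Defensive.

Import Order.TTheory GRing.Theory Num.Theory.

Local Open Scope classical_set_scope.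
Local Open Scope complex_scope.
Local Open Scope ring_scope.

Definition cexp (R : realType) (z : R[i]) : R[i] :=
  (expR (complex.Re z))%:C * (cos (complex.Im z) +i* sin (complex.Im z)).

Definition exp2ipi (R : realType) (a : R[i]) : R[i] :=
  cexp (2 * pi%:C * 'i%C * a).

Definition exp_poly (R : realType) (n : nat) (a : n.-tuple R[i]) :
    {poly R[i]} :=
  \prod_(x <- a) ('X - (exp2ipi x)%:P).

(* Matrices act on column vectors: C e_j = e_(j+1), and the last column
   carries the coefficients. The library's companionmx uses the transposed
   convention, and its dimension is tied to the size of p. *)
Definition companion (R : nzRingType) (n : nat) (p : {poly R}) : 'M[R]_n :=
  \matrix_(i < n, j < n)
    if j == n.-1 :> nat then - p`_i else (j.+1 == i :> nat)%:R.

Lemma companion_tr (R : nzRingType) (p : {poly R}) :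
  companion (size p).-1 p = (companionmx p)^T.
Proof. by apply/matrixP => i j; rewrite !mxE. Qed.

Section MatrixGroups.
Variables (K : fieldType) (n : nat).
Implicit Types (S G H : set 'M[K]_n).

(* 'M_n is a unit ring only for n of the form m.+1, and {'GL_n[K]} exists only
   for finite K, so subgroups of GL_n(K) are represented as sets of
   matrices. *)
Definition GL : set 'M[K]_n := [set M | M \in unitmx].

Definition is_subgroup H :=
  [/\ H `<=` GL,
      H 1%:M,
      forall M N, H M -> H N -> H (M *m N)
    & forall M, H M -> H (invmx M)].

Definition generated S : set 'M[K]_n := smallest is_subgroup S.

(* Evaluation at the n * n entries of M of a polynomial in as many variables;
   mpoly.mpoly m K is {mpoly K[m]}, whose notations clash with those of
   the analysis library. *)
Definition mxeval (M : 'M[K]_n) (p : mpoly.mpoly (n * n) K) : K :=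
  mpoly.meval (fun k => mxvec M 0 k) p.

(* The Zariski topology on GL_n is the one induced from the affine space of
   all matrices: allowing powers of 1 / det gives the same closed sets. *)
Definition zariski_closure S : set 'M[K]_n :=
  [set M | GL M /\
     forall p, (forall N, S N -> mxeval N p = 0) -> mxeval M p = 0].

(* The matrices over K coming from GL_n(Z). *)
Definition GLZ : set 'M[K]_n :=
  [set map_mx intr M | M in [set M : 'M[int]_n | M \in unitmx]].

Definition integral_points G : set 'M[K]_n := G `&` GLZ.

Definition left_cosets G H : set (set 'M[K]_n) :=
  [set [set M *m N | N in H] | M in G].

Definition finite_index G H := finite_set (left_cosets G H).

(* Arithmeticity and thinness make sense only for subgroups of the integral
   points of their Zariski closure; this is part of both definitions. *)
Definition arithmetic H :=
  H `<=` integral_points (zariski_closure H) /\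
  finite_index (integral_points (zariski_closure H)) H.

Definition thin H :=
  H `<=` integral_points (zariski_closure H) /\
  ~ finite_index (integral_points (zariski_closure H)) H.

End MatrixGroups.

(* The standing assumption that no a_j - b_k is an integer is not needed to
   form the group. *)
Definition hypergeometric_group (R : realType) (n : nat)
    (a b : n.-tuple R[i]) : set 'M[R[i]]_n :=
  generated [set companion n (exp_poly a); companion n (exp_poly b)].

(* Main.v *)
Require Import Defs.
From Stdlib Require Import ZArith.
From mathcomp Require Import all_boot all_order all_algebra.
From mathcomp Require Import boolp classical_sets functions cardinality.
From mathcomp Require Import reals exp trigo complex ssrZ zify ring lra.
From mathcomp Require mpoly.

(** Let f = (x - 1)^6 and g be the two polynomials, A and B their companion
    matrices, and T = B A^-1. As f(0) = g(0), T is a transvection: it sends x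
    to x - x_1 v, where v is the vector of coefficients of f - g. The group
    Gamma is generated by T and B. Two facts make its index infinite.

    1. An element of Gamma that fixes v is a power of T ([stabiliser_fixes]).
    This is a ping-pong argument. There are four polyhedral cones, one for each
    of the letters T, T^-1, B, B^-1, such that a letter l sends the cone of a
    letter s into plus or minus the cone of l, unless s is the inverse of l.
    The cones of T and T^-1 contain v, so that a reduced word with first letter
    l sends v into plus or minus the cone of l ([ping_pong]). The first
    coordinate vanishes at v, but at no non-zero vector of the cones of B and
    B^-1; hence a reduced word that fixes v cannot begin with B or B^-1, and
    removing its initial powers of T one finds that it has no other letters.

    What suggests such cones is that Gamma is the monodromy group of a
    hypergeometric equation on the sphere with three punctures, where A, T and B
    are the local monodromies, all of infinite order. The fundamental group
    acts on the boundary circle of the hyperbolic plane; the fixed points of T,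
    A, B and T A T^-1 cut this circle into four arcs, one for each letter, which
    the letters permute as in the Schottky picture of a free group of rank two.
    The cone of a letter is the linear counterpart of an arc: it has to contain,
    up to sign, all w v for w a reduced word beginning with this letter. The
    cones are given by generators, and each inclusion is certified by writing
    the images of the generators as non-negative combinations ([in_coneP]). As f
    and g are palindromic, reversing the order of the coordinates exchanges A
    and A^-1, and B and B^-1; this halves the number of cones.

    2. The Zariski closure of Gamma contains the matrices 1 + m W, for m
    natural, where W is an integral matrix of square zero that kills v and is
    not a multiple of T - 1. Indeed, the transvections attached to q = A v and
    r = A^-1 v, that is A T A^-1 and A^-1 T A, belong to Gamma, and a
    polynomial that vanishes on all powers of a unipotent matrix 1 + E with
    E^2 = 0 vanishes on the whole line 1 + t E ([zariski_closure_unip3]).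
    Conjugating the first one-parameter group by a well-chosen rational element
    of the second gives the transvections attached to q + r or q - r, and one of
    these two vectors is orthogonal to v for the invariant symplectic form.

    By 1, no 1 + m W with m > 0 lies in Gamma, so that the matrices 1 + m W
    represent infinitely many cosets ([thin_of_unip]). *)

Set Implicit Arguments.
Unset Strict Implicit.
Unset Printing Implicit Defensive.

Import Order.TTheory GRing.Theory Num.Theory.
Local Open Scope ring_scope.
Local Open Scope classical_set_scope.

(** * Polyhedral cones *)

Section Cones.
Variables (K : numFieldType) (V : lmodType K).
Implicit Types (S : seq V) (x y : V).

Inductive cone S : V -> Prop :=
| cone0 : cone S 0
| coneD x c y : cone S x -> 0 <= c -> y \in S -> cone S (x + c *: y).

Lemma cone_add S x y : cone S x -> cone S y -> cone S (x + y).
Proof.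
move=> Sx; elim=> [|y' c g Sy' IH c0 gS]; first by rewrite addr0.
by rewrite addrA; apply: coneD.
Qed.

Lemma cone_scale S c x : 0 <= c -> cone S x -> cone S (c *: x).
Proof.
move=> c0; elim=> [|y d g Sy IH d0 gS]; first by rewrite scaler0; exact: cone0.
by rewrite scalerDr scalerA; apply: coneD => //; apply: mulr_ge0.
Qed.

Lemma cone_gen S x : x \in S -> cone S x.
Proof.
by move=> xS; rewrite -[x]add0r -[x]scale1r; apply: coneD => //; exact: cone0.
Qed.

(** A linear form that is positive on the generators can vanish only at the
    apex: this is how a cone is seen to avoid a given vector. *)
Lemma cone_pos S (f : V -> K) : scalar f ->
  (forall x, x \in S -> 0 < f x) ->
  forall x, cone S x -> 0 <= f x /\ (f x = 0 -> x = 0).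
Proof.
move=> fS f0 x; elim=> [|y c g _ [fy0 fyE] c0 gS].
  by split=> //; have := fS (-1) 0 0; rewrite scaler0 addr0 mulN1r addNr => ->.
have fcg : 0 <= c * f g by apply: mulr_ge0 => //; apply/ltW/f0.
rewrite addrC fS; split; first exact: addr_ge0.
rewrite addrC [X in _ -> X = _]addrC.
move/eqP; rewrite paddr_eq0 // => /andP[/eqP /fyE -> ].
by rewrite mulf_eq0 (gt_eqF (f0 _ gS)) orbF => /eqP->; rewrite scale0r addr0.
Qed.

End Cones.

Lemma cone_linear (K : numFieldType) (V W : lmodType K) (f : {linear V -> W})
    (S : seq V) (S' : seq W) :
  (forall x, x \in S -> cone S' (f x)) -> forall x, cone S x -> cone S' (f x).
Proof.
move=> fS x; elim=> [|y c g _ IH c0 gS]; first by rewrite linear0; exact: cone0.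
rewrite linearD linearZ; apply: cone_add => //.
by apply: cone_scale => //; exact: fS.
Qed.

(** * Reduced words and ping-pong *)

Section Words.
Variables (K : fieldType) (n : nat) (L : eqType) (inv : L -> L).
Hypothesis invK : involutive inv.
Variable g : L -> 'M[K]_n.
Hypothesis gK : forall l, g (inv l) *m g l = 1%:M.
Implicit Types (w : seq L).

Definition word_mx w := foldr (fun l M => g l *m M) 1%:M w.
Definition reduced w := sorted (fun l s => s != inv l) w.

Lemma word_mx_cat w1 w2 : word_mx (w1 ++ w2) = word_mx w1 *m word_mx w2.
Proof. by elim: w1 => [|l w1 IH] /=; rewrite ?mul1mx // IH mulmxA. Qed.

Lemma word_mx_inv w : word_mx (rev (map inv w)) *m word_mx w = 1%:M.
Proof.
elim: w => [|l w IH] /=; first by rewrite mulmx1.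
rewrite rev_cons -cats1 word_mx_cat /= mulmx1.
by rewrite -mulmxA (mulmxA (g (inv l))) gK mul1mx.
Qed.

(** Multiplying a reduced word by one letter on the left creates at most one
    cancellation, at the front. *)
Lemma word_mx_reduce w : exists2 w', reduced w' & word_mx w' = word_mx w.
Proof.
elim: w => [|l w [w' w'r w'E]]; first by exists [::].
case: w' w'r w'E => [|s w'] w'r w'E; first by exists [:: l] => //=; rewrite -w'E.
have [sl|sl] := eqVneq s (inv l); last first.
  by exists (l :: s :: w'); rewrite /= ?sl -?w'E.
exists w'; first exact: path_sorted w'r.
by rewrite /= -w'E sl /= mulmxA -{1}[l]invK gK mul1mx.
Qed.

Lemma generated_words (S : set 'M[K]_n) :
  (forall M, S M -> exists w, M = word_mx w) ->
  forall M, generated S M -> exists2 w, reduced w & M = word_mx w.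
Proof.
move=> Sw M; suff: generated S `<=` [set M | exists w, M = word_mx w].
  move=> /[apply] -[w ->]; have [w' w'r <-] := word_mx_reduce w.
  by exists w'.
apply: smallest_sub => // {Sw}; split.
- move=> _ [w ->]; rewrite /GL /=.
  by case/mulmx1_unit: (word_mx_inv w).
- by exists [::].
- by move=> _ _ [w ->] [w' ->]; exists (w ++ w'); rewrite word_mx_cat.
- move=> _ [w ->]; exists (rev (map inv w)).
  have [_ u] := mulmx1_unit (word_mx_inv w).
  by rewrite -[RHS](mulmxK u) word_mx_inv mul1mx.
Qed.

(** As nothing cancels in a reduced word, every letter acts on a vector of the
    set attached to the letter that follows it. *)
Lemma ping_pong (P : L -> set 'cV[K]_n) (v : 'cV[K]_n) :
  (forall l, P l (g l *m v)) ->
  (forall l s x, s != inv l -> P s x -> P l (g l *m x)) ->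
  forall l w, reduced (l :: w) -> P l (word_mx (l :: w) *m v).
Proof.
move=> Pv Pg l w; elim: w l => [|s w IH] l /=; first by rewrite mulmx1.
by case/andP=> sl wr; rewrite -mulmxA; apply: Pg sl (IH _ wr).
Qed.

(** The letters that fix [v] can be stripped from the front of a word fixing
    [v]; the first letter left over, if any, would put [v] into a set that
    does not contain it. *)
Lemma ping_pong_stab (P : L -> set 'cV[K]_n) (v : 'cV[K]_n) (fixes : pred L) :
  (forall l, P l (g l *m v)) ->
  (forall l s x, s != inv l -> P s x -> P l (g l *m x)) ->
  (forall l, fixes l -> g l *m v = v) ->
  (forall l, ~~ fixes l -> ~ P l v) ->
  forall w, reduced w -> word_mx w *m v = v -> all fixes w.
Proof.
move=> Pv Pg gv Pv' w; elim: w => //= l w IH wr wv.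
have [lf|lf] := boolP (fixes l); last first.
  by case: (Pv' l lf); rewrite -{1}wv; exact: ping_pong.
apply: IH; first exact: path_sorted wr.
have := congr1 (mulmx (g (inv l))) wv.
by rewrite -[in RHS](gv _ lf) !mulmxA gK !mul1mx.
Qed.

End Words.

(** * Unipotent one-parameter groups and infinite index *)

Section Thin.
Variables (K : numFieldType) (n : nat).
Implicit Types (E M N : 'M[K]_n) (H : set 'M[K]_n).

Definition unip E (a : K) : 'M[K]_n := 1%:M + a *: E.

Lemma unip0 E : unip E 0 = 1%:M.
Proof. by rewrite /unip scale0r addr0. Qed.

Lemma unipD E a b : E *m E = 0 -> unip E a *m unip E b = unip E (a + b).
Proof.
move=> EE; rewrite /unip mulmxDl mul1mx mulmxDr mulmx1 -scalemxAl -scalemxAr EE.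
by rewrite !scaler0 addr0 scalerDl -addrA [a *: E + _]addrC.
Qed.

Lemma subgroup_unip H E (m : nat) :
  is_subgroup H -> E *m E = 0 -> H (1%:M + E) -> H (unip E m%:R).
Proof.
move=> [_ H1 HM _] EE HE; elim: m => [|m IH]; first by rewrite unip0.
by rewrite -natr1 -unipD //; apply: HM => //; rewrite /unip scale1r.
Qed.

(** A polynomial in the entries becomes a polynomial in one variable along a
    line; infinitely many zeros on the line make it vanish there. *)
Lemma mxeval_line (p : mpoly.mpoly (n * n) K) M N :
  exists q : {poly K}, forall t, mxeval (M + t *: N) p = q.[t].
Proof.
pose c k := (mxvec N 0 k) *: 'X + (mxvec M 0 k)%:P : {poly K}.
exists (\sum_(m <- mpoly.msupp p)
   mpoly.mcoeff m p *: \prod_i c i ^+ (mpoly.fun_of_multinom m i)) => t.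
rewrite /mxeval mpoly.mevalE horner_sum; apply: eq_bigr => m _.
rewrite hornerZ horner_prod; congr (_ * _); apply: eq_bigr => i _.
rewrite horner_exp /c hornerD hornerZ hornerX hornerC !linearD !linearZ /= !mxE.
by rewrite addrC mulrC.
Qed.

Lemma mxeval_line_eq0 (p : mpoly.mpoly (n * n) K) M N :
  (forall m : nat, mxeval (M + m%:R *: N) p = 0) ->
  forall t, mxeval (M + t *: N) p = 0.
Proof.
move=> p0; have [q qE] := mxeval_line p M N.
suff q0 : q = 0 by move=> t; rewrite qE q0 horner0.
apply/eqP/negPn/negP => q0.
have := max_poly_roots (rs := [seq i%:R | i <- iota 0 (size q)]) q0.
rewrite size_map size_iota ltnn => H; apply/notF/H.
  by apply/allP => _ /mapP[m _ ->]; rewrite rootE -qE p0.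
by rewrite map_inj_uniq ?iota_uniq // => i j /eqP; rewrite eqr_nat => /eqP.
Qed.

Lemma mxeval_unip (p : mpoly.mpoly (n * n) K) E M N :
  (forall m : nat, mxeval (M *m unip E m%:R *m N) p = 0) ->
  forall t, mxeval (M *m unip E t *m N) p = 0.
Proof.
have e t : M *m unip E t *m N = M *m N + t *: (M *m E *m N).
  by rewrite /unip mulmxDr mulmx1 mulmxDl -scalemxAr -scalemxAl.
by move=> p0 t; rewrite e mxeval_line_eq0 // => m; rewrite -e.
Qed.

(** A polynomial that vanishes on H vanishes at these products for natural
    parameters; by [mxeval_unip] the parameters can be freed one at a time. *)
Lemma zariski_closure_unip3 H E1 E2 E3 (a b c : K) :
  is_subgroup H -> E1 *m E1 = 0 -> E2 *m E2 = 0 -> E3 *m E3 = 0 ->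
  H (1%:M + E1) -> H (1%:M + E2) -> H (1%:M + E3) ->
  zariski_closure H (unip E1 a *m unip E2 b *m unip E3 c).
Proof.
move=> Hs E11 E22 E33 H1 H2 H3; split.
  have u E d : E *m E = 0 -> unip E d \in unitmx.
    move=> EE; apply: (proj1 (mulmx1_unit (B := unip E (- d)) _)).
    by rewrite unipD // subrr unip0.
  by rewrite /GL /= !unitmx_mul !u.
move=> p p0.
(* the parameters are replaced by natural numbers from the last to the first *)
rewrite -[unip E3 c]mulmx1 mulmxA; apply: (@mxeval_unip p) => k; rewrite mulmx1.
apply: (@mxeval_unip p) => m.
rewrite -[unip E1 a]mul1mx -[X in mxeval X _]mulmxA.
apply: (@mxeval_unip p) => l.
rewrite mul1mx mulmxA; apply: p0.
have [_ _ HM _] := Hs.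
by apply: (HM); [apply: HM|]; apply: subgroup_unip.
Qed.

(** Two of the matrices 1 + m E lie in the same coset of H only if their
    quotient, again of this form, lies in H. *)
Lemma thin_of_unip H E :
  is_subgroup H -> H `<=` @GLZ K n -> E *m E = 0 ->
  (forall m : nat, GLZ (unip E m%:R)) ->
  (forall m : nat, zariski_closure H (unip E m%:R)) ->
  (forall m : nat, H (unip E m.+1%:R) -> False) ->
  thin H.
Proof.
move=> Hs HZ EE EZ Ecl EH; split.
  move=> M HM; split; last exact: HZ.
  by split=> [|p]; [case: Hs => + _ _ _; apply|apply].
pose coset m := [set unip E m%:R *m N | N in H].
have coset_inj : injective coset.
  suff lt m k : (m < k)%N -> coset m <> coset k.
    by move=> m k mk; case: (ltngtP m k) => // /lt; rewrite mk.
  move=> mk mkE; have [d dE] : exists d, k = (m + d.+1)%N.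
    by exists (k - m.+1)%N; rewrite addnS -addSn subnKC.
  have : coset k (unip E k%:R).
    by exists 1%:M; [case: Hs|rewrite mulmx1].
  rewrite -mkE => -[N HN NE]; apply: (EH d).
  suff -> : unip E d.+1%:R = N by [].
  have := congr1 (mulmx (unip E (- m%:R))) NE.
  rewrite mulmxA !unipD // addNr unip0 mul1mx => ->.
  by rewrite dE natrD addKr.
move=> fin; apply: infinite_nat.
apply: sub_finite_set (finite_preimage (in2W coset_inj) fin) => m _ /=.
by exists (unip E m%:R).
Qed.

End Thin.

(** * Subgroups of GL_n(Z) *)

Lemma generated_subgroup (K : fieldType) n (S : set 'M[K]_n) :
  S `<=` @GL K n -> is_subgroup (generated S).
Proof.
move=> SGL; have GLs : is_subgroup (@GL K n).
  split=> [//||M N Mu Nu|M Mu]; rewrite /GL /=; first exact: unitmx1.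
    by rewrite unitmx_mul; apply/andP.
  by rewrite unitmx_inv.
split.
- exact: smallest_sub.
- by move=> G [[_ G1 _ _] _].
- move=> M N HM HN G GS; have [[_ _ GM _] _] := GS.
  by apply: GM; [exact: HM|exact: HN].
- by move=> M HM G GS; have [[_ _ _ GV] _] := GS; apply: GV; exact: HM.
Qed.

Section GLZ.
Variables (K : numFieldType) (n : nat).
Implicit Types M N : 'M[K]_n.

Let intr_mulmx (M N : 'M[int]_n) :
  map_mx intr (M *m N) = map_mx intr M *m map_mx intr N :> 'M[K]_n.
Proof. exact: (map_mxM (intr : {rmorphism int -> K})). Qed.

Let intr_mx1 : map_mx intr (1%:M : 'M[int]_n) = 1%:M :> 'M[K]_n.
Proof. exact: (map_mx1 (intr : {rmorphism int -> K})). Qed.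

Lemma GLZ_intr (M N : 'M[int]_n) :
  map_mx intr M *m map_mx intr N = 1%:M :> 'M[K]_n ->
  GLZ (map_mx intr M : 'M[K]_n).
Proof.
rewrite -intr_mulmx -intr_mx1 => /matrixP MN1.
have MN : M *m N = 1%:M.
  by apply/matrixP => i j; apply: (@intr_inj K); have := MN1 i j; rewrite !mxE.
by exists M => //=; have [] := mulmx1_unit MN.
Qed.

Lemma GLZ_subgroup : is_subgroup (@GLZ K n).
Proof.
have inv (M : 'M[int]_n) : M \in unitmx ->
    map_mx intr M *m map_mx intr (invmx M) = 1%:M :> 'M[K]_n.
  by move=> Mu; rewrite -intr_mulmx mulmxV // intr_mx1.
split.
- by move=> _ [M /= /inv Mu <-]; have [] := mulmx1_unit Mu.
- by exists 1%:M; rewrite /= ?unitmx1 ?intr_mx1.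
- move=> _ _ [M /= Mu <-] [N /= Nu <-]; exists (M *m N); last exact: intr_mulmx.
  by rewrite /= unitmx_mul Mu.
- move=> _ [M /= Mu <-]; exists (invmx M); first by rewrite /= unitmx_inv.
  have [u _] := mulmx1_unit (inv _ Mu).
  by rewrite -[RHS]mulmx1 -(inv _ Mu) mulmxA mulVmx // mul1mx.
Qed.

End GLZ.

(** * The criterion for thinness *)

Section Criterion.
Variables (K : numFieldType) (n : nat) (A Ai B Bi J : 'M[K]_n).
Hypotheses (AK : Ai *m A = 1%:M) (BK : Bi *m B = 1%:M) (JJ : J *m J = 1%:M).
Let T := B *m Ai.
Let Ti := A *m Bi.
Hypotheses (JT : J *m T *m J = Ti) (JB : J *m B *m J = Bi).
Variables (C : bool -> seq 'cV[K]_n) (v : 'cV[K]_n) (f : 'cV[K]_n -> K).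
Hypotheses (f_scalar : scalar f) (vC : v \in C true) (v0 : v != 0).
Hypotheses (Tv : T *m v = v) (Jv : J *m v = v) (fv : f v = 0).

(** A letter is a pair of booleans: the first tells T^(+-1) from B^(+-1), the
    second is set for the inverses. *)
Definition letter_inv (l : bool * bool) := (l.1, ~~ l.2).

Definition letter_mx (l : bool * bool) : 'M[K]_n :=
  if l.1 then if l.2 then Ti else T else if l.2 then Bi else B.

Definition letter_gens (l : bool * bool) : seq 'cV[K]_n :=
  if l.2 then [seq J *m x | x <- C l.1] else C l.1.

(* the sign e is common to a whole cone, which is what makes an inclusion up to
   sign a statement on generators *)
Hypothesis C_step : forall (l : bool) s, s != (l, true) ->
  exists2 e, e ^+ 2 = 1 &
  forall x, x \in letter_gens s -> cone (C l) (e *: (letter_mx (l, false) *m x)).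
Hypotheses (f_gt0 : forall x, x \in C false -> 0 < f x)
           (f_lt0 : forall x, x \in C false -> f (J *m x) < 0).

Definition letter_cone l : set 'cV[K]_n :=
  [set x | cone (letter_gens l) x \/ cone (letter_gens l) (- x)].

Lemma letter_invK : involutive letter_inv.
Proof. by case=> a b; rewrite /letter_inv /= negbK. Qed.

Lemma letter_mxJ l : letter_mx (letter_inv l) = J *m letter_mx l *m J.
Proof.
have JJm X : J *m (J *m X *m J) *m J = X.
  by rewrite -!mulmxA JJ mulmx1 mulmxA JJ mul1mx.
by case: l => [[] []]; rewrite /letter_mx /= -?JT -?JB ?JJm.
Qed.

Lemma letter_mxK l : letter_mx (letter_inv l) *m letter_mx l = 1%:M.
Proof.
have AK' := mulmx1C AK; have BK' := mulmx1C BK.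
case: l => [[] []]; rewrite /letter_mx /T /Ti //= -mulmxA.
  by rewrite (mulmxA Ai) AK mul1mx.
by rewrite (mulmxA Bi) BK mul1mx.
Qed.

Lemma letter_coneN l x : letter_cone l x -> letter_cone l (- x).
Proof. by case=> ?; [right; rewrite opprK|left]. Qed.

Lemma letter_coneJ l x : letter_cone l x -> letter_cone (letter_inv l) (J *m x).
Proof.
have JC y : cone (letter_gens l) y -> cone (letter_gens (letter_inv l)) (J *m y).
  apply: (@cone_linear _ _ _ (mulmx J)) => {}y.
  case: l => a [] /=; rewrite /letter_gens /=.
    by case/mapP=> z zC ->; rewrite mulmxA JJ mul1mx; exact: cone_gen.
  by move=> yC; apply/cone_gen/map_f.
by case=> /JC ?; [left|right; rewrite -mulmxN].
Qed.

(** For the inverse letters this is the case of T and B conjugated by J. *)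
Lemma letter_cone_step l s x : s != letter_inv l ->
  letter_cone s x -> letter_cone l (letter_mx l *m x).
Proof.
have step a t y : t != (a, true) -> letter_cone t y ->
    letter_cone (a, false) (letter_mx (a, false) *m y).
  move=> ta ty; have [e e2 eC] := C_step ta.
  have {}eC z : cone (letter_gens t) z ->
      cone (C a) (e *: (letter_mx (a, false) *m z)).
    rewrite scalemxAl; apply: (@cone_linear _ _ _ (mulmx _)) => {}z.
    by move/eC; rewrite scalemxAl.
  have : letter_cone (a, false) (e *: (letter_mx (a, false) *m y)).
    by case: ty => /eC; rewrite ?mulmxN ?scalerN; [left|right].
  have /eqP := e2; rewrite sqrf_eq1 => /pred2P[] ->; rewrite ?scale1r //.
  by rewrite scaleN1r => /letter_coneN; rewrite opprK.
case: l => a [] sa sx; last exact: step sx.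
rewrite -[(a, true)]/(letter_inv (a, false)) letter_mxJ -!mulmxA.
apply: letter_coneJ; apply: (step a (letter_inv s)); last exact: letter_coneJ.
by case: s sa {sx} => b [] /=; rewrite /letter_inv /= !xpair_eqE ?andbF ?andbT.
Qed.

(** As J fixes [v], the cone of T^-1 contains [v] like that of T; each letter
    is therefore applied to a vector of a cone that it does not cancel. *)
Lemma letter_cone_base l : letter_cone l (letter_mx l *m v).
Proof.
have vT : letter_cone (true, false) v by left; exact: cone_gen.
have vt : letter_cone (true, true) v.
  by rewrite -Jv; exact: (@letter_coneJ (true, false)).
by case: l => [[] []]; [exact: letter_cone_step vt|exact: letter_cone_step vT..].
Qed.

(** The form f vanishes at [v] and has a strict sign on the generators of the
    cones of B and B^-1. *)
Lemma letter_cone_base_notin l : ~~ l.1 -> ~ letter_cone l v.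
Proof.
have fN x : f (- x) = - f x.
  have f0 : f 0 = 0.
    by have := f_scalar (-1) 0 0; rewrite scaler0 addr0 mulN1r addNr.
  by have := f_scalar (-1) x 0; rewrite !addr0 scaleN1r mulN1r f0 addr0.
case: l => [[] b] //= _ vb.
pose h x := (-1) ^+ b * f x.
have hS : scalar h by move=> a x y; rewrite /h f_scalar mulrDr mulrCA.
have h_gt0 x : x \in letter_gens (false, b) -> 0 < h x.
  rewrite /h /letter_gens; case: b {vb h hS} => /=; rewrite ?expr1 ?mulN1r.
    by case/mapP=> y yC ->; rewrite oppr_gt0 f_lt0.
  by rewrite expr0 mul1r; exact: f_gt0.
have hv x : cone (letter_gens (false, b)) x -> f x = 0 -> x = 0.
  by move=> /(cone_pos hS h_gt0)[_ hx] fx; apply: hx; rewrite /h fx mulr0.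
case: vb => /hv; rewrite ?fN fv ?oppr0 => /(_ erefl) /eqP.
  by rewrite (negPf v0).
by rewrite oppr_eq0 (negPf v0).
Qed.

Let H := generated [set A; B].

(** An element of the group that fixes [v] is a product of powers of T; what
    is used of this is that it fixes whatever T fixes. *)
Lemma stabiliser_fixes M (x : 'cV[K]_n) :
  H M -> M *m v = v -> T *m x = x -> M *m x = x.
Proof.
move=> HM Mv Tx.
have TiT : Ti *m T = 1%:M := letter_mxK (true, false).
have fix_Ti (y : 'cV[K]_n) : T *m y = y -> Ti *m y = y.
  by move=> Ty; rewrite -{1}Ty mulmxA TiT mul1mx.
have words N : [set A; B] N -> exists w, N = word_mx letter_mx w.
  case=> ->; [exists [:: (true, true); (false, false)]|exists [:: (false, false)]].
    by rewrite /= mulmx1 /letter_mx /= /Ti -mulmxA BK mulmx1.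
  by rewrite /= mulmx1.
have [w wr ME] := generated_words letter_invK letter_mxK words HM.
have wT : all (fun l => l.1) w.
  apply: (ping_pong_stab letter_mxK letter_cone_base letter_cone_step _
    letter_cone_base_notin wr); last by rewrite -ME.
  by case=> [[] []] //= _; exact: fix_Ti.
rewrite ME; elim: w wT {ME wr} => [|l w IH] /=; first by rewrite mul1mx.
case/andP=> lT /IH{}IH; rewrite -mulmxA IH.
by case: l lT => [[] []] //= _; exact: fix_Ti.
Qed.

Let E := T - 1%:M.
Variables (c eps : K) (W : 'M[K]_n) (x0 : 'cV[K]_n).
Hypotheses (EE : E *m E = 0) (c0 : c != 0).
(* This identity says that W is the conjugate of A E A^-1 by the element of
   parameter eps / c of the one-parameter group of A^-1 E A; multiplying by c^2
   makes it an identity between integral matrices. *)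
Hypothesis WE : c ^+ 2 *: W =
  (c%:M + eps *: (Ai *m E *m A)) *m (A *m E *m Ai) *m
  (c%:M - eps *: (Ai *m E *m A)).
Hypotheses (WW : W *m W = 0) (Wv : W *m v = 0) (Tx0 : T *m x0 = x0)
  (Wx0 : W *m x0 != 0).
Hypotheses (AZ : GLZ A) (BZ : GLZ B).
Hypothesis WZ : exists W' : 'M[int]_n, W = map_mx intr W'.

Lemma thin_criterion : thin H.
Proof.
have [GLZ_GL _ _ _] := GLZ_subgroup K n.
have SZ : [set A; B] `<=` @GLZ K n by move=> _ [] ->.
have Hs : is_subgroup H by apply: generated_subgroup => M /SZ /GLZ_GL.
have HZ : H `<=` @GLZ K n by apply: smallest_sub => //; exact: GLZ_subgroup.
have HA : H A by apply: sub_gen_smallest; left.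
have HB : H B by apply: sub_gen_smallest; right.
have [_ H1 HM HV] := Hs.
have invmxE (M Mi : 'M[K]_n) : Mi *m M = 1%:M -> invmx M = Mi.
  move=> MiM; have [_ Mu] := mulmx1_unit MiM.
  by rewrite -[LHS]mul1mx -MiM -mulmxA mulmxV // mulmx1.
have HAi : H Ai by rewrite -(invmxE _ _ AK); exact: HV.
have AAi := mulmx1C AK.
have HT : H T by apply: HM.
pose E1 := Ai *m E *m A; pose E2 := A *m E *m Ai.
have conj_nil (P Q : 'M[K]_n) : Q *m P = 1%:M ->
    (P *m E *m Q) *m (P *m E *m Q) = 0.
  by move=> QP; rewrite -!mulmxA (mulmxA Q) QP mul1mx (mulmxA E) EE mul0mx mulmx0.
have conj_H (P Q : 'M[K]_n) : H P -> H Q -> P *m Q = 1%:M ->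
    H (1%:M + P *m E *m Q).
  move=> HP HQ PQ; suff -> : 1%:M + P *m E *m Q = P *m T *m Q.
    by apply: (HM) => //; apply: (HM).
  by rewrite /E mulmxBr mulmx1 mulmxBl PQ addrC subrK.
have E11 : E1 *m E1 = 0 by apply: conj_nil.
have E22 : E2 *m E2 = 0 by apply: conj_nil.
have HE1 : H (1%:M + E1) by apply: conj_H.
have HE2 : H (1%:M + E2) by apply: conj_H.
pose a := eps / c.
have WE' b : unip W b = unip E1 a *m unip E2 b *m unip E1 (- a).
  have -> : unip E1 a *m unip E2 b *m unip E1 (- a) =
      1%:M + b *: (unip E1 a *m E2 *m unip E1 (- a)).
    rewrite {2}/unip mulmxDr mulmx1 mulmxDl unipD // subrr unip0.
    by rewrite -scalemxAr -scalemxAl.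
  congr (_ + _ *: _); apply: (scalerI (expf_neq0 2 c0)); rewrite WE -/E1 -/E2.
  have -> : c%:M + eps *: E1 = c *: unip E1 a.
    by rewrite scalerDr scalemx1 scalerA mulrC divfK.
  have -> : c%:M - eps *: E1 = c *: unip E1 (- a).
    by rewrite scalerDr scalemx1 scalerA mulrN scaleNr mulrC divfK.
  by rewrite -!scalemxAl -scalemxAr scalerA.
apply: (@thin_of_unip _ _ _ W) => //.
- move=> m; have [W' W'E] := WZ.
  have unipZ (k : int) : unip W k%:~R = map_mx intr (1%:M + k *: W').
    by rewrite W'E map_mxD map_mx1 map_mxZ.
  have := unipZ m%:Z; rewrite -pmulrn => ->.
  apply: (GLZ_intr (N := 1%:M + (- m%:Z) *: W')).
  by rewrite -!unipZ unipD // mulrNz subrr unip0.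
- by move=> m; rewrite WE'; apply: zariski_closure_unip3.
- move=> m Hm; have /(stabiliser_fixes Hm) : unip W m.+1%:R *m v = v.
    by rewrite /unip mulmxDl mul1mx -scalemxAl Wv scaler0 addr0.
  move/(_ _ Tx0)/eqP; rewrite /unip mulmxDl mul1mx -scalemxAl.
  rewrite addrC -subr_eq0 addrK.
  by rewrite scaler_eq0 pnatr_eq0 (negPf Wx0).
Qed.

End Criterion.

(** * Integer vectors and matrices as lists *)

Section IntegerLists.
Local Open Scope Z_scope.
Variable n : nat.
Implicit Types (x y : seq Z) (M N : seq (seq Z)).

(** Missing entries count as 0, in agreement with [cv] and [mx] below. *)
Fixpoint dot k x y : Z :=
  if k is k'.+1 then head 0 x * head 0 y + dot k' (behead x) (behead y) else 0.

Definition entry M i j : Z := nth 0 (nth [::] M i) j.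
Definition vec_of (e : nat -> Z) : seq Z := mkseq e n.
Definition mat_of (e : nat -> nat -> Z) : seq (seq Z) :=
  mkseq (fun i => mkseq (e i) n) n.

Definition vscale a x := vec_of (fun i => a * nth 0 x i).
Definition mulv M x := vec_of (fun i => dot n (nth [::] M i) x).
Definition mulm M N :=
  mat_of (fun i j => dot n (nth [::] M i) (vec_of (fun k => entry N k j))).
Definition axpym a M N := mat_of (fun i j => entry M i j + a * entry N i j).
Definition scalarm a := mat_of (fun i j => if i == j then a else 0).
Definition companion_list (p : seq Z) :=
  mat_of (fun i j => if j == n.-1 then - nth 0 p i
                     else if j.+1 == i then 1 else 0).

Definition lincomb (S : seq (seq Z)) (ps : seq (nat * Z)) : seq Z :=
  foldr (fun p y => let g := nth [::] S p.1 in
                    vec_of (fun i => p.2 * nth 0 g i + nth 0 y i)) [::] ps.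

Fixpoint pairs (s : seq Z) : seq (nat * Z) :=
  if s is i :: u :: s' then (Z.to_nat i, u) :: pairs s' else [::].

(** A certificate [:: d; i1; u1; i2; u2; ...] stands for the identity
    d x = u1 S_i1 + u2 S_i2 + ..., with d positive and the u's non-negative. *)
Definition in_cone S x (cert : seq Z) : bool :=
  let d := head 0 cert in let ps := pairs (behead cert) in
  [&& Z.ltb 0 d, all (fun p => Z.leb 0 p.2) ps & vscale d x == lincomb S ps].

End IntegerLists.

Section Transfer.
Variables (K : numFieldType) (n : nat).
Implicit Types (x y : seq Z) (M N : seq (seq Z)).

Definition ZK : Z -> K := intr \o int_of_Z.

Definition cv x : 'cV[K]_n := \col_i ZK (nth Z0 x i).
Definition mx M : 'M[K]_n := \matrix_(i, j) ZK (entry M i j).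

Lemma ZK0 : ZK Z0 = 0. Proof. exact: rmorph0. Qed.
Lemma ZK1 : ZK (Zpos 1) = 1. Proof. by []. Qed.
Lemma ZKD a b : ZK (Z.add a b) = ZK a + ZK b. Proof. exact: rmorphD. Qed.
Lemma ZKN a : ZK (Z.opp a) = - ZK a. Proof. exact: rmorphN. Qed.
Lemma ZKM a b : ZK (Z.mul a b) = ZK a * ZK b. Proof. exact: rmorphM. Qed.
Lemma ZK_ge0 a : Z.leb 0 a -> 0 <= ZK a.
Proof. by move=> a0; rewrite /ZK /= ler0z; lia. Qed.
Lemma ZK_gt0 a : Z.ltb 0 a -> 0 < ZK a.
Proof. by move=> a0; rewrite /ZK /= ltr0z; lia. Qed.
Lemma ZK_inj : injective ZK.
Proof. by move=> a b /intr_inj /(can_inj int_of_ZK). Qed.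

Lemma ZK_dot k x y :
  ZK (dot k x y) = \sum_(i < k) ZK (nth Z0 x i) * ZK (nth Z0 y i).
Proof.
elim: k x y => [|k IH] x y; first by rewrite big_ord0 ZK0.
rewrite big_ord_recl /= ZKD ZKM IH !nth0; congr (_ + _).
by apply: eq_bigr => i _; rewrite !nth_behead.
Qed.

Lemma nth_vec_of e (i : 'I_n) : nth Z0 (vec_of n e) i = e i.
Proof. exact: nth_mkseq. Qed.
Lemma entry_mat_of e (i j : 'I_n) : entry (mat_of n e) i j = e i j.
Proof. by rewrite /entry /mat_of !nth_mkseq. Qed.

Lemma cv_scale a x : cv (vscale n a x) = ZK a *: cv x.
Proof. by apply/colP => i; rewrite !mxE nth_vec_of ZKM. Qed.

Lemma cv_mulv M x : cv (mulv n M x) = mx M *m cv x.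
Proof.
apply/colP => i; rewrite !mxE nth_vec_of ZK_dot.
by apply: eq_bigr => j _; rewrite !mxE.
Qed.

Lemma mx_mulm M N : mx (mulm n M N) = mx M *m mx N.
Proof.
apply/matrixP => i j; rewrite !mxE entry_mat_of ZK_dot.
by apply: eq_bigr => k _; rewrite !mxE nth_vec_of.
Qed.

Lemma mx_axpym a M N : mx (axpym n a M N) = mx M + ZK a *: mx N.
Proof. by apply/matrixP => i j; rewrite !mxE entry_mat_of ZKD ZKM. Qed.

Lemma mx_scalarm a : mx (scalarm n a) = (ZK a)%:M.
Proof.
apply/matrixP => i j; rewrite !mxE entry_mat_of -val_eqE.
by case: eqP => _; rewrite ?mulr1n ?mulr0n ?ZK0.
Qed.

Lemma companion_Poly p : companion n (Poly (map ZK p)) = mx (companion_list n p).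
Proof.
apply/matrixP => i j; rewrite !mxE entry_mat_of coef_Poly.
have -> : (map ZK p)`_i = ZK (nth Z0 p i).
  have [ip|pi] := ltnP i (size p); first by rewrite (nth_map Z0).
  by rewrite !nth_default ?size_map ?ZK0.
by case: ifP => _; [rewrite ZKN|case: eqP => _; rewrite ?ZK0].
Qed.

Lemma cv_nil : cv [::] = 0.
Proof. by apply/colP => i; rewrite !mxE nth_nil ZK0. Qed.

Lemma in_coneP S x cert : in_cone n S x cert -> cone [seq cv y | y <- S] (cv x).
Proof.
rewrite /in_cone; set d := head _ _; set ps := pairs _.
case/and3P=> d0 ps0 /eqP dx; have {}d0 := ZK_gt0 d0.
have -> : cv x = (ZK d)^-1 *: cv (lincomb n S ps).
  by rewrite -dx cv_scale scalerA mulVf ?scale1r ?gt_eqF.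
apply: cone_scale; first by rewrite invr_ge0 ltW.
elim: ps ps0 {dx} => [|p ps IH] /=; first by rewrite cv_nil; constructor.
case/andP=> p0 /IH{}IH; set y := lincomb n S ps in IH *; set g := nth _ _ _.
have -> : cv (vec_of n (fun i => p.2 * nth Z0 g i + nth Z0 y i)%Z) =
    cv y + ZK p.2 *: cv g.
  by apply/colP => i; rewrite !mxE nth_vec_of ZKD ZKM addrC.
have [pS|Sp] := ltnP p.1 (size S); last first.
  by rewrite /g nth_default // cv_nil scaler0 addr0.
by apply: coneD (ZK_ge0 p0) _ => //; apply/map_f/mem_nth.
Qed.

Lemma mx_int M : exists M' : 'M[int]_n, mx M = map_mx intr M'.
Proof.
exists (\matrix_(i, j) int_of_Z (entry M i j)).
by apply/matrixP => i j; rewrite !mxE.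
Qed.

End Transfer.

(** * A decidable sufficient condition for thinness *)

Section PingPongCheck.
Local Open Scope Z_scope.
Variables (n : nat) (f g : seq Z) (CT CB : seq (seq Z)).
Variable certs : seq (seq (seq Z)).

Let A := companion_list n f.
Let B := companion_list n g.
(* f and g being palindromic, the inverses of A and B are their conjugates by
   the reversal of coordinates, and J is B times this reversal *)
Let Ai := rev (map rev A).
Let Bi := rev (map rev B).
Let J := map rev B.
Let T := mulm n B Ai.
Let id := scalarm n 1.
Let v := vec_of n (fun i => nth 0 f i - nth 0 g i).

Definition symmetry_check : bool :=
  let mul := mulm n in
  [&& mul Ai A == id, mul Bi B == id, mul J J == id,
      mul (mul J T) J == mul A Bi & mul (mul J B) J == Bi].

Definition vector_check : bool :=
  [&& v \in CT, has (fun a => a != 0) v, mulv n T v == v, mulv n J v == v,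
      nth 0 v 0 == 0 & all (fun x => Z.ltb (nth 0 x 0) 0) CB &&
      all (fun x => Z.ltb 0 (nth 0 (mulv n J x) 0)) CB].

Definition gens (s : bool * bool) :=
  let C := if s.1 then CT else CB in if s.2 then map (mulv n J) C else C.

(** As T x = x - x_1 v, the sign for T is the one of -x_1 on the cones of B and
    B^-1, which [vector_check] makes negative for the second. The sign for B is
    negative because a matrix that maps a cone into itself should have its
    spectral radius as an eigenvalue: 1 is an eigenvalue of -B, not of B. *)
Definition step_check (l : bool) (s : bool * bool) (cs : seq (seq Z)) : bool :=
  let sgn := if l && (s != (false, true)) then 1 else -1 in
  let M := if l then T else B in let C := if l then CT else CB in
  all2 (fun x => in_cone n C (vscale n sgn (mulv n M x))) (gens s) cs.

Definition steps : seq (bool * (bool * bool)) :=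
  [:: (true, (true, false)); (true, (false, false)); (true, (false, true));
      (false, (false, false)); (false, (true, false)); (false, (true, true))].

Definition step_checks : bool := all2 (fun p => step_check p.1 p.2) steps certs.

(** Since (T - 1) x = - x_1 v, the conjugates of T - 1 by A^-1 and A send x to
    (fr x) r and (fq x) q. The one-parameter group of the first conjugate takes
    q to q + e r at the parameter e / c, because c = fr q; W sends x to
    (fq x + e fr x) (q + e r), and e is chosen for it to kill v. *)
Definition transvection_check : bool :=
  let mul := mulm n in
  let E := axpym n (-1) T id in
  let zero := scalarm n 0 in
  let E1 := mul (mul Ai E) A in let E2 := mul (mul A E) Ai in
  let r := mulv n Ai v in let q := mulv n A v in
  let fr := vscale n (-1) (nth [::] A 0) in
  let fq := vscale n (-1) (nth [::] Ai 0) in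
  let c := dot n fr q in
  let e := if dot n fr v + dot n fq v == 0 then 1 else -1 in
  let W := mat_of n (fun i j => (nth 0 q i + e * nth 0 r i)
                              * (nth 0 fq j + e * nth 0 fr j)) in
  (* T - 1 only sees the first coordinate, so it kills x0 *)
  let x0 := vec_of n (fun i => if i == 1%nat then 1 else 0) in
  let zv := vec_of n (fun _ => 0) in
  [&& mul E E == zero, c != 0,
      axpym n (c * c) zero W ==
      mul (mul (axpym n e (scalarm n c) E1) E2) (axpym n (- e) (scalarm n c) E1),
      mul W W == zero, mulv n W v == zv, mulv n T x0 == x0 &
      has (fun a => a != 0) (mulv n W x0)].

Definition thin_check : bool :=
  [&& symmetry_check, vector_check, step_checks & transvection_check].

End PingPongCheck.

Lemma cv_neq0 (K : numFieldType) n x :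
  (size x <= n)%N -> has (fun a => a != Z0) x -> cv K n x != 0.
Proof.
move=> xn /(has_nthP Z0)[i ix xi0]; apply: contraNneq xi0 => x0.
have /colP/(_ (Ordinal (leq_trans ix xn))) := x0; rewrite !mxE /=.
by rewrite -(ZK0 K) => /ZK_inj ->.
Qed.

Lemma mx_GLZ (K : numFieldType) n M N :
  mx K n M *m mx K n N = 1%:M -> GLZ (mx K n M).
Proof.
by have [M' ->] := mx_int K n M; have [N' ->] := mx_int K n N; exact: GLZ_intr.
Qed.

Lemma all2_mem (S : eqType) (U : Type) (r : S -> U -> bool) xs us x :
  all2 r xs us -> x \in xs -> exists u, r x u.
Proof.
elim: xs us => [|y xs IH] [|u us] //= /andP[ru /IH{}IH].
by rewrite inE => /predU1P[->|/IH //]; exists u.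
Qed.

Lemma thin_of_check (K : numFieldType) (n : nat) (f g : seq Z) CT CB certs :
  thin_check n.+1 f g CT CB certs ->
  thin (generated [set companion n.+1 (Poly (map (@ZK K) f));
                       companion n.+1 (Poly (map (@ZK K) g))]).
Proof.
rewrite !companion_Poly; set m := n.+1.
set lA := companion_list m f; set lB := companion_list m g.
pose lAi := rev (map rev lA); pose lBi := rev (map rev lB).
pose lJ := map rev lB; pose lT := mulm m lB lAi.
pose v := vec_of m (fun i => Z.sub (nth Z0 f i) (nth Z0 g i)).
have mxE2 M N : M == N -> mx K m M = mx K m N by move/eqP->.
have cvE2 x y : x == y -> cv K m x = cv K m y by move/eqP->.
have ZKN1 : ZK K (Zneg 1) = - 1 by rewrite (ZKN _ (Zpos 1)) ZK1.
have id1 : mx K m (scalarm m (Zpos 1)) = 1%:M by rewrite mx_scalarm ZK1.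
have zero0 : mx K m (scalarm m Z0) = 0.
  by rewrite mx_scalarm ZK0 -scalemx1 scale0r.
case/and4P.
rewrite /symmetry_check -/lA -/lB -/lAi -/lBi -/lJ -/lT.
case/and5P=> /mxE2 + /mxE2 + /mxE2 + /mxE2 + /mxE2.
rewrite !mx_mulm id1 => AK BK JJ JT JB.
rewrite /vector_check -/lA -/lB -/lAi -/lJ -/lT -/v.
case/and5P=> vCT v0 /cvE2 + /cvE2 + /and3P[/eqP fv /allP fB /allP fJB].
rewrite !cv_mulv => Tv Jv checks.
rewrite /transvection_check -/lA -/lB -/lAi -/lJ -/lT -/v.
set E := axpym _ _ _ _; set E1 := mulm _ _ lA; set E2 := mulm _ _ lAi.
set c := dot _ _ _; set e := if _ then _ else _; set W := mat_of _ _.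
set x0 := vec_of _ (fun i => if _ then _ else _).
case/andP=> /mxE2 EE /andP[c0] /and5P[/mxE2 WE /mxE2 WW /cvE2 Wv /cvE2 Tx0 Wx0].
pose C (b : bool) := [seq cv K m y | y <- if b then CT else CB].
pose h (x : 'cV[K]_m) := - x 0 0.
have lTE : mx K m lT = mx K m lB *m mx K m lAi by exact: mx_mulm.
rewrite lTE in Tv.
have EK : mx K m E = mx K m lB *m mx K m lAi - 1%:M.
  by rewrite mx_axpym mx_mulm id1 ZKN1 scaleN1r.
have cvhE x : h (cv K m x) = - ZK K (nth Z0 x 0) by rewrite /h mxE.
have crit := @thin_criterion K m _ _ _ _ _ AK BK JJ JT JB C (cv K m v) h
  _ _ _ Tv Jv _ _ _ _ (ZK K c) (ZK K e) (mx K m W) (cv K m x0).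
apply: crit.
- by move=> a x y; rewrite /h !mxE opprD mulrN.
- exact: map_f.
- by apply: cv_neq0 => //; rewrite size_mkseq.
- by rewrite cvhE fv ZK0 oppr0.
- move=> l s ls.
  exists (ZK K (if l && (s != (false, true)) then Zpos 1 else Zneg 1)).
    by case: ifP => _; rewrite ?ZKN1 ?ZK1 ?sqrrN expr1n.
  have [cs step] : exists cs, step_check m f g CT CB l s cs.
    by apply: (all2_mem (x := (l, s)) checks); case: l s ls => [] [[] []].
  have -> : letter_gens (mx K m lJ) C s = [seq cv K m y | y <- gens m g CT CB s].
    rewrite /letter_gens /gens /C; case: s.2 => //.
    by rewrite -[LHS]map_comp -[RHS]map_comp; apply: eq_map => y; rewrite [LHS]/= -cv_mulv.
  move=> _ /mapP[y /(all2_mem step)[cert /(in_coneP K)] + ->].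
  rewrite cv_scale cv_mulv.
  case: l {ls step} => //=.
  by rewrite mx_mulm.
- move=> _ /mapP[x xB ->]; rewrite cvhE -ZKN; apply: ZK_gt0.
  by move: (fB _ xB) => /Z.ltb_lt ?; apply/Z.ltb_lt; lia.
- move=> _ /mapP[x xB ->]; rewrite -cv_mulv cvhE oppr_lt0.
  exact: ZK_gt0 (fJB _ xB).
- by rewrite -EK -mx_mulm EE zero0.
- by rewrite -(ZK0 K) (inj_eq (@ZK_inj K)).
- have := WE; rewrite !(mx_axpym, mx_mulm) zero0 add0r !mx_scalarm ZKM -expr2 => ->.
  by rewrite ZKN1 ZK1 scaleN1r ZKN scaleNr.
- by rewrite -mx_mulm WW.
- rewrite -cv_mulv Wv; apply/colP => i; by rewrite !mxE nth_vec_of ZK0.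
- by rewrite -lTE -cv_mulv Tx0.
- by rewrite -cv_mulv; apply: cv_neq0 => //; rewrite size_mkseq.
- exact: mx_GLZ (mulmx1C AK).
- exact: mx_GLZ (mulmx1C BK).
- exact: mx_int.
Qed.

(** * Cyclotomic factors *)

Section Coefficients.
Local Open Scope Z_scope.

Definition coef_f : seq Z := [:: 1; -6; 15; -20; 15; -6; 1].
Definition coef_g1 : seq Z := [:: 1; 6; 15; 20; 15; 6; 1].
Definition coef_g2 : seq Z := [:: 1; 5; 11; 14; 11; 5; 1].
Definition coef_g3 : seq Z := [:: 1; 4; 7; 8; 7; 4; 1].
Definition coef_g4 : seq Z := [:: 1; 3; 3; 2; 3; 3; 1].
Definition coef_g5 : seq Z := [:: 1; 4; 8; 10; 8; 4; 1].
Definition coef_g6 : seq Z := [:: 1; 3; 5; 6; 5; 3; 1].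
Definition coef_g7 : seq Z := [:: 1; 3; 4; 4; 4; 3; 1].

End Coefficients.

Section RootsOfUnity.
Variable R : realType.
Local Open Scope complex_scope.

Definition cis (t : R) : R[i] := cos t +i* sin t.

Lemma cisD s t : cis (s + t) = cis s * cis t.
Proof.
rewrite /cis cosD sinD; apply/eqP.
by rewrite eq_complex /= [sin s * _ + _]addrC !eqxx.
Qed.

Lemma exp2ipi_real (x : R) : exp2ipi x%:C = cis (2 * pi * x).
Proof.
rewrite /exp2ipi /cexp /cis.
have -> : 2 * pi%:C * 'i * x%:C = 0 +i* (2 * pi * x).
  by apply/eqP; rewrite eq_complex /=; apply/andP; split; apply/eqP; ring.
by rewrite expR0 mul1r.
Qed.

Lemma cis_neq1 t : 0 < t -> t < 2 * pi -> cis t != 1.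
Proof.
move=> t0 t2; apply/eqP => /eqP; rewrite eq_complex /= => /andP[/eqP ct _].
have s0 : 0 < sin (t / 2) by apply: sin_gt0_pi; lra.
have := cosD (t / 2) (t / 2); rewrite -splitr ct.
have := cos2Dsin2 (t / 2); nra.
Qed.

Lemma cisX t k : cis t ^+ k = cis (t *+ k).
Proof.
elim: k => [|k IH]; first by rewrite expr0 mulr0n /cis cos0 sin0.
by rewrite exprS IH mulrS cisD.
Qed.

Definition zeta n : R[i] := cis (2 * pi / n%:R).

Lemma exp2ipi_ratr k n : exp2ipi (ratr (k%:R / n%:R)) = zeta n ^+ k.
Proof.
rewrite fmorph_div !rmorph_nat.
have -> : k%:R / n%:R = (k%:R / n%:R : R)%:C by rewrite fmorph_div !rmorph_nat.
by rewrite exp2ipi_real cisX -mulr_natr; congr cis; ring.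
Qed.

(** The order m of zeta n divides n, and m < n would put the angle 2 pi m / n
    strictly between 0 and 2 pi. *)
Lemma zeta_prim n : (0 < n)%N -> n.-primitive_root (zeta n).
Proof.
move=> n0; have n0' : (n%:R : R) != 0 by rewrite pnatr_eq0 -lt0n.
have n1 : zeta n ^+ n = 1.
  by rewrite cisX -[_ *+ n]mulr_natr divfK // mulrC mulr_natr /cis cos2pi sin2pi.
have [m mn dm] := prim_order_exists n0 n1.
case: (eqVneq n m) => [nm|m_ne]; first by rewrite {1}nm.
have m0 := prim_order_gt0 mn.
have mlt : (m < n)%N by rewrite ltn_neqAle eq_sym m_ne dvdn_leq.
suff /eqP[] : zeta n ^+ m != 1 by exact: prim_expr_order mn.
rewrite cisX; apply: cis_neq1.
  by rewrite pmulrn_lgt0 // divr_gt0 ?ltr0n // mulr_gt0 ?pi_gt0.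
rewrite -[_ *+ m]mulr_natr mulrAC ltr_pdivrMr ?ltr0n // ltr_pM2l ?ltr_nat //.
by rewrite mulr_gt0 ?pi_gt0.
Qed.

Lemma zeta2 : zeta 2 = - 1.
Proof.
have p := zeta_prim (isT : 0 < 2)%N.
have /eqP := prim_expr_order p; rewrite sqrf_eq1 => /pred2P[z1|//].
by have := prim_order_dvd p 1; rewrite expr1 z1 eqxx.
Qed.

Lemma XsubC2 (a b : R[i]) :
  ('X - a%:P) * ('X - b%:P) = 'X^2 - (a + b)%:P * 'X + (a * b)%:P.
Proof. by rewrite polyCD polyCM; ring. Qed.

Lemma zeta3 : zeta 3 ^+ 2 = - 1 - zeta 3.
Proof.
have p := zeta_prim (isT : 0 < 3)%N.
have z1 : zeta 3 - 1 != 0.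
  rewrite subr_eq0; apply/negP => /eqP z1.
  by have := prim_order_dvd p 1; rewrite expr1 z1 eqxx.
apply: (mulfI z1); have := prim_expr_order p; rewrite exprS => z3.
by rewrite mulrBl z3; ring.
Qed.

Lemma zeta4 : zeta 4 ^+ 2 = - 1.
Proof.
have p := zeta_prim (isT : 0 < 4)%N.
have z4 : (zeta 4 ^+ 2) ^+ 2 = 1 by rewrite -exprM; exact: prim_expr_order p.
have /eqP := z4; rewrite sqrf_eq1 => /pred2P[z1|//].
by have := prim_order_dvd p 2; rewrite z1 eqxx.
Qed.

Lemma zeta6 : zeta 6 ^+ 2 = zeta 6 - 1.
Proof.
have p := zeta_prim (isT : 0 < 6)%N.
have z3 : zeta 6 ^+ 3 = - 1.
  have z6 : (zeta 6 ^+ 3) ^+ 2 = 1 by rewrite -exprM; exact: prim_expr_order p.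
  have /eqP := z6; rewrite sqrf_eq1 => /pred2P[z1|//].
  by have := prim_order_dvd p 3; rewrite z1 eqxx.
have z1 : zeta 6 + 1 != 0.
  rewrite addr_eq0; apply/negP => /eqP z1.
  by have := prim_order_dvd p 2; rewrite z1 sqrrN expr1n eqxx.
apply: (mulfI z1); rewrite mulrDl mul1r -exprS z3; ring.
Qed.

Lemma prod_zeta5 :
  ('X - (zeta 5)%:P) * ('X - (zeta 5 ^+ 2)%:P) * ('X - (zeta 5 ^+ 3)%:P) *
  ('X - (zeta 5 ^+ 4)%:P) = 'X^4 + 'X^3 + 'X^2 + 'X + 1.
Proof.
have p := zeta_prim (isT : 0 < 5)%N.
have := factor_Xn_sub_1 p.
rewrite !big_nat_recr //= big_geq // mul1r expr0 expr1 => E.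
apply: (mulfI (negbT (polyXsubC_eq0 (1 : R[i])))).
by rewrite !mulrA E; ring.
Qed.

Lemma ZK_pos p : ZK R[i] (Zpos p) = (Pos.to_nat p)%:R.
Proof. by []. Qed.
Lemma ZK_neg p : ZK R[i] (Zneg p) = - (Pos.to_nat p)%:R.
Proof. by rewrite (ZKN _ (Zpos p)). Qed.

Ltac zpoly_ring :=
  rewrite [Poly _]/= !cons_poly_def !(ZK_pos, ZK_neg, ZK0) ?polyCN ?polyC_natr;
  rewrite /Pos.to_nat /=; ring.

Definition exp_poly_seq (s : seq rat) : {poly R[i]} :=
  \prod_(q <- s) ('X - (exp2ipi (ratr q))%:P).

Lemma exp_poly_map n (b : n.-tuple rat) :
  exp_poly (map_tuple (ratr : rat -> R[i]) b) = exp_poly_seq b.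
Proof. by rewrite /exp_poly big_map. Qed.

Lemma exp_poly_cat s1 s2 : exp_poly_seq (s1 ++ s2) = exp_poly_seq s1 * exp_poly_seq s2.
Proof. exact: big_cat. Qed.

Lemma exp_poly_half : exp_poly_seq [:: 1 / 2] = 'X + 1.
Proof. by rewrite /exp_poly_seq big_seq1 (exp2ipi_ratr 1 2) zeta2; ring. Qed.

Lemma exp_poly2 p q n : (p + q = n)%N -> (0 < n)%N ->
  exp_poly_seq [:: p%:R / n%:R; q%:R / n%:R] =
  'X^2 - (zeta n ^+ p + zeta n ^+ q)%:P * 'X + 1.
Proof.
move=> pqn n0; rewrite /exp_poly_seq !big_cons big_nil mulr1 !exp2ipi_ratr XsubC2.
by rewrite -exprD pqn (prim_expr_order (zeta_prim n0)) polyC1.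
Qed.

Lemma exp_poly_third : exp_poly_seq [:: 1 / 3; 2 / 3] = 'X^2 + 'X + 1.
Proof. by rewrite (@exp_poly2 1 2 3) // zeta3; ring. Qed.

Lemma exp_poly_quarter : exp_poly_seq [:: 1 / 4; 3 / 4] = 'X^2 + 1.
Proof.
rewrite (@exp_poly2 1 3 4) // (exprS _ 2) zeta4 mulrN1 expr1 subrr.
by rewrite mul0r subr0.
Qed.

Lemma exp_poly_sixth : exp_poly_seq [:: 1 / 6; 5 / 6] = 'X^2 - 'X + 1.
Proof.
rewrite (@exp_poly2 1 5 6) // (exprD _ 3 2).
have -> : zeta 6 ^+ 3 = - 1.
  by rewrite exprS zeta6 mulrBr mulr1 -expr2 zeta6; ring.
by rewrite zeta6; ring.
Qed.

Lemma exp_poly_fifth :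
  exp_poly_seq [:: 1 / 5; 2 / 5; 3 / 5; 4 / 5] = 'X^4 + 'X^3 + 'X^2 + 'X + 1.
Proof.
rewrite -prod_zeta5 /exp_poly_seq !big_cons big_nil mulr1.
rewrite (exp2ipi_ratr 1 5) (exp2ipi_ratr 2 5) (exp2ipi_ratr 3 5).
by rewrite (exp2ipi_ratr 4 5) !mulrA.
Qed.

Lemma exp_poly_zeros :
  exp_poly (nseq_tuple 6 (0 : R[i])) = Poly (map (@ZK R[i]) coef_f).
Proof.
have e0 : exp2ipi (0 : R[i]) = 1.
  by rewrite -[0]/(0%:C) exp2ipi_real mulr0 /cis cos0 sin0.
by rewrite /exp_poly !big_cons big_nil e0 /coef_f; zpoly_ring.
Qed.

Lemma exp_poly_g1 :
  exp_poly_seq [:: 1 / 2; 1 / 2; 1 / 2; 1 / 2; 1 / 2; 1 / 2] =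
  Poly (map (@ZK R[i]) coef_g1).
Proof.
rewrite (exp_poly_cat [:: _] [:: _; _; _; _; _]).
rewrite (exp_poly_cat [:: _] [:: _; _; _; _]).
rewrite (exp_poly_cat [:: _] [:: _; _; _]).
rewrite (exp_poly_cat [:: _] [:: _; _]).
rewrite (exp_poly_cat [:: _] [:: _]).
by rewrite exp_poly_half /coef_g1; zpoly_ring.
Qed.

Lemma exp_poly_g2 :
  exp_poly_seq [:: 1 / 2; 1 / 2; 1 / 2; 1 / 2; 1 / 3; 2 / 3] =
  Poly (map (@ZK R[i]) coef_g2).
Proof.
rewrite (exp_poly_cat [:: _] [:: _; _; _; _; _]).
rewrite (exp_poly_cat [:: _] [:: _; _; _; _]).
rewrite (exp_poly_cat [:: _] [:: _; _; _]).
rewrite (exp_poly_cat [:: _] [:: _; _]).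
by rewrite exp_poly_half exp_poly_third /coef_g2; zpoly_ring.
Qed.

Lemma exp_poly_g3 :
  exp_poly_seq [:: 1 / 2; 1 / 2; 1 / 2; 1 / 2; 1 / 4; 3 / 4] =
  Poly (map (@ZK R[i]) coef_g3).
Proof.
rewrite (exp_poly_cat [:: _] [:: _; _; _; _; _]).
rewrite (exp_poly_cat [:: _] [:: _; _; _; _]).
rewrite (exp_poly_cat [:: _] [:: _; _; _]).
rewrite (exp_poly_cat [:: _] [:: _; _]).
by rewrite exp_poly_half exp_poly_quarter /coef_g3; zpoly_ring.
Qed.

Lemma exp_poly_g4 :
  exp_poly_seq [:: 1 / 2; 1 / 2; 1 / 2; 1 / 2; 1 / 6; 5 / 6] =
  Poly (map (@ZK R[i]) coef_g4).
Proof.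
rewrite (exp_poly_cat [:: _] [:: _; _; _; _; _]).
rewrite (exp_poly_cat [:: _] [:: _; _; _; _]).
rewrite (exp_poly_cat [:: _] [:: _; _; _]).
rewrite (exp_poly_cat [:: _] [:: _; _]).
by rewrite exp_poly_half exp_poly_sixth /coef_g4; zpoly_ring.
Qed.

Lemma exp_poly_g5 :
  exp_poly_seq [:: 1 / 2; 1 / 2; 1 / 3; 2 / 3; 1 / 3; 2 / 3] =
  Poly (map (@ZK R[i]) coef_g5).
Proof.
rewrite (exp_poly_cat [:: _] [:: _; _; _; _; _]).
rewrite (exp_poly_cat [:: _] [:: _; _; _; _]).
rewrite (exp_poly_cat [:: _; _] [:: _; _]).
by rewrite exp_poly_half exp_poly_third /coef_g5; zpoly_ring.
Qed.

Lemma exp_poly_g6 :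
  exp_poly_seq [:: 1 / 2; 1 / 2; 1 / 3; 2 / 3; 1 / 4; 3 / 4] =
  Poly (map (@ZK R[i]) coef_g6).
Proof.
rewrite (exp_poly_cat [:: _] [:: _; _; _; _; _]).
rewrite (exp_poly_cat [:: _] [:: _; _; _; _]).
rewrite (exp_poly_cat [:: _; _] [:: _; _]).
by rewrite exp_poly_half exp_poly_third exp_poly_quarter /coef_g6; zpoly_ring.
Qed.

Lemma exp_poly_g7 :
  exp_poly_seq [:: 1 / 2; 1 / 2; 1 / 5; 2 / 5; 3 / 5; 4 / 5] =
  Poly (map (@ZK R[i]) coef_g7).
Proof.
rewrite (exp_poly_cat [:: _] [:: _; _; _; _; _]).
rewrite (exp_poly_cat [:: _] [:: _; _; _; _]).
by rewrite exp_poly_half exp_poly_fifth /coef_g7; zpoly_ring.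
Qed.

End RootsOfUnity.

(** * The cones *)

Section ConeData.
Local Open Scope Z_scope.

(** One list of generators for the cone of T, one for the cone of B, and six
    lists of certificates, in the order of [steps], for each of the seven
    polynomials. The number of generators can be finite although infinitely many
    vectors w v accumulate at the fixed line of T B^-1, because the cone of T
    contains with v the vectors D^i v for D = T B^-1 - 1 and i at most 5: they
    span a cone invariant under the unipotent matrix T B^-1, as
    T B^-1 D^i v = D^i v + D^(i+1) v. *)

Definition gens_T1 : seq (seq Z) :=
  [::
   [:: 0; -12; 0; -40; 0; -12];
   [:: -2007; -17295; -10185; -72017; -3459; -23488];
   [:: -1305; -12225; -4711; -48403; -1484; -15404];
   [:: -1318; -12014; -5378; -48403; -1735; -15518];
   [:: -85; -947; -128; -3280; -8; -1009];
   [:: -86; -898; -191; -3280; -43; -1020];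
   [:: -33; -291; -159; -1195; -51; -387];
   [:: -16; -156; -53; -610; -16; -189]; [:: -7; -57; -42; -246; -15; -81];
   [:: -3; -28; -10; -112; -3; -36]; [:: -3; -33; -10; -110; -3; -33];
   [:: -1; -22; -17; -81; -14; -30]; [:: -1; -21; -12; -81; -6; -29];
   [:: -2; -15; -16; -66; -6; -23]; [:: -1; -21; -15; -58; -9; -13];
   [:: -1; -20; -18; -58; -15; -13]; [:: -1; -18; -19; -58; -16; -15];
   [:: -1; -18; -7; -41; -2; -9]; [:: -1; -15; -2; -41; 0; -11];
   [:: -1; -12; -3; -41; -5; -13]; [:: -1; -12; -2; -41; 0; -12];
   [:: -1; -12; -11; -41; -12; -13]; [:: -1; -14; -2; -41; 1; -12];
   [:: -1; -7; -10; -30; -5; -11]].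

Definition gens_B1 : seq (seq Z) :=
  [::
   [:: -5253; -33525; -67349; -131706; -46918; -51438];
   [:: -2778; -17560; -36521; -67764; -26756; -26407];
   [:: -2007; -12638; -26646; -48403; -19920; -18831];
   [:: -758; -4719; -10371; -17640; -8276; -6733];
   [:: -550; -3408; -7624; -12600; -6264; -4747];
   [:: -193; -1210; -2596; -4592; -1962; -1769];
   [:: -58; -348; -855; -1195; -740; -379];
   [:: -55; -336; -795; -1195; -699; -413];
   [:: -40; -245; -594; -854; -537; -273];
   [:: -54; -307; -715; -854; -532; -141];
   [:: -28; -173; -388; -610; -324; -228];
   [:: -26; -149; -354; -436; -288; -85];
   [:: -15; -97; -186; -390; -119; -153];
   [:: -15; -93; -210; -342; -175; -125];
   [:: -15; -93; -209; -311; -177; -104];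
   [:: -15; -87; -210; -258; -175; -55]; [:: -10; -63; -132; -242; -98; -95];
   [:: -15; -83; -186; -210; -119; -27]; [:: -8; -48; -118; -159; -103; -48];
   [:: -10; -57; -132; -158; -98; -25]; [:: -6; -36; -91; -113; -74; -25];
   [:: -6; -36; -89; -113; -79; -30]; [:: -3; -20; -34; -84; -19; -32];
   [:: -3; -19; -46; -58; -39; -13]; [:: -2; -11; -27; -41; -23; -14];
   [:: -3; -16; -34; -36; -19; -4]; [:: -1; -7; -10; -30; -5; -11];
   [:: -1; -5; -10; -15; -9; -4]; [:: -1; -3; -7; -11; -6; -3];
   [:: -1; -5; -10; -10; -5; -1]].

Definition certs1 : seq (seq (seq Z)) :=
  [:: [::
   [:: 1; 0; 1]; [:: 1; 1; 1; 0; 2007]; [:: 1; 2; 1; 0; 1305];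
   [:: 1; 3; 1; 0; 1318]; [:: 1; 4; 1; 0; 85]; [:: 1; 5; 1; 0; 86];
   [:: 1; 6; 1; 0; 33]; [:: 1; 7; 1; 0; 16]; [:: 1; 8; 1; 0; 7];
   [:: 1; 9; 1; 0; 3]; [:: 1; 10; 1; 0; 3]; [:: 1; 11; 1; 0; 1];
   [:: 1; 12; 1; 0; 1]; [:: 1; 13; 1; 0; 2]; [:: 1; 14; 1; 0; 1];
   [:: 1; 15; 1; 0; 1]; [:: 1; 16; 1; 0; 1]; [:: 1; 17; 1; 0; 1];
   [:: 1; 18; 1; 0; 1]; [:: 1; 19; 1; 0; 1]; [:: 1; 20; 1; 0; 1];
   [:: 1; 21; 1; 0; 1]; [:: 1; 22; 1; 0; 1]; [:: 1; 23; 1; 0; 1]];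
   [::
   [:: 122544; 13; 122474468; 0; 135527063; 15; 69877080; 11; 271166376; 21; 5472464; 17; 52258776];
   [:: 122544; 13; 53139428; 0; 58242647; 15; 40823496; 11; 144754248; 21; 22389752; 17; 26180880];
   [:: 13616; 13; 3879948; 0; 4271629; 15; 3412792; 11; 11623112; 21; 2497256; 17; 2034256];
   [:: 592; 13; 44964; 0; 56995; 15; 68904; 11; 181560; 21; 83752; 17; 24592];
   [:: 20424; 13; 920660; 0; 1339727; 15; 1906680; 11; 4370928; 21; 2639024; 17; 475248];
   [:: 61272; 13; 1586204; 0; 1676999; 15; 1709136; 11; 4969488; 21; 1153964; 17; 820500];
   [:: 20968; 21; 384692; 15; 251444; 11; 246332; 23; 150828; 16; 182848; 0; 206587];
   [:: 20968; 21; 420148; 0; 189597; 15; 208692; 23; 116900; 16; 97488; 11; 310012];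
   [:: 20968; 21; 348564; 15; 56940; 11; 152756; 23; 36636; 16; 243824; 0; 156193];
   [:: 352424; 22; 1545008; 15; 11110088; 13; 2523684; 7; 49432; 21; 537520; 0; 3393013];
   [:: 61272; 17; 133896; 0; 138667; 15; 277272; 13; 87100; 21; 460408; 11; 669840];
   [:: 88106; 22; 14224; 15; 1185916; 13; 251194; 7; 5488; 21; 500420; 0; 505861];
   [:: 38368; 13; 111388; 0; 118453; 12; 45976; 11; 210712; 14; 68504; 17; 27552];
   [:: 15318; 13; 18734; 0; 31211; 15; 47250; 11; 81426; 21; 59228; 17; 4398];
   [:: 30636; 17; 26430; 15; 115704; 13; 24332; 0; 55637; 21; 137114; 11; 131628];
   [:: 25512; 13; 39772; 15; 188880; 11; 10560; 16; 144; 21; 103552; 0; 79999];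
   [:: 30636; 13; 44000; 0; 47495; 15; 34056; 11; 133320; 21; 25904; 17; 25080];
   [:: 253672; 22; 93152; 15; 957944; 14; 1445032; 7; 31912; 13; 399180; 0; 411757];
   [:: 20968; 21; 55972; 15; 45412; 11; 30716; 23; 17588; 16; 18056; 0; 26301];
   [:: 44053; 22; 31124; 15; 264196; 13; 52947; 7; 2296; 21; 2580; 0; 74532];
   [:: 17008; 21; 14984; 13; 10732; 11; 2616; 16; 33008; 15; 29976; 0; 20405];
   [:: 5242; 21; 11690; 15; 9238; 11; 3292; 23; 2412; 16; 4820; 0; 5419];
   [:: 38368; 13; 25812; 0; 34599; 12; 27400; 11; 20360; 14; 13320; 17; 2400];
   [:: 25512; 21; 17648; 13; 4892; 11; 3408; 16; 20688; 15; 25008; 0; 14207];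
   [:: 12920; 13; 2348; 0; 6063; 17; 672; 16; 6704; 21; 9144; 11; 4624];
   [:: 253672; 22; 121472; 15; 58200; 14; 391336; 7; 744; 13; 89052; 0; 54703];
   [:: 38368; 13; 12836; 0; 22267; 12; 5480; 11; 4072; 14; 2664; 17; 480];
   [:: 1057272; 22; 206136; 15; 209736; 13; 17236; 7; 4608; 21; 533200; 0; 293101];
   [:: 230808; 7; 3072; 0; 47579; 13; 16988; 21; 2024; 15; 48120; 19; 97536];
   [:: 21752; 13; 3292; 17; 5672; 14; 6856; 20; 1576; 15; 1064; 0; 2845]];
   [::
   [:: 112; 23; 3512; 10; 2509; 13; 82312; 8; 43787; 17; 24; 9; 35380];
   [:: 9768; 8; 405883; 10; 233; 13; 1074364; 6; 6648; 9; 168936; 1; 10672];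
   [:: 1; 1; 1];
   [:: 8112998; 6; 5312364; 3; 3592237; 8; 30338801; 2; 664451; 7; 2636299; 9; 39371720];
   [:: 45732; 23; 11191; 7; 4480; 10; 6641; 21; 730; 2; 19122; 9; 31622];
   [:: 10600; 6; 56580; 12; 140; 22; 15928; 8; 10281; 9; 21197; 13; 13517];
   [:: 43768; 4; 8228; 19; 85672; 22; 492156; 20; 606844; 9; 218164; 0; 403];
   [:: 1055553; 10; 52767; 19; 784079; 4; 357052; 7; 821472; 9; 3185263; 5; 47259];
   [:: 54384; 9; 10456; 17; 7653; 22; 11253; 20; 33951; 19; 19175; 4; 24376];
   [:: 6164; 22; 205040; 21; 12702; 17; 62418; 15; 24988; 23; 27708; 0; 23505];
   [:: 7327; 21; 2487; 17; 1240; 15; 265; 7; 11889; 20; 2999; 9; 2647];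
   [:: 72380; 22; 1377616; 17; 107920; 15; 170560; 0; 23559; 19; 216880; 11; 8904];
   [:: 1; 13; 4; 8; 1]; [:: 1; 10; 1; 9; 4];
   [:: 2673; 7; 891; 17; 2669; 15; 143; 20; 12070; 19; 2518; 9; 2813];
   [:: 214; 19; 564; 17; 620; 22; 1180; 20; 692; 8; 22; 0; 167];
   [:: 1; 8; 1; 9; 1];
   [:: 6498; 22; 12672; 23; 15824; 8; 2434; 17; 48352; 15; 3584; 0; 17507];
   [:: 43314; 10; 4587; 19; 21824; 22; 67563; 20; 155613; 9; 8482; 4; 733];
   [:: 6164; 22; 35488; 21; 3488; 17; 14112; 15; 3360; 23; 5192; 0; 4931];
   [:: 32008; 17; 3069; 20; 4951; 15; 4584; 19; 7983; 8; 1120; 22; 163621];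
   [:: 3120; 18; 5956; 4; 88; 22; 464; 0; 529; 19; 576; 20; 4244];
   [:: 1; 13; 1; 23; 1];
   [:: 8909; 10; 228; 19; 306; 18; 8212; 20; 3705; 4; 29; 22; 11355];
   [:: 41920; 9; 14440; 22; 18992; 13; 3460; 0; 1363; 19; 13760; 11; 848];
   [:: 21752; 13; 10772; 17; 27176; 14; 12232; 20; 3624; 15; 680; 0; 10241];
   [:: 1; 23; 1];
   [:: 211244; 19; 101316; 17; 29900; 8; 5972; 20; 11540; 15; 26684; 0; 15905];
   [:: 26760; 22; 7872; 15; 2040; 11; 1248; 13; 740; 21; 14120; 0; 3533];
   [:: 21752; 13; 3292; 17; 5672; 14; 6856; 20; 1576; 15; 1064; 0; 2845]];
   [::
   [:: 195030; 29; 711243829; 21; 965783109; 20; 111732644; 19; 2785884; 28; 210675393; 8; 65427014];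
   [:: 195030; 29; 222138913; 21; 520009653; 20; 20555198; 19; 39481098; 28; 115980291; 8; 29345948];
   [:: 78012; 29; 45641653; 21; 150945213; 20; 1462118; 19; 16039734; 28; 34041393; 8; 7862990];
   [:: 84532; 21; 57874691; 23; 3746355; 28; 13267461; 19; 9955808; 27; 9228404; 8; 2215320];
   [:: 84532; 21; 37428461; 19; 5940668; 23; 15744489; 28; 14278087; 27; 7603444; 8; 1204524];
   [:: 16451; 29; 744467; 27; 51067; 21; 3013756; 19; 376569; 28; 658259; 8; 144995];
   [:: 612; 21; 14125; 11; 751; 28; 11637; 19; 4657; 27; 3384; 23; 22027];
   [:: 6038; 21; 160811; 19; 32512; 23; 311863; 28; 168219; 27; 48220; 8; 1292];
   [:: 1224; 19; 4361; 11; 1571; 21; 13703; 28; 23175; 27; 2592; 23; 47237];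
   [:: 240; 29; 566; 20; 16; 17; 1153; 23; 96; 15; 173; 19; 1300];
   [:: 84532; 21; 1660365; 19; 175600; 23; 1582829; 28; 943463; 27; 733716; 8; 28236];
   [:: 13108; 17; 8605; 19; 76200; 20; 5680; 28; 2704; 9; 1064; 15; 8591];
   [:: 48627; 29; 461143; 10; 8289; 20; 9716; 21; 870081; 24; 394557; 8; 16970];
   [:: 42266; 21; 459473; 19; 89984; 23; 246167; 28; 203607; 27; 75504; 8; 15224];
   [:: 42266; 21; 302337; 19; 78562; 23; 412631; 28; 222973; 27; 163476; 8; 4292];
   [:: 1; 19; 4; 15; 1];
   [:: 32505; 29; 99919; 21; 320334; 20; 2744; 19; 30579; 28; 72438; 8; 16784];
   [:: 1; 25; 4; 17; 1];
   [:: 816; 19; 523; 11; 505; 21; 1675; 28; 1311; 27; 480; 23; 2989];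
   [:: 1; 17; 1; 19; 1];
   [:: 1432; 29; 2841; 15; 631; 23; 1158; 19; 1628; 20; 616; 28; 44];
   [:: 9472; 19; 2297; 20; 136; 28; 1494; 23; 13100; 11; 8135; 15; 538];
   [:: 60670; 29; 118233; 18; 43852; 28; 24349; 6; 8948; 21; 146191; 10; 1854];
   [:: 988; 19; 796; 29; 145; 27; 136; 15; 187; 23; 566; 28; 100];
   [:: 2122; 21; 2358; 19; 342; 20; 1472; 27; 3248; 23; 15; 26; 15];
   [:: 1; 29; 1; 25; 1];
   [:: 2856; 29; 1881; 20; 279; 18; 3365; 28; 110; 21; 31; 27; 645];
   [:: 4848; 28; 1422; 19; 101; 20; 504; 26; 298; 11; 327; 23; 1712];
   [:: 390060; 28; 107199; 19; 10302; 29; 48067; 20; 131882; 21; 6087; 8; 2102];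
   [:: 1; 29; 1]];
   [::
   [:: 26239; 29; 13908; 17; 3482; 12; 1562; 28; 768; 8; 5568; 26; 1812];
   [:: 587346; 29; 763637684; 8; 12638689; 18; 661571700; 20; 505623367; 24; 905117793; 10; 85351722];
   [:: 293673; 29; 295181306; 8; 21506926; 18; 73380180; 20; 202404058; 24; 350283639; 10; 30937410];
   [:: 293673; 29; 279527726; 8; 15292915; 18; 122739360; 20; 192765076; 24; 336559998; 10; 30512427];
   [:: 16133734; 10; 65562574; 12; 19656045; 20; 217061304; 17; 185914685; 8; 179730344; 24; 1434021500];
   [:: 240160; 10; 1558416; 20; 6521394; 29; 2136041; 17; 2137649; 8; 2106118; 24; 21876846];
   [:: 293673; 29; 6514903; 8; 167876; 18; 4846911; 20; 4296008; 24; 7678686; 10; 732600];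
   [:: 293673; 10; 447447; 20; 2827609; 18; 329004; 29; 3662711; 8; 263374; 24; 4590162];
   [:: 101559; 29; 575635; 18; 303386; 6; 41689; 10; 31786; 20; 221195; 24; 294208];
   [:: 195782; 29; 438368; 8; 33995; 18; 119804; 20; 312237; 24; 553193; 10; 46848];
   [:: 8066867; 10; 1233392; 12; 137039; 20; 1869388; 17; 3633054; 8; 3042260; 24; 21106756];
   [:: 82255; 29; 131566; 21; 54565; 28; 53; 19; 40428; 27; 26481; 8; 39447];
   [:: 293673; 29; 1002989; 10; 7311; 24; 4794; 20; 151564; 18; 121176; 8; 135511];
   [:: 203118; 29; 391790; 18; 281158; 10; 1022; 20; 28813; 6; 30863; 24; 19556];
   [:: 120344; 29; 280389; 23; 46068; 12; 6463; 17; 12889; 8; 19904; 26; 59439];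
   [:: 53236; 27; 12844; 29; 13577; 17; 17595; 23; 14156; 8; 7916; 26; 42614];
   [:: 62562; 29; 80141; 23; 25710; 20; 3994; 12; 4281; 19; 29346; 8; 9988];
   [:: 181944; 29; 360748; 23; 5177; 8; 23264; 26; 145637; 27; 102980; 10; 2930];
   [:: 314868; 29; 232769; 26; 71960; 12; 18358; 17; 30139; 8; 57780; 28; 120164];
   [:: 311508; 28; 166620; 26; 178593; 29; 207683; 20; 187768; 19; 18546; 8; 54616];
   [:: 16133734; 10; 1194062; 12; 275786; 20; 3449323; 17; 2237302; 8; 1700639; 24; 16876627];
   [:: 191321; 20; 95595; 19; 56763; 28; 5002; 27; 188626; 26; 44065; 8; 27707];
   [:: 246142; 29; 168079; 17; 24931; 24; 11480; 28; 81420; 8; 48570; 16; 36448];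
   [:: 2856; 29; 1881; 20; 279; 18; 3365; 28; 110; 21; 31; 27; 645]];
   [::
   [:: 26239; 29; 13908; 17; 3482; 12; 1562; 28; 768; 8; 5568; 26; 1812];
   [:: 1; 0; 1];
   [:: 1472360; 13; 418355; 12; 347349; 5; 137792; 2; 3169424; 23; 287592; 16; 7104604];
   [:: 412328; 24; 74560; 13; 159319; 12; 515953; 1; 595512; 5; 48464; 16; 1905468];
   [:: 20248184; 28; 732068; 10; 1893737; 16; 5211207; 4; 15820635; 8; 407206; 24; 12475072];
   [:: 90709854; 10; 8752859; 16; 77982159; 24; 14540406; 3; 39531006; 4; 4993661; 5; 4591532];
   [:: 1236984; 24; 397176; 13; 1037077; 12; 3338563; 1; 5776; 5; 31384; 16; 2650772];
   [:: 2344528; 25; 97975; 16; 860731; 20; 182156; 5; 670652; 10; 37290; 23; 65851];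
   [:: 1; 12; 1]; [:: 1; 16; 1]; [:: 1; 13; 1];
   [:: 50415; 29; 63516; 14; 6106; 8; 7253; 23; 65994; 27; 85039; 26; 78393];
   [:: 26618; 29; 19261; 23; 2721; 17; 4011; 27; 12318; 8; 6166; 26; 52723];
   [:: 1; 22; 1];
   [:: 125124; 20; 44684; 12; 6213; 29; 32527; 23; 17058; 19; 19266; 8; 30980];
   [:: 3630948; 29; 3432124; 23; 2503119; 10; 145830; 12; 99129; 20; 1537736; 8; 627380];
   [:: 104270; 12; 7967; 29; 96441; 20; 9586; 23; 98966; 19; 9208; 8; 14720];
   [:: 5004; 29; 535; 8; 1397; 24; 501; 20; 227; 21; 159; 28; 315];
   [:: 260908714; 10; 7872296; 4; 263018; 24; 20446135; 7; 24295250; 8; 13563185; 6; 1093721];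
   [:: 2245560; 29; 147449; 26; 56163; 16; 19722; 10; 448104; 8; 7432; 20; 38056];
   [:: 294503028; 23; 4978685; 16; 38033496; 6; 7762032; 4; 1526659; 8; 1993715; 5; 11079];
   [:: 14024; 29; 2800; 14; 2928; 23; 4273; 26; 1745; 27; 1748; 10; 754];
   [:: 619622; 28; 9681; 26; 188668; 4; 41; 24; 50426; 8; 525; 7; 83895];
   [:: 1; 26; 1]]].

Lemma thin_check1 :
  thin_check 6 coef_f coef_g1 gens_T1 gens_B1 certs1.
Proof. by vm_compute. Qed.

Definition gens_T2 : seq (seq Z) :=
  [::
   [:: 0; -11; 4; -34; 4; -11];
   [:: -1400; -10243; -2503; -40991; 2856; -14921];
   [:: -1201; -9247; -1039; -36141; 2855; -12876];
   [:: -335; -2876; 279; -10533; 1008; -3624];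
   [:: -137; -1085; -34; -4233; 381; -1469];
   [:: -51; -526; 140; -1701; 225; -545]; [:: -21; -199; 44; -684; 75; -232];
   [:: -11; -106; 6; -336; 29; -110]; [:: -11; -78; -24; -318; 19; -116];
   [:: -5; -53; 12; -159; 16; -53]; [:: -5; -41; 2; -156; 15; -55];
   [:: -4; -40; 9; -132; 17; -44]; [:: -1; -17; -3; -64; 4; -26];
   [:: -2; -19; 1; -64; 7; -21]; [:: -2; -13; -8; -54; 2; -21];
   [:: -1; -22; -13; -53; -15; -14]; [:: -1; -15; -6; -53; -2; -23];
   [:: -1; -18; -3; -37; -1; -8]; [:: -1; -16; 2; -37; 3; -10];
   [:: -1; -16; -8; -37; -7; -8]; [:: -1; -11; -6; -37; -6; -12];
   [:: -1; -9; 1; -31; 1; -10]; [:: -1; -6; -6; -24; -1; -10]].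

Definition gens_B2 : seq (seq Z) :=
  [::
   [:: -707362; -3168026; -6096984; -6592566; -4121865; -1190111];
   [:: -368784; -1683998; -3310502; -3659117; -2346699; -707362];
   [:: -159922; -746122; -1503859; -1709925; -1136558; -368784];
   [:: -53488; -255283; -528983; -622584; -430826; -159922];
   [:: -12157; -59385; -126248; -157542; -107518; -53488];
   [:: -16152; -72144; -138448; -149287; -93062; -26748];
   [:: -8616; -39224; -76841; -84610; -54012; -16152];
   [:: -3243; -17615; -27752; -63658; -14282; -29112];
   [:: -3856; -17935; -36014; -40764; -26928; -8616];
   [:: -1400; -7479; -12656; -26209; -7297; -12157];
   [:: -1201; -6340; -11262; -21507; -7368; -9969];
   [:: -1579; -7682; -16265; -19974; -13842; -6227];
   [:: -1345; -6402; -13220; -15488; -10664; -3856];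
   [:: -971; -4643; -9644; -11388; -7905; -2985];
   [:: -519; -2693; -5155; -8777; -3820; -3942];
   [:: -736; -3209; -6014; -6351; -3876; -1077];
   [:: -772; -3291; -6053; -6303; -3786; -1021];
   [:: -569; -2439; -4505; -4706; -2839; -772];
   [:: -471; -2082; -3953; -4220; -2603; -736];
   [:: -323; -1575; -3342; -4131; -2869; -1345];
   [:: -213; -1104; -2132; -3527; -1668; -1579];
   [:: -406; -1754; -3260; -3420; -2073; -569];
   [:: -212; -1037; -2206; -2776; -1870; -971];
   [:: -289; -1303; -2526; -2752; -1736; -509];
   [:: -273; -1228; -2374; -2578; -1619; -471];
   [:: -307; -1306; -2395; -2485; -1486; -397];
   [:: -276; -1206; -2264; -2393; -1461; -406];
   [:: -229; -982; -1813; -1891; -1138; -307];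
   [:: -174; -772; -1471; -1575; -974; -276];
   [:: -142; -653; -1294; -1443; -936; -289];
   [:: -137; -629; -1244; -1384; -894; -273];
   [:: -163; -706; -1315; -1381; -838; -229];
   [:: -57; -298; -550; -984; -390; -453];
   [:: -109; -478; -901; -955; -586; -163];
   [:: -98; -443; -861; -940; -594; -174];
   [:: -51; -266; -506; -864; -379; -382];
   [:: -84; -380; -740; -811; -516; -154];
   [:: -40; -211; -391; -684; -270; -323];
   [:: -57; -268; -545; -626; -421; -142];
   [:: -56; -263; -534; -613; -412; -137];
   [:: -47; -222; -454; -525; -356; -123];
   [:: -47; -217; -432; -484; -316; -98];
   [:: -23; -126; -192; -462; -89; -212];
   [:: -40; -184; -365; -408; -266; -84];
   [:: -16; -85; -146; -294; -90; -137]; [:: -21; -99; -202; -233; -158; -54];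
   [:: -17; -82; -172; -206; -143; -57]; [:: -17; -82; -171; -204; -143; -56];
   [:: -18; -85; -174; -201; -137; -47]; [:: -12; -62; -121; -198; -96; -86];
   [:: -16; -75; -152; -174; -116; -40]; [:: -13; -63; -133; -161; -112; -47];
   [:: -6; -29; -61; -73; -51; -21]; [:: -3; -17; -22; -66; -7; -29];
   [:: -4; -22; -41; -64; -30; -26]; [:: -5; -24; -51; -61; -43; -18];
   [:: -5; -24; -50; -60; -40; -16]; [:: -7; -29; -52; -53; -31; -8];
   [:: -3; -16; -34; -44; -29; -17]; [:: -3; -15; -32; -44; -28; -17];
   [:: -2; -10; -21; -31; -18; -13]; [:: -1; -6; -6; -24; -1; -10];
   [:: -1; -5; -10; -15; -9; -5]; [:: -1; -5; -11; -15; -9; -6];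
   [:: -1; -5; -8; -15; -7; -6]; [:: -1; -4; -9; -12; -7; -5];
   [:: -1; -4; -7; -7; -4; -1]].

Definition certs2 : seq (seq (seq Z)) :=
  [:: [::
   [:: 1; 0; 1]; [:: 1; 1; 1; 0; 1400]; [:: 1; 2; 1; 0; 1201];
   [:: 1; 3; 1; 0; 335]; [:: 1; 4; 1; 0; 137]; [:: 1; 5; 1; 0; 51];
   [:: 1; 6; 1; 0; 21]; [:: 1; 7; 1; 0; 11]; [:: 1; 8; 1; 0; 11];
   [:: 1; 9; 1; 0; 5]; [:: 1; 10; 1; 0; 5]; [:: 1; 11; 1; 0; 4];
   [:: 1; 12; 1; 0; 1]; [:: 1; 13; 1; 0; 2]; [:: 1; 14; 1; 0; 2];
   [:: 1; 15; 1; 0; 1]; [:: 1; 16; 1; 0; 1]; [:: 1; 17; 1; 0; 1];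
   [:: 1; 18; 1; 0; 1]; [:: 1; 19; 1; 0; 1]; [:: 1; 20; 1; 0; 1];
   [:: 1; 21; 1; 0; 1]; [:: 1; 22; 1; 0; 1]];
   [::
   [:: 29590; 14; 4736730272; 17; 2490620225; 19; 7993291242; 21; 24437968; 15; 949031601; 0; 6234653848];
   [:: 2348043; 5; 622765791; 0; 308158123881; 19; 466045491867; 8; 7326447499; 20; 1716607821; 22; 285806612194];
   [:: 4696086; 5; 179759760; 0; 273192509082; 19; 369104095746; 8; 311637125; 20; 103889010978; 22; 265418602433];
   [:: 928735; 5; 40209695; 0; 16240159227; 19; 14018430826; 20; 8985825324; 15; 7054364133; 22; 17566862952];
   [:: 1690459; 22; 6726043667; 5; 49596327; 0; 4675970297; 20; 2398825220; 15; 6961687176; 16; 1934941323];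
   [:: 29590; 14; 108242611; 17; 60641880; 19; 180020646; 21; 410544; 15; 20379388; 0; 141906899];
   [:: 14795; 14; 28648283; 17; 9209180; 19; 50907783; 21; 1033232; 15; 9026959; 0; 38356397];
   [:: 17636; 22; 23466278; 0; 20144290; 12; 9344826; 16; 14296864; 15; 5636717; 17; 4448863];
   [:: 2348043; 5; 1968219; 0; 3281475033; 19; 4541972265; 8; 25198481; 20; 1026216456; 22; 3108302627];
   [:: 4409; 22; 2293313; 0; 1913018; 12; 663790; 16; 2009199; 15; 733664; 17; 472634];
   [:: 7763; 20; 29227; 0; 3106234; 22; 3698516; 16; 3569034; 15; 1522060; 18; 504526];
   [:: 1690459; 5; 5953910; 0; 752068188; 22; 1067771417; 20; 349335117; 15; 923812091; 16; 24666726];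
   [:: 185747; 5; 135723; 0; 83871588; 19; 81756794; 20; 46899149; 15; 27111916; 22; 87139983];
   [:: 928735; 5; 881840; 0; 289697628; 19; 227408094; 20; 159682926; 15; 147996922; 22; 321739903];
   [:: 54341; 20; 2980183; 0; 7103765; 22; 7955662; 16; 10528224; 15; 5361627; 18; 1377283];
   [:: 29590; 14; 4917853; 17; 4154010; 19; 7012818; 21; 157732; 15; 617974; 0; 6235507];
   [:: 1188654; 5; 480484; 17; 208601156; 14; 202288257; 19; 257889888; 15; 22068646; 0; 250623539];
   [:: 1188654; 5; 301394; 17; 148280380; 14; 149880513; 19; 195058812; 15; 17872814; 0; 186249349];
   [:: 29590; 14; 3160221; 17; 2175040; 19; 4946286; 21; 19084; 15; 476038; 0; 4081219];
   [:: 1690459; 22; 186241244; 5; 1313635; 0; 132579668; 20; 73844445; 15; 186504470; 16; 32432713];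
   [:: 7763; 20; 282481; 0; 306618; 22; 281324; 16; 673400; 15; 304834; 18; 111480];
   [:: 29590; 14; 2700714; 17; 2541305; 19; 3628054; 21; 145516; 15; 297237; 0; 3390846];
   [:: 1690459; 5; 873518; 0; 76867263; 22; 112023286; 20; 37875080; 15; 120348222; 16; 43581302];
   [:: 29590; 14; 1929941; 17; 858045; 19; 3319246; 21; 35014; 15; 479323; 0; 2556379];
   [:: 29590; 14; 1827081; 17; 861890; 19; 3149316; 21; 10974; 15; 401728; 0; 2418489];
   [:: 614440; 5; 137512; 22; 14036442; 14; 33538179; 17; 40766272; 19; 59740896; 0; 54111727];
   [:: 29590; 14; 1847853; 17; 1517305; 19; 2692588; 21; 38762; 15; 222479; 0; 2351127];
   [:: 29590; 14; 1516386; 17; 1527665; 19; 1995306; 21; 99744; 15; 120623; 0; 1900664];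
   [:: 6964; 14; 274121; 17; 175615; 12; 710; 19; 446012; 15; 41157; 0; 356995];
   [:: 782681; 5; 59000; 0; 39843127; 19; 58344349; 8; 705238; 20; 4726692; 22; 37303043];
   [:: 782681; 5; 49525; 0; 38343975; 19; 56997454; 8; 884492; 20; 3035033; 22; 34939623];
   [:: 5918; 14; 216822; 17; 196675; 19; 303774; 21; 9312; 15; 21229; 0; 274456];
   [:: 7763; 20; 28887; 0; 114928; 22; 129581; 16; 179452; 15; 76068; 18; 28503];
   [:: 29590; 14; 728226; 17; 563345; 19; 1097946; 21; 14544; 15; 93023; 0; 933704];
   [:: 2959; 14; 65338; 17; 26366; 19; 115977; 21; 945; 15; 16018; 0; 87284];
   [:: 7763; 20; 50088; 0; 103737; 22; 112001; 16; 139776; 15; 75752; 18; 18296];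
   [:: 29590; 14; 558707; 17; 229430; 19; 934922; 21; 27448; 15; 176346; 0; 737003];
   [:: 6611; 18; 14719; 0; 60771; 22; 76594; 16; 120086; 15; 46046; 17; 6995];
   [:: 928735; 5; 12690; 0; 18920407; 19; 23501211; 20; 8448724; 15; 1588653; 22; 18752117];
   [:: 928735; 5; 8140; 0; 18690919; 19; 23861167; 20; 8677398; 15; 932096; 22; 18123359];
   [:: 928735; 5; 12820; 0; 15323472; 19; 17775226; 20; 7470999; 15; 2371628; 22; 15378872];
   [:: 782681; 5; 11482; 0; 13202213; 19; 19139055; 8; 240242; 20; 2349595; 22; 12069113];
   [:: 8818; 15; 17181; 17; 21435; 22; 65636; 12; 59106; 0; 53432; 16; 39456];
   [:: 4696086; 5; 167172; 0; 67622670; 19; 96130728; 8; 275597; 20; 11611074; 22; 68544299];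
   [:: 19833; 22; 133588; 0; 117189; 16; 123438; 18; 7616; 15; 41008; 17; 11678];
   [:: 928735; 5; 6930; 0; 6833527; 19; 8087566; 20; 3260919; 15; 974268; 22; 6827252];
   [:: 185747; 5; 3111; 0; 1002201; 19; 589869; 20; 585084; 15; 655438; 22; 1168647];
   [:: 185747; 5; 4384; 0; 964675; 19; 550559; 20; 548294; 15; 699799; 22; 1135463];
   [:: 928735; 5; 5305; 0; 5822832; 19; 6756681; 20; 2944559; 15; 938798; 22; 5806637];
   [:: 54341; 20; 131566; 0; 140006; 22; 129498; 16; 232288; 15; 125619; 18; 33121];
   [:: 928735; 5; 8955; 0; 5278227; 19; 6374031; 20; 1783394; 15; 704128; 22; 5541502];
   [:: 928735; 5; 17515; 0; 3675323; 22; 4665258; 19; 1219724; 15; 3265677; 20; 2029631];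
   [:: 928735; 5; 9085; 0; 1681292; 22; 2168257; 19; 648046; 15; 1487103; 20; 805669];
   [:: 4409; 0; 6216; 15; 728; 22; 6971; 12; 4192; 17; 976; 16; 360];
   [:: 19833; 18; 1289; 0; 25446; 22; 35224; 16; 18522; 15; 20482; 17; 3815];
   [:: 928735; 5; 8950; 0; 1351569; 22; 1820564; 19; 328872; 15; 1381281; 20; 656508];
   [:: 928735; 5; 425; 0; 1650294; 19; 1362542; 20; 868593; 15; 580806; 22; 1810059];
   [:: 153610; 5; 1114; 22; 58874; 14; 198713; 17; 287464; 19; 274692; 0; 290069];
   [:: 54341; 22; 43147; 20; 22341; 0; 28871; 16; 39361; 15; 53216; 18; 4958];
   [:: 54341; 22; 26967; 20; 50332; 0; 29125; 16; 38913; 15; 39978; 18; 6833];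
   [:: 7763; 20; 4729; 0; 2306; 22; 1581; 16; 5285; 15; 3229; 18; 702];
   [:: 1; 0; 1; 22; 1];
   [:: 1690459; 5; 1481; 0; 520186; 22; 387342; 20; 733205; 15; 391610; 16; 102771];
   [:: 413; 20; 67; 0; 100; 22; 138; 12; 2; 15; 117; 16; 89];
   [:: 175029; 5; 45; 0; 31824; 16; 48653; 20; 41222; 15; 32034; 9; 10165];
   [:: 1690459; 5; 8075; 0; 248637; 22; 378109; 20; 76910; 15; 415077; 16; 408538];
   [:: 238088; 4; 262; 17; 81468; 22; 30050; 14; 25209; 0; 60771; 19; 40258]];
   [::
   [:: 247688; 18; 38051329636; 17; 54830276368; 22; 22138718370; 4; 259688788; 14; 12303695363; 0; 30745101619];
   [:: 61922; 18; 7856882738; 17; 4864291194; 22; 2527852788; 4; 31400742; 14; 1642457237; 0; 3428725875];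
   [:: 247688; 4; 76110752; 18; 18966190848; 0; 4754957181; 17; 3554361720; 14; 128326081; 22; 6406382582];
   [:: 2568052; 9; 1412752845; 18; 71619060929; 0; 5908602265; 21; 2505070362; 4; 375083245; 16; 4785665295];
   [:: 4565254; 21; 4432588930; 18; 12548133557; 0; 3270364287; 4; 102163835; 5; 247578786; 9; 2379221382];
   [:: 6927; 15; 1119511; 18; 14343485; 22; 24161473; 13; 18478062; 0; 19929132; 17; 35304311];
   [:: 247688; 18; 690624776; 17; 490728168; 22; 231420330; 4; 2893504; 14; 162448243; 0; 329246903];
   [:: 144; 7; 267; 4; 288; 22; 21611; 8; 14492; 14; 93648; 10; 11256];
   [:: 247688; 4; 1676340; 18; 440446236; 22; 139548342; 17; 103511576; 14; 20960097; 0; 118939153];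
   [:: 1; 1; 1]; [:: 1; 2; 1];
   [:: 31956778; 5; 91578238; 18; 14994529737; 0; 3185329021; 4; 103494729; 9; 2925570148; 21; 1988103974];
   [:: 1284026; 9; 1208673; 18; 958235304; 0; 64104720; 21; 20626964; 4; 4883736; 16; 73037505];
   [:: 2568052; 9; 42487491; 18; 1242815697; 0; 116926349; 21; 54281302; 4; 6639845; 16; 74385273];
   [:: 974760; 22; 2613325; 9; 1498496; 10; 67498648; 4; 611568; 7; 5735689; 5; 224000];
   [:: 114088; 9; 198665; 13; 15100711; 22; 17921920; 15; 1698146; 0; 16502076; 17; 33153955];
   [:: 17703; 15; 103701; 13; 2246669; 22; 3214435; 19; 922570; 0; 2980794; 17; 4932672];
   [:: 11802; 15; 80439; 13; 1145572; 22; 1532006; 19; 333950; 0; 1423920; 17; 2477799];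
   [:: 8776; 9; 54107; 13; 644013; 22; 900480; 15; 21054; 0; 813236; 17; 1653401];
   [:: 15978389; 5; 18298786; 18; 1298945607; 0; 317741879; 4; 8777572; 9; 265185800; 21; 400379590];
   [:: 35554861; 7; 1284110; 21; 8968765; 5; 430406; 3; 22171380; 4; 110656; 10; 17113708];
   [:: 35406; 15; 246153; 13; 2556098; 22; 3168256; 19; 355102; 0; 2936604; 17; 5493129];
   [:: 15978389; 21; 287641094; 18; 694611725; 0; 193319448; 4; 6502591; 5; 17287402; 9; 126530636];
   [:: 123844; 18; 9304192; 17; 10000844; 22; 4278422; 4; 51476; 14; 2577623; 0; 5973155];
   [:: 247688; 18; 16548932; 17; 19783624; 22; 7772454; 4; 94604; 14; 5276533; 0; 11497909];
   [:: 12912; 19; 338528; 13; 621352; 22; 960746; 14; 3771; 0; 891063; 17; 1414464];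
   [:: 28522; 9; 26499; 13; 1388689; 22; 1696602; 15; 137292; 0; 1552196; 17; 3128305];
   [:: 11802; 15; 20457; 13; 448880; 22; 631708; 19; 150022; 0; 581922; 17; 1002711];
   [:: 20781; 15; 41954; 18; 324016; 22; 789401; 13; 609999; 0; 668697; 17; 1240525];
   [:: 61922; 4; 13234; 18; 3404012; 22; 1062808; 17; 1535772; 14; 488637; 0; 1235929];
   [:: 123844; 4; 23440; 18; 6457412; 22; 1888514; 17; 3109764; 14; 1149829; 0; 2422821];
   [:: 3934; 15; 12221; 13; 114656; 22; 140812; 19; 8830; 0; 129482; 17; 250067];
   [:: 694929; 22; 2106934; 21; 1613917; 11; 402550; 16; 4222; 4; 141155; 10; 2987489];
   [:: 114088; 9; 88143; 13; 2091681; 22; 2690328; 15; 164738; 0; 2452484; 17; 4956449];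
   [:: 61922; 18; 1691483; 17; 1620808; 22; 658208; 4; 8075; 14; 495791; 0; 993190];
   [:: 1; 10; 8; 7; 1];
   [:: 4423; 18; 104611; 17; 95848; 22; 51489; 4; 596; 14; 18966; 0; 60198];
   [:: 563397; 10; 1625; 9; 6016; 22; 19931; 21; 23150; 4; 163851; 16; 7007];
   [:: 587436; 15; 140719; 18; 17741663; 0; 3496029; 17; 1240307; 4; 70017; 22; 4768834];
   [:: 881154; 15; 218201; 18; 26299435; 0; 5218545; 17; 1892965; 4; 99327; 22; 7326224];
   [:: 5587798; 16; 216674; 18; 148357263; 0; 24214421; 15; 2141070; 4; 581093; 22; 32301758];
   [:: 247688; 4; 17684; 18; 4860868; 22; 1474038; 17; 1752240; 14; 565741; 0; 1571613];
   [:: 1; 14; 6; 8; 1];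
   [:: 247688; 4; 18080; 18; 3753352; 22; 1448850; 17; 1707160; 14; 260599; 0; 1384939];
   [:: 1; 8; 1; 10; 1];
   [:: 1762308; 15; 329797; 18; 20656187; 0; 3525477; 17; 255437; 4; 80745; 22; 4704982];
   [:: 3401186; 9; 2455270; 18; 24815915; 0; 2411129; 4; 132001; 12; 1316712; 21; 1327048];
   [:: 13164406; 15; 1343590; 18; 93165278; 0; 13338980; 16; 1963629; 4; 551450; 9; 10354751];
   [:: 2793899; 16; 324198; 18; 28495981; 0; 4279976; 15; 407145; 4; 114513; 22; 5374577];
   [:: 2748478; 21; 475173; 10; 2527488; 5; 37701; 7; 15452; 9; 928545; 3; 39205];
   [:: 1762308; 15; 48817; 18; 13529951; 0; 3145785; 17; 2017133; 4; 63069; 22; 3960574];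
   [:: 3401186; 9; 2663686; 18; 16062441; 0; 2767991; 4; 105477; 12; 133538; 21; 250660];
   [:: 3401186; 9; 922560; 18; 8113169; 0; 1237349; 4; 51005; 12; 148768; 21; 544694];
   [:: 1; 22; 1; 14; 1];
   [:: 179865; 9; 1527; 21; 39106; 0; 817; 4; 720; 13; 274882; 18; 24315];
   [:: 1700593; 9; 459367; 18; 3089351; 0; 596844; 4; 20687; 12; 13260; 21; 269400];
   [:: 3401186; 9; 279942; 18; 8666097; 0; 88553; 4; 43293; 12; 894200; 21; 114782];
   [:: 119044; 4; 1277; 17; 331650; 22; 133970; 14; 55510; 0; 199307; 19; 81719];
   [:: 4133044; 21; 79995; 17; 78067; 0; 2094; 5; 236237; 9; 13964; 4; 899];
   [:: 90180463; 21; 13648223; 5; 1836852; 0; 7473026; 4; 123421; 6; 2558147; 9; 18516790];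
   [:: 40554106; 21; 468529; 4; 20285; 17; 350209; 5; 6387; 9; 573382; 6; 3538942];
   [:: 1; 22; 1];
   [:: 26349; 22; 309; 12; 755; 9; 4349; 18; 1747; 21; 1699; 16; 94];
   [:: 10854; 9; 162; 11; 2198; 0; 78; 18; 119; 19; 37; 4; 8];
   [:: 2128989; 21; 361404; 9; 180481; 0; 24741; 4; 3255; 16; 14060; 20; 405185];
   [:: 20479342; 9; 1490100; 17; 283213; 0; 2225984; 4; 75458; 22; 1133222; 15; 1274661];
   [:: 238088; 4; 262; 17; 81468; 22; 30050; 14; 25209; 0; 60771; 19; 40258]];
   [::
   [:: 253707; 26; 279459668; 64; 37979335; 58; 141445510; 28; 765797417; 33; 834381102; 47; 8824504];
   [:: 1; 0; 1]; [:: 1; 1; 1]; [:: 1; 2; 1]; [:: 1; 3; 1];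
   [:: 253707; 26; 10352464; 64; 1094966; 58; 2076887; 28; 11844481; 33; 16948113; 47; 780302];
   [:: 1; 5; 1];
   [:: 19751; 48; 546911; 58; 42181961; 19; 1180843; 64; 922363; 66; 6256321; 65; 50009858];
   [:: 1; 6; 1]; [:: 1; 4; 1];
   [:: 9861; 48; 170177; 58; 2271226; 55; 298270; 63; 1422781; 19; 256354; 65; 2710972];
   [:: 80230; 56; 5424959; 48; 14961442; 58; 209080; 61; 37100; 12; 127995; 47; 1784932];
   [:: 1; 8; 1];
   [:: 659635; 41; 1141559; 2; 3486; 8; 150239; 65; 380708; 48; 11163429; 39; 10307591];
   [:: 1730; 19; 6035; 55; 797194; 62; 15073; 59; 127380; 64; 65000; 58; 140724];
   [:: 55704; 64; 840; 17; 9504; 39; 17256; 27; 57491; 31; 13723; 21; 94128];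
   [:: 1; 27; 2; 66; 3; 57; 66; 34; 1]; [:: 1; 16; 1]; [:: 1; 15; 1];
   [:: 1; 12; 1]; [:: 1; 11; 1]; [:: 1; 17; 1]; [:: 1; 13; 1];
   [:: 65480; 26; 15895; 64; 2857; 47; 7018; 28; 143736; 33; 23426; 41; 26737];
   [:: 1; 18; 1]; [:: 1; 57; 24; 27; 1]; [:: 1; 21; 1]; [:: 1; 25; 1];
   [:: 1; 26; 1]; [:: 1; 23; 1]; [:: 1; 24; 1]; [:: 1; 27; 1];
   [:: 845; 65; 2435; 58; 2050; 55; 668; 46; 2664; 19; 978; 63; 9678];
   [:: 1; 31; 1]; [:: 1; 28; 1];
   [:: 7443; 65; 4585; 55; 421037; 19; 777; 59; 69224; 64; 43486; 58; 77109];
   [:: 67104; 26; 5644; 24; 19432; 31; 5329; 64; 3076; 33; 16473; 41; 17108];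
   [:: 1; 19; 1]; [:: 1; 29; 1]; [:: 1; 30; 1];
   [:: 10576; 47; 68; 41; 25914; 48; 578; 24; 191; 55; 2908; 58; 1549];
   [:: 1; 34; 1]; [:: 1; 22; 1]; [:: 1; 36; 1];
   [:: 146552; 48; 22500; 58; 742832; 63; 33491; 61; 4491; 19; 50977; 65; 940575];
   [:: 3833494; 54; 7071; 58; 66645; 63; 212713; 26; 13475; 41; 4216969; 24; 17037];
   [:: 1; 38; 1]; [:: 1; 39; 1]; [:: 1; 41; 1];
   [:: 725; 65; 140; 41; 5; 55; 10249; 62; 3933; 66; 365; 58; 2144];
   [:: 1; 43; 1]; [:: 1; 40; 1]; [:: 1; 45; 1];
   [:: 67626; 62; 34703; 58; 263654; 48; 6200; 19; 2079; 66; 43190; 65; 309182];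
   [:: 12385; 55; 33111; 47; 2301; 19; 212; 64; 8192; 66; 10952; 58; 9906];
   [:: 1; 48; 1]; [:: 1; 50; 1]; [:: 1; 66; 1; 57; 1]; [:: 1; 47; 1];
   [:: 1; 46; 1]; [:: 1; 51; 1];
   [:: 3861; 61; 72; 58; 6962; 48; 383; 62; 1778; 66; 419; 65; 8561];
   [:: 1; 56; 1]; [:: 1; 52; 1];
   [:: 395; 63; 178; 41; 1; 65; 7; 62; 288; 55; 262; 56; 108]; [:: 1; 55; 1];
   [:: 1; 66; 1]];
   [::
   [:: 4442; 39; 145; 64; 332; 61; 4423; 62; 1917; 58; 8028; 65; 9986];
   [:: 102; 41; 4231; 58; 170319; 66; 42899; 63; 490667; 65; 236312; 61; 42250];
   [:: 306; 41; 12499; 58; 398505; 66; 60011; 63; 1340747; 65; 618674; 61; 137656];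
   [:: 5424; 41; 68510; 58; 1710680; 63; 6772127; 62; 373989; 65; 3226495; 61; 931955];
   [:: 102; 41; 347; 58; 10911; 66; 8455; 63; 71329; 65; 15598; 61; 5414];
   [:: 1808; 41; 2862; 58; 101976; 63; 236407; 62; 22429; 65; 214375; 61; 71707];
   [:: 5424; 41; 3962; 58; 106712; 63; 394085; 62; 71799; 65; 217717; 61; 68417];
   [:: 1808; 41; 642; 58; 23944; 63; 30313; 62; 9411; 65; 44713; 61; 12437];
   [:: 918; 41; 277; 58; 10941; 66; 4655; 63; 39569; 65; 13910; 61; 2512];
   [:: 5456; 30; 254; 58; 30066; 65; 60817; 63; 43337; 62; 42323; 61; 17695];
   [:: 2712; 41; 502; 58; 14104; 63; 50251; 62; 1977; 65; 24827; 61; 6199];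
   [:: 5424; 41; 634; 58; 27256; 63; 49429; 62; 10071; 65; 52565; 61; 15025];
   [:: 17061; 66; 3912; 58; 81578; 65; 86847; 30; 302; 62; 57687; 61; 9032];
   [:: 459; 41; 22; 58; 1149; 66; 320; 63; 2339; 65; 1925; 61; 574];
   [:: 918; 41; 61; 58; 3165; 66; 11; 63; 2417; 65; 4190; 61; 298];
   [:: 8884; 64; 6925; 39; 1439; 58; 6041; 65; 1164; 62; 6878; 61; 10702];
   [:: 12974; 66; 8778; 58; 47150; 65; 41360; 61; 333; 39; 607; 62; 72489];
   [:: 542; 66; 1198; 61; 575; 58; 449; 62; 371; 64; 477; 65; 368];
   [:: 271; 66; 341; 61; 277; 58; 328; 62; 437; 64; 136; 65; 535];
   [:: 8374; 66; 5323; 30; 227; 65; 4323; 64; 1869; 58; 5197; 61; 8787];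
   [:: 3841; 41; 281; 58; 911; 56; 1480; 62; 2947; 63; 18019; 61; 1786];
   [:: 5424; 41; 286; 58; 472; 63; 29407; 62; 3525; 65; 3599; 61; 2851];
   [:: 3861; 61; 72; 58; 6962; 48; 383; 62; 1778; 66; 419; 65; 8561]];
   [::
   [:: 4442; 39; 145; 64; 332; 61; 4423; 62; 1917; 58; 8028; 65; 9986];
   [:: 1; 7; 1];
   [:: 288; 9; 144; 44; 24408; 42; 12724; 35; 831; 53; 768; 61; 4231];
   [:: 1; 10; 1];
   [:: 79537213; 9; 22521315; 42; 6997284; 28; 2481; 54; 2117211; 63; 13653810; 37; 2538808];
   [:: 34108711; 9; 227198; 60; 141889419; 20; 1731663; 14; 15304314; 63; 99425858; 37; 5759890];
   [:: 218977; 65; 35966; 20; 1922; 44; 88894; 32; 313406; 60; 351880; 37; 3707];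
   [:: 1; 35; 1]; [:: 1; 42; 1];
   [:: 21067; 60; 13306; 64; 4042; 61; 1230; 65; 149; 20; 2511; 37; 575];
   [:: 1; 44; 1];
   [:: 113762; 44; 38614; 20; 3320; 53; 12545; 14; 1096; 60; 126169; 63; 91459];
   [:: 2221; 39; 111; 64; 1985; 61; 5178; 62; 671; 58; 2883; 65; 3953];
   [:: 15890; 63; 16815; 60; 12053; 42; 1222; 53; 2377; 58; 2216; 14; 116];
   [:: 1; 53; 1];
   [:: 12974; 66; 9902; 58; 43066; 65; 12644; 61; 2637; 39; 599; 62; 32633];
   [:: 542; 66; 786; 61; 741; 58; 671; 62; 989; 64; 807; 65; 84];
   [:: 7; 60; 1; 58; 9; 65; 2; 63; 21; 62; 18; 59; 7];
   [:: 224; 61; 63; 58; 265; 65; 104; 62; 117; 64; 21; 60; 682];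
   [:: 4453; 30; 30; 58; 6262; 63; 16252; 56; 603; 62; 6346; 61; 474];
   [:: 373232; 34; 5447; 61; 88701; 63; 36580; 37; 18379; 58; 168403; 54; 84984];
   [:: 42062; 65; 3372; 42; 57; 37; 4050; 62; 243; 58; 257; 64; 551];
   [:: 1; 61; 1]]].

Lemma thin_check2 :
  thin_check 6 coef_f coef_g2 gens_T2 gens_B2 certs2.
Proof. by vm_compute. Qed.

Definition gens_T3 : seq (seq Z) :=
  [::
   [:: 0; -10; 8; -28; 8; -10]; [:: -379; -2331; 741; -8777; 2268; -3652];
   [:: -247; -1736; 937; -6095; 1650; -2415];
   [:: -44; -373; 277; -1181; 347; -437]; [:: -23; -156; 84; -570; 147; -221];
   [:: -16; -114; 55; -396; 110; -156]; [:: -5; -41; 22; -122; 31; -45];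
   [:: -4; -37; 25; -110; 34; -41]; [:: -2; -12; 3; -45; 11; -19];
   [:: -1; -15; 2; -44; 7; -21]; [:: -1; -14; 4; -44; 11; -20];
   [:: -2; -11; 0; -42; 10; -19]; [:: -1; -17; 2; -37; 1; -12];
   [:: -1; -14; -1; -37; 0; -17]; [:: -1; -10; 7; -31; 9; -11];
   [:: -1; -12; -2; -31; 0; -13]; [:: -1; -14; 7; -26; 4; -6];
   [:: -1; -8; 4; -26; 6; -9]; [:: -1; -7; 4; -25; 7; -10];
   [:: -1; -7; 2; -21; 2; -9]; [:: -1; -5; -2; -18; 3; -9]].

Definition gens_B3 : seq (seq Z) :=
  [::
   [:: -105521; -395744; -636513; -674192; -542053; -282994];
   [:: -26340; -102134; -169976; -196594; -139090; -105521];
   [:: -3226; -14404; -14126; -45290; 161; -26340];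
   [:: -6969; -26079; -41824; -44172; -35548; -18237];
   [:: -2941; -10762; -16779; -17322; -13947; -6451];
   [:: -1339; -5655; -7599; -15167; -3737; -9336];
   [:: -1797; -6959; -11580; -13235; -9639; -6969];
   [:: -1002; -3808; -6206; -6640; -5313; -2941];
   [:: -229; -999; -1141; -2940; -219; -1797];
   [:: -350; -1304; -2080; -2188; -1763; -887];
   [:: -200; -808; -1376; -1701; -1067; -1002];
   [:: -201; -738; -1155; -1195; -961; -452];
   [:: -211; -700; -994; -996; -782; -295];
   [:: -122; -471; -779; -885; -663; -443];
   [:: -109; -410; -662; -704; -565; -302];
   [:: -144; -483; -692; -695; -549; -211];
   [:: -96; -370; -612; -687; -513; -350];
   [:: -80; -294; -461; -478; -386; -182];
   [:: -101; -329; -460; -460; -359; -131];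
   [:: -93; -316; -457; -459; -365; -144];
   [:: -66; -252; -413; -446; -352; -201];
   [:: -81; -277; -403; -405; -322; -128];
   [:: -75; -247; -348; -348; -273; -101];
   [:: -64; -222; -327; -329; -262; -107];
   [:: -56; -194; -285; -286; -228; -93];
   [:: -22; -95; -113; -275; -36; -162];
   [:: -33; -128; -213; -247; -174; -133];
   [:: -47; -164; -243; -245; -196; -81];
   [:: -21; -89; -122; -234; -65; -141];
   [:: -26; -101; -168; -198; -134; -109];
   [:: -17; -75; -91; -191; -45; -122]; [:: -34; -121; -183; -186; -149; -64];
   [:: -26; -99; -162; -174; -138; -80];
   [:: -30; -107; -162; -164; -131; -56]; [:: -14; -60; -81; -159; -34; -96];
   [:: -19; -73; -121; -136; -102; -66]; [:: -24; -86; -131; -133; -107; -47];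
   [:: -15; -63; -100; -132; -76; -74]; [:: -12; -49; -82; -110; -63; -66];
   [:: -15; -55; -86; -89; -72; -34]; [:: -13; -48; -76; -79; -64; -30];
   [:: -7; -29; -40; -77; -23; -46]; [:: -10; -37; -59; -61; -49; -24];
   [:: -4; -18; -17; -57; 1; -33]; [:: -3; -14; -10; -48; 5; -26];
   [:: -5; -20; -34; -44; -24; -26]; [:: -3; -13; -15; -38; -4; -23];
   [:: -4; -17; -23; -37; -17; -20]; [:: -5; -19; -31; -33; -26; -15];
   [:: -3; -12; -16; -31; -10; -19]; [:: -7; -22; -30; -30; -23; -8];
   [:: -4; -15; -25; -27; -22; -13]; [:: -3; -11; -19; -21; -16; -10];
   [:: -1; -5; -2; -18; 3; -9]; [:: -1; -4; -7; -9; -5; -5];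
   [:: -1; -3; -5; -6; -3; -4]; [:: -1; -3; -4; -4; -3; -1]].

Definition certs3 : seq (seq (seq Z)) :=
  [:: [::
   [:: 1; 0; 1]; [:: 1; 1; 1; 0; 379]; [:: 1; 2; 1; 0; 247];
   [:: 1; 3; 1; 0; 44]; [:: 1; 4; 1; 0; 23]; [:: 1; 5; 1; 0; 16];
   [:: 1; 6; 1; 0; 5]; [:: 1; 7; 1; 0; 4]; [:: 1; 8; 1; 0; 2];
   [:: 1; 9; 1; 0; 1]; [:: 1; 10; 1; 0; 1]; [:: 1; 11; 1; 0; 2];
   [:: 1; 12; 1; 0; 1]; [:: 1; 13; 1; 0; 1]; [:: 1; 14; 1; 0; 1];
   [:: 1; 15; 1; 0; 1]; [:: 1; 16; 1; 0; 1]; [:: 1; 17; 1; 0; 1];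
   [:: 1; 18; 1; 0; 1]; [:: 1; 19; 1; 0; 1]; [:: 1; 20; 1; 0; 1]];
   [::
   [:: 62930; 4; 56974924; 12; 3346568428; 0; 602113405; 15; 420327894; 20; 824435818; 13; 738681138];
   [:: 41650; 16; 28183694; 12; 380343306; 0; 145802829; 4; 4502710; 20; 220663472; 13; 364308198];
   [:: 1064; 12; 320190; 16; 103968; 0; 1260928; 10; 395966; 20; 1458619; 9; 1153721];
   [:: 62930; 4; 3784044; 12; 223865838; 0; 40481045; 15; 29467354; 20; 55823018; 13; 42369948];
   [:: 124950; 16; 3659033; 12; 208125267; 0; 40727903; 4; 2868470; 20; 75632079; 13; 14086761];
   [:: 930; 9; 314810; 12; 90721; 0; 330889; 16; 84829; 20; 401977; 13; 352933];
   [:: 5950; 16; 172382; 12; 3962868; 0; 1232687; 4; 56130; 20; 1806716; 13; 3459194];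
   [:: 31465; 4; 263041; 12; 14795837; 0; 2746895; 15; 2824521; 20; 3203957; 13; 4653672];
   [:: 56; 12; 1290; 16; 712; 0; 3092; 10; 474; 20; 4049; 9; 6299];
   [:: 4495; 4; 13473; 12; 826921; 0; 148055; 15; 74023; 20; 223141; 13; 139286];
   [:: 41650; 16; 94773; 12; 2273327; 0; 1506693; 4; 3370; 20; 2332699; 13; 3551691];
   [:: 124950; 16; 181657; 12; 14175693; 0; 2749087; 4; 194830; 20; 5102541; 13; 1173969];
   [:: 22848; 16; 855776; 12; 2008928; 0; 723741; 11; 767006; 20; 262500; 4; 6944];
   [:: 12586; 4; 11786; 12; 615104; 0; 141655; 15; 71876; 20; 152844; 13; 424590];
   [:: 62930; 4; 58272; 12; 3397184; 0; 609015; 15; 396032; 20; 828074; 13; 897824];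
   [:: 22848; 16; 525664; 12; 1428384; 0; 485809; 11; 435030; 20; 285684; 4; 7840];
   [:: 8330; 16; 10479; 12; 320341; 0; 86479; 4; 4610; 20; 130797; 13; 232033];
   [:: 41650; 16; 15659; 12; 1876441; 0; 346069; 4; 27060; 20; 631217; 13; 186303];
   [:: 2856; 16; 58640; 12; 112176; 0; 44693; 11; 51918; 20; 8652; 4; 224];
   [:: 22848; 16; 304160; 12; 954656; 0; 316149; 11; 204782; 20; 296772; 4; 6944];
   [:: 62930; 4; 34066; 12; 1865052; 0; 379835; 15; 500486; 20; 388082; 13; 616242];
   [:: 11424; 16; 123392; 12; 427136; 0; 134079; 11; 94826; 20; 118188; 4; 2912];
   [:: 2856; 16; 40688; 12; 86608; 0; 32521; 11; 36550; 20; 8652; 4; 224];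
   [:: 22848; 16; 164704; 12; 706784; 0; 208199; 11; 126650; 20; 218988; 4; 5152];
   [:: 3264; 16; 21728; 12; 87072; 0; 26639; 11; 15402; 20; 29196; 4; 608];
   [:: 186; 16; 115; 9; 1103; 0; 1501; 12; 457; 20; 1798; 13; 619];
   [:: 62475; 16; 55601; 12; 705999; 0; 277916; 4; 8240; 20; 419913; 13; 690642];
   [:: 11424; 16; 53440; 12; 265344; 0; 76177; 11; 30294; 20; 100884; 4; 2464];
   [:: 155; 16; 144; 9; 580; 0; 939; 12; 376; 20; 1147; 13; 1008];
   [:: 2450; 16; 2464; 12; 19936; 0; 10099; 4; 160; 20; 15732; 13; 21888];
   [:: 4100; 16; 11134; 9; 33443; 0; 8261; 13; 14922; 20; 7973; 19; 2228];
   [:: 5712; 16; 11216; 12; 103840; 0; 26197; 11; 2686; 20; 45444; 4; 1232];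
   [:: 6293; 4; 1223; 12; 77112; 0; 14752; 15; 5250; 20; 21867; 13; 31260];
   [:: 22848; 16; 41568; 12; 368608; 0; 89981; 11; 36958; 20; 124068; 4; 3360];
   [:: 1860; 12; 6146; 16; 164; 0; 5009; 9; 10615; 20; 7967; 13; 1148];
   [:: 31465; 4; 4631; 12; 240037; 0; 60110; 15; 66066; 20; 57192; 13; 128027];
   [:: 124950; 16; 154532; 12; 1606668; 0; 403937; 4; 19580; 20; 762066; 13; 25194];
   [:: 124950; 16; 8309; 12; 592641; 0; 387719; 4; 110; 20; 584667; 13; 686103];
   [:: 41650; 16; 1337; 12; 111713; 0; 94792; 4; 930; 20; 120781; 13; 244579];
   [:: 124950; 16; 26341; 12; 1032759; 0; 200056; 4; 14740; 20; 364083; 13; 112047];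
   [:: 62930; 4; 7262; 12; 444584; 0; 81045; 15; 60102; 20; 118914; 13; 27464];
   [:: 310; 16; 138; 9; 65; 0; 803; 12; 102; 20; 899; 13; 966];
   [:: 4495; 4; 338; 12; 24706; 0; 4890; 15; 1448; 20; 8611; 13; 2411];
   [:: 266; 12; 88; 16; 38; 0; 395; 10; 150; 20; 447; 9; 341];
   [:: 38; 20; 70; 12; 8; 0; 67; 10; 24; 9; 12];
   [:: 223; 12; 311; 9; 92; 0; 204; 15; 61; 20; 327; 13; 324];
   [:: 930; 13; 316; 16; 178; 0; 883; 12; 172; 20; 1054; 9; 1070];
   [:: 1225; 16; 399; 12; 1001; 0; 1259; 4; 10; 20; 1412; 13; 1858];
   [:: 31465; 4; 1013; 12; 77476; 0; 16145; 15; 1148; 20; 28321; 13; 27081];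
   [:: 4100; 19; 1292; 9; 1477; 0; 3679; 16; 1326; 20; 3247; 13; 4958];
   [:: 84; 16; 144; 12; 200; 0; 97; 11; 122];
   [:: 4495; 4; 173; 12; 7911; 0; 1040; 15; 23; 20; 1096; 13; 4971];
   [:: 2170; 4; 68; 12; 2296; 0; 605; 15; 1568; 20; 76; 13; 1006];
   [:: 1; 20; 1; 0; 1];
   [:: 946; 12; 150; 15; 414; 0; 237; 17; 32; 20; 200; 13; 150];
   [:: 2050; 19; 94; 9; 639; 0; 228; 16; 582; 20; 479; 13; 256];
   [:: 28; 16; 8; 12; 8; 0; 5; 11; 6]];
   [::
   [:: 18374; 19; 167981604; 7; 203297130; 0; 303313939; 17; 181422348; 20; 233980040; 16; 542270342];
   [:: 99493; 3; 18659328; 16; 319999005; 0; 206759561; 17; 401311331; 7; 213795799; 19; 223141656];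
   [:: 530; 6; 1907; 8; 314745; 18; 90944; 5; 612; 11; 423422; 1; 325];
   [:: 18374; 19; 10149012; 7; 12952714; 0; 20794045; 17; 11333932; 20; 17542094; 16; 37212512];
   [:: 18374; 19; 1516060; 7; 3340304; 0; 11455873; 17; 5666670; 20; 13890132; 16; 19603856];
   [:: 40; 19; 24; 20; 197; 4; 56; 2; 192; 6; 135; 18; 3952];
   [:: 99493; 3; 1317919; 16; 24496307; 0; 14917240; 17; 22506058; 7; 14370932; 19; 16314392];
   [:: 18374; 19; 1971516; 7; 2274944; 0; 2388615; 17; 1876534; 20; 1071148; 16; 4391774];
   [:: 558854; 4; 394; 18; 56486; 19; 77038; 9; 19504; 1; 337244; 0; 2083];
   [:: 18374; 19; 458228; 7; 603012; 0; 1105021; 17; 583698; 20; 1020104; 16; 1956822];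
   [:: 24604; 3; 78738; 16; 191376; 0; 49165; 14; 451094; 7; 135200; 17; 273058];
   [:: 18374; 19; 115786; 7; 245288; 0; 760073; 17; 389128; 20; 900004; 16; 1307104];
   [:: 22848; 16; 1838240; 12; 698976; 0; 1051229; 11; 919326; 20; 285348; 4; 6944];
   [:: 99493; 3; 69619; 16; 1969514; 0; 1096269; 17; 959300; 7; 1184200; 19; 1409296];
   [:: 18374; 19; 192736; 7; 219872; 0; 297281; 17; 201600; 20; 198382; 16; 530560];
   [:: 72; 17; 840; 16; 4056; 0; 2471; 11; 1234; 20; 1908; 12; 1096];
   [:: 198986; 3; 83020; 16; 2974590; 0; 1781501; 17; 2771932; 7; 1918680; 19; 2028534];
   [:: 9187; 19; 30480; 7; 51405; 0; 148408; 17; 73944; 20; 169155; 16; 255761];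
   [:: 2856; 16; 104336; 12; 51248; 0; 59925; 11; 59534; 20; 8652; 4; 224];
   [:: 504; 17; 5208; 16; 18768; 0; 11611; 11; 4178; 20; 10836; 12; 3704];
   [:: 9187; 19; 66378; 7; 79784; 0; 72413; 17; 59295; 20; 26045; 16; 135488];
   [:: 63; 17; 546; 16; 2091; 0; 1285; 11; 464; 20; 1197; 12; 341];
   [:: 408; 16; 11408; 12; 4912; 0; 6511; 11; 6154; 20; 1236; 4; 32];
   [:: 2016; 12; 4864; 17; 15456; 0; 33749; 11; 9934; 20; 34020; 16; 54816];
   [:: 126; 12; 332; 17; 798; 0; 1807; 11; 662; 20; 1638; 16; 2964];
   [:: 32; 17; 16; 20; 37; 6; 15; 11; 96; 18; 384];
   [:: 99493; 3; 23858; 16; 393339; 0; 256307; 17; 507083; 7; 264002; 19; 277087];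
   [:: 252; 12; 172; 17; 1848; 0; 3233; 11; 346; 20; 4032; 16; 5100];
   [:: 1; 6; 1; 18; 16];
   [:: 198986; 3; 34372; 16; 519056; 0; 373421; 17; 992456; 7; 436860; 19; 402316];
   [:: 1015; 16; 67; 17; 213; 4; 717; 8; 71; 18; 242; 19; 100];
   [:: 9187; 19; 428; 7; 6527; 0; 80634; 17; 46221; 20; 109997; 16; 129604];
   [:: 18374; 19; 53916; 7; 59698; 0; 58191; 17; 64190; 20; 17224; 16; 103602];
   [:: 196; 17; 692; 7; 96; 0; 1525; 11; 270; 20; 1740; 16; 2524];
   [:: 3230; 7; 35; 11; 761; 5; 2381; 16; 210; 6; 366; 18; 3422];
   [:: 198986; 3; 6328; 16; 642152; 0; 353333; 17; 371882; 7; 502274; 19; 479172];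
   [:: 18374; 19; 1722; 7; 12480; 0; 109427; 17; 66490; 20; 145526; 16; 177318];
   [:: 4604; 3; 766; 17; 9346; 0; 915; 18; 1582; 7; 5082; 16; 4100];
   [:: 18743; 3; 4944; 18; 4032; 0; 403; 19; 550; 16; 1531; 17; 1267];
   [:: 18374; 19; 11730; 7; 18110; 0; 56535; 17; 31278; 20; 64022; 16; 96140];
   [:: 9187; 19; 5615; 7; 9836; 0; 22939; 17; 8088; 20; 25587; 16; 40797];
   [:: 3142; 20; 571; 16; 188; 3; 99; 19; 1835; 18; 13792; 7; 313];
   [:: 9187; 19; 3055; 7; 7544; 0; 17250; 17; 9039; 20; 19337; 16; 30263];
   [:: 1; 11; 1; 8; 1]; [:: 1; 20; 1; 11; 1];
   [:: 32228; 3; 1138; 16; 1992; 0; 2303; 17; 28394; 7; 16746; 18; 13698];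
   [:: 1; 8; 1; 18; 1];
   [:: 99493; 3; 1013; 16; 20033; 0; 11454; 17; 110819; 7; 40501; 19; 60544];
   [:: 18374; 19; 7626; 7; 10646; 0; 12131; 17; 13596; 20; 6632; 16; 21432];
   [:: 41339; 3; 647; 17; 4283; 0; 4528; 4; 1788; 18; 27178; 19; 22964];
   [:: 84; 16; 192; 12; 136; 0; 113; 11; 130];
   [:: 198986; 3; 3266; 7; 77542; 0; 93403; 17; 65588; 19; 122912; 16; 153572];
   [:: 18374; 19; 9286; 7; 8400; 0; 5987; 17; 1998; 20; 780; 16; 9458];
   [:: 1; 20; 1];
   [:: 46799; 19; 281; 7; 7480; 0; 39; 16; 1739; 3; 211; 18; 5575];
   [:: 2845; 17; 2005; 16; 156; 0; 401; 12; 44; 20; 388; 13; 252];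
   [:: 28; 16; 8; 12; 8; 0; 5; 11; 6]];
   [::
   [:: 900528; 19; 13642769; 53; 46528651; 4; 48117391; 27; 127943698; 40; 1782474629; 33; 2760998125];
   [:: 1; 0; 1]; [:: 1; 1; 1];
   [:: 900528; 19; 305581; 53; 3050351; 4; 2678435; 33; 235299113; 27; 7472954; 40; 84921553];
   [:: 217; 27; 10096; 36; 8601; 39; 235; 33; 22762; 31; 891; 47; 563];
   [:: 17932; 10; 117639; 13; 264622; 32; 319980; 16; 399629; 51; 5337124; 20; 660138];
   [:: 1; 3; 1]; [:: 1; 4; 1]; [:: 1; 6; 1];
   [:: 5617; 31; 24078; 47; 1642; 39; 8412; 33; 74780; 4; 435; 40; 39088];
   [:: 1; 7; 1];
   [:: 434; 27; 1039; 36; 1943; 39; 461; 33; 2461; 31; 577; 47; 85];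
   [:: 13; 18; 32; 24; 10; 56; 40; 55; 3];
   [:: 253253; 48; 3172497; 7; 14134; 24; 2478; 40; 6235099; 47; 214445; 50; 16213];
   [:: 86314; 53; 6189; 4; 4837; 19; 3945; 33; 206005; 40; 281719; 39; 108376];
   [:: 1; 12; 1]; [:: 1; 9; 1];
   [:: 827; 27; 306; 47; 27; 39; 344; 33; 2022; 31; 2035; 40; 78];
   [:: 1; 56; 2; 50; 4; 18; 1]; [:: 1; 15; 1]; [:: 1; 11; 1];
   [:: 6236; 22; 4529; 33; 534; 53; 43; 21; 4652; 19; 706]; [:: 1; 18; 1];
   [:: 12472; 22; 2903; 24; 6236; 33; 544; 21; 1154; 19; 7072; 53; 73];
   [:: 1; 19; 1];
   [:: 83988; 55; 183316; 37; 51286; 16; 29713; 48; 628994; 51; 896158; 10; 15357];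
   [:: 780429328; 51; 366842983; 9; 12713894; 0; 652582; 3; 2993880; 47; 16597023; 7; 8071879];
   [:: 1; 21; 1];
   [:: 29924; 10; 3187; 37; 18322; 20; 14119; 48; 184993; 51; 354445; 54; 32455];
   [:: 1; 14; 1]; [:: 1; 13; 1]; [:: 1; 23; 1]; [:: 1; 17; 1]; [:: 1; 24; 1];
   [:: 1; 16; 1];
   [:: 2016; 48; 5812; 47; 142; 51; 63; 40; 4890; 11; 197; 56; 9];
   [:: 1; 27; 1];
   [:: 57856; 48; 239982; 20; 2242; 7; 1927; 40; 38512; 47; 31991; 51; 93497];
   [:: 1; 20; 1]; [:: 1; 31; 1]; [:: 1; 33; 1];
   [:: 14962; 48; 25223; 37; 2354; 10; 367; 20; 3377; 51; 48985; 54; 34605];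
   [:: 1; 36; 1]; [:: 1; 26; 1]; [:: 1; 29; 1]; [:: 1; 32; 1];
   [:: 20997; 55; 3064; 37; 1741; 16; 1615; 48; 8840; 51; 37828; 10; 516];
   [:: 5336; 51; 10163; 37; 997; 20; 7; 40; 3581; 53; 236; 54; 3862];
   [:: 1; 39; 1]; [:: 1; 35; 1]; [:: 1; 56; 1; 50; 1]; [:: 1; 40; 1];
   [:: 1; 42; 1];
   [:: 1264925; 33; 9162; 30; 1088; 10; 46148; 51; 21674; 24; 10528; 56; 1185105];
   [:: 1; 48; 1]; [:: 1; 51; 1]; [:: 1; 56; 1]];
   [::
   [:: 5017283; 18; 45697; 30; 139028; 34; 441502; 40; 856632; 38; 1978374; 53; 2136225];
   [:: 114027; 33; 2879219; 30; 155480; 45; 35073084; 34; 1528745; 38; 9049946; 55; 22039672];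
   [:: 434867; 18; 1736710; 54; 281804502; 37; 5540475; 55; 53893738; 38; 28893386; 34; 7805007];
   [:: 190447; 18; 123550; 53; 3800601; 30; 125865; 54; 27203258; 38; 2600627; 55; 6395701];
   [:: 434867; 18; 127492; 54; 34049729; 37; 1231587; 55; 8025931; 38; 1065941; 34; 706297];
   [:: 434867; 18; 86565; 54; 15225207; 37; 965485; 55; 6524273; 38; 1387801; 34; 443630];
   [:: 190447; 18; 15966; 53; 315217; 30; 25406; 54; 2447438; 38; 270396; 55; 518240];
   [:: 190447; 18; 12297; 53; 353534; 30; 12196; 54; 1361697; 38; 335796; 55; 614215];
   [:: 456108; 33; 62645; 30; 4613; 45; 734925; 34; 23051; 38; 191432; 55; 413758];
   [:: 654488; 18; 7048; 34; 11379; 40; 301908; 53; 22642; 47; 404673; 38; 608913];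
   [:: 18498; 55; 13815; 48; 14872; 45; 2255; 40; 5041; 38; 13714; 30; 2377];
   [:: 24454; 45; 30145; 10; 90; 51; 9359; 55; 56880; 37; 9488; 48; 11853];
   [:: 15051849; 18; 231557; 30; 1251922; 34; 676021; 40; 5926291; 38; 3172148; 53; 11380404];
   [:: 7113; 47; 9460; 54; 23598; 52; 7045; 20; 52; 40; 2324; 38; 392];
   [:: 133657; 18; 2693; 53; 35433; 54; 297099; 55; 74338; 38; 48951; 34; 14568];
   [:: 2435883; 30; 150731; 37; 100123; 34; 163334; 40; 1313763; 38; 675115; 53; 135232];
   [:: 2220; 53; 2233; 52; 954; 56; 3072; 51; 52; 18; 5; 49; 1480];
   [:: 434867; 18; 6970; 54; 1250160; 37; 38454; 55; 278635; 38; 26492; 34; 56166];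
   [:: 434867; 18; 6889; 54; 1175736; 37; 23158; 55; 232035; 38; 122641; 34; 30432];
   [:: 473; 55; 95; 40; 79; 54; 960; 52; 353; 38; 75; 53; 216];
   [:: 1264925; 33; 9162; 30; 1088; 10; 46148; 51; 21674; 24; 10528; 56; 1185105]];
   [::
   [:: 5017283; 18; 45697; 30; 139028; 34; 441502; 40; 856632; 38; 1978374; 53; 2136225];
   [:: 32937267; 8; 149981; 44; 4092588; 2; 8251147; 43; 40760626; 24; 4879; 34; 1123803];
   [:: 166; 53; 679; 46; 27042; 28; 931; 44; 412; 54; 50; 8; 94];
   [:: 932930; 46; 519568; 30; 14589; 55; 54934; 45; 1748; 38; 83376; 5; 135113];
   [:: 24714; 43; 590; 34; 593; 56; 2809; 8; 6837; 55; 597; 30; 115];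
   [:: 2808; 44; 4043; 41; 1493; 54; 6279; 25; 2952; 8; 169; 38; 658];
   [:: 1; 28; 1];
   [:: 33289; 53; 26092; 38; 19883; 41; 38626; 49; 8819; 54; 3577; 8; 585];
   [:: 1; 43; 1];
   [:: 354567; 30; 28452; 24; 1786; 53; 532542; 51; 507377; 37; 6405; 47; 164603];
   [:: 15763512; 53; 35151995; 51; 16952420; 10; 222854; 55; 3503818; 18; 29439; 30; 213264];
   [:: 1; 44; 1];
   [:: 35973; 34; 1939; 56; 2368; 37; 14077; 40; 7585; 38; 9971; 53; 8723];
   [:: 85084; 33; 5446; 47; 86363; 53; 23773; 51; 23297; 37; 7437; 30; 6676];
   [:: 37366; 53; 7032; 10; 109; 34; 7323; 38; 170; 54; 31429; 49; 19791];
   [:: 230809; 30; 7083; 33; 7699; 37; 62146; 40; 20694; 47; 38742; 53; 138911];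
   [:: 143350; 53; 765; 30; 109; 48; 553; 37; 15293; 38; 96496; 45; 8154];
   [:: 42954; 44; 1469; 49; 2616; 54; 11315; 55; 2107; 34; 10095; 8; 21];
   [:: 1; 46; 1];
   [:: 21836635; 53; 347929; 30; 3421540; 8; 4214; 10; 4223; 55; 2845620; 49; 780190];
   [:: 1; 53; 1]]].

Lemma thin_check3 :
  thin_check 6 coef_f coef_g3 gens_T3 gens_B3 certs3.
Proof. by vm_compute. Qed.

Definition gens_T4 : seq (seq Z) :=
  [::
   [:: 0; -9; 12; -22; 12; -9];
   [:: -13818; -73220; 84842; -236762; 137257; -119388];
   [:: -6246; -31393; 33951; -102469; 59738; -53518];
   [:: -2598; -13814; 16128; -44712; 25883; -22457];
   [:: -1892; -10992; 13900; -34573; 19783; -16505];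
   [:: -366; -1994; 2381; -6428; 3723; -3178];
   [:: -82; -566; 784; -1673; 943; -720];
   [:: -62; -417; 545; -1195; 669; -542]; [:: -16; -99; 132; -311; 177; -141];
   [:: -9; -60; 74; -164; 87; -72]; [:: -7; -81; 89; -159; 64; -58];
   [:: -5; -48; 61; -113; 55; -43]; [:: -3; -49; 35; -81; 25; -41];
   [:: -3; -33; 33; -81; 41; -35]; [:: -4; -29; 36; -81; 46; -35];
   [:: -5; -24; 24; -78; 45; -42]; [:: -3; -19; 23; -58; 32; -26];
   [:: -3; -17; 22; -56; 33; -27]; [:: -1; -18; 15; -41; 22; -24];
   [:: -2; -9; 8; -30; 18; -17]; [:: -1; -15; 10; -30; 12; -18];
   [:: -1; -10; 14; -30; 16; -12]; [:: -1; -8; 11; -21; 10; -8];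
   [:: -1; -7; 6; -15; 8; -8]; [:: -1; -4; 2; -12; 7; -8]].

Definition gens_B4 : seq (seq Z) :=
  [::
   [:: -31766; -109116; -17364; -242243; 113828; -221594];
   [:: -12655; -44211; -3185; -103786; 52012; -90654];
   [:: -13818; -46428; -12895; -94870; 39520; -92596];
   [:: -6246; -21434; -3524; -47435; 22263; -43559];
   [:: -2836; -9235; -4307; -16213; 4869; -17640];
   [:: -2598; -8719; -2501; -17640; 7254; -17362];
   [:: -1219; -4155; -826; -9000; 4096; -8392];
   [:: -358; -1187; -420; -2302; 891; -2343];
   [:: -188; -617; -255; -1130; 383; -1195];
   [:: -142; -460; -242; -754; 185; -854];
   [:: -138; -452; -201; -790; 228; -854];
   [:: -234; -621; -475; -276; -580; -516];
   [:: -159; -409; -294; -173; -392; -309];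
   [:: -53; -172; -87; -290; 72; -311];
   [:: -91; -244; -191; -111; -225; -209];
   [:: -81; -227; -192; -122; -186; -234];
   [:: -96; -226; -139; -97; -224; -140];
   [:: -80; -210; -157; -91; -199; -167]; [:: -33; -108; -54; -180; 47; -200];
   [:: -68; -183; -145; -85; -168; -159]; [:: -62; -149; -95; -64; -148; -96];
   [:: -46; -123; -96; -57; -114; -106]; [:: -18; -60; -23; -112; 42; -113];
   [:: -43; -102; -63; -43; -102; -63]; [:: -29; -82; -71; -48; -64; -91];
   [:: -37; -91; -60; -38; -90; -62]; [:: -30; -83; -69; -41; -73; -80];
   [:: -18; -58; -42; -56; -18; -81]; [:: -16; -51; -40; -57; -9; -81];
   [:: -9; -32; 0; -78; 41; -66]; [:: -27; -69; -49; -29; -67; -51];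
   [:: -21; -59; -51; -36; -45; -68]; [:: -27; -66; -43; -27; -66; -43];
   [:: -21; -59; -50; -35; -44; -64]; [:: -8; -27; -6; -58; 26; -55];
   [:: -20; -51; -36; -21; -49; -37]; [:: -15; -42; -35; -24; -32; -46];
   [:: -12; -32; -25; -14; -30; -27]; [:: -3; -11; 2; -30; 17; -23];
   [:: -7; -21; -19; -17; -10; -30]; [:: -7; -22; -12; -23; -4; -30];
   [:: -5; -16; -10; -23; 4; -29]; [:: -9; -24; -19; -11; -23; -20];
   [:: -4; -13; -7; -19; 1; -21]; [:: -3; -10; -6; -13; 1; -15];
   [:: -1; -4; 2; -12; 7; -8]; [:: -4; -11; -10; -6; -9; -12];
   [:: -5; -11; -6; -5; -11; -6]; [:: -3; -8; -7; -4; -7; -9];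
   [:: -1; -2; -2; -3; 0; -4]; [:: -1; -2; -2; -2; 0; -3];
   [:: -1; -2; -1; -1; -2; -1]].

Definition certs4 : seq (seq (seq Z)) :=
  [:: [::
   [:: 1; 0; 1]; [:: 1; 1; 1; 0; 13818]; [:: 1; 2; 1; 0; 6246];
   [:: 1; 3; 1; 0; 2598]; [:: 1; 4; 1; 0; 1892]; [:: 1; 5; 1; 0; 366];
   [:: 1; 6; 1; 0; 82]; [:: 1; 7; 1; 0; 62]; [:: 1; 8; 1; 0; 16];
   [:: 1; 9; 1; 0; 9]; [:: 1; 10; 1; 0; 7]; [:: 1; 11; 1; 0; 5];
   [:: 1; 12; 1; 0; 3]; [:: 1; 13; 1; 0; 3]; [:: 1; 14; 1; 0; 4];
   [:: 1; 15; 1; 0; 5]; [:: 1; 16; 1; 0; 3]; [:: 1; 17; 1; 0; 3];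
   [:: 1; 18; 1; 0; 1]; [:: 1; 19; 1; 0; 2]; [:: 1; 20; 1; 0; 1];
   [:: 1; 21; 1; 0; 1]; [:: 1; 22; 1; 0; 1]; [:: 1; 23; 1; 0; 1];
   [:: 1; 24; 1; 0; 1]];
   [::
   [:: 359; 23; 1736245; 18; 2571463; 0; 3978918; 20; 1400257; 24; 4753452; 22; 942577];
   [:: 718; 23; 1245758; 18; 1946441; 0; 3875074; 20; 815714; 24; 4493632; 22; 584745];
   [:: 718; 23; 1765618; 18; 2108293; 0; 2735636; 20; 1805184; 24; 3329424; 22; 912805];
   [:: 359; 23; 342185; 18; 523586; 0; 756471; 20; 269438; 24; 912715; 22; 194390];
   [:: 718; 23; 501768; 18; 217863; 0; 533360; 20; 641572; 24; 575282; 22; 99763];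
   [:: 359; 23; 163653; 18; 215132; 0; 228632; 20; 166584; 24; 287160; 22; 100153];
   [:: 359; 23; 73414; 18; 90798; 0; 150599; 20; 64219; 24; 177556; 22; 31634];
   [:: 718; 23; 56332; 18; 45233; 0; 71410; 20; 57290; 24; 82602; 22; 15587];
   [:: 359; 23; 15293; 18; 10858; 0; 16011; 20; 17867; 24; 18365; 22; 5109];
   [:: 718; 23; 30324; 18; 3607; 0; 30324; 20; 38450; 24; 28894; 22; 681];
   [:: 718; 23; 22334; 18; 13077; 0; 21616; 20; 30848; 24; 23824; 22; 9001];
   [:: 91426; 24; 6435808; 10; 607932; 22; 1552016; 13; 304037; 0; 1925106; 12; 2746075];
   [:: 91426; 24; 4189596; 10; 571270; 22; 796844; 13; 204197; 0; 1268006; 12; 1646271];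
   [:: 745; 12; 2297; 18; 2414; 0; 14223; 20; 6550; 24; 21389; 23; 2241];
   [:: 5936; 23; 68206; 12; 78975; 22; 98334; 13; 19101; 0; 25346; 24; 79408];
   [:: 5936; 23; 22206; 24; 154784; 12; 76215; 13; 4965; 0; 57730; 22; 60286];
   [:: 45713; 24; 1113759; 10; 243120; 22; 264720; 13; 69375; 0; 367283; 12; 366668];
   [:: 45713; 24; 1057307; 10; 118535; 22; 241476; 13; 60745; 0; 306327; 12; 448759];
   [:: 3883; 23; 37968; 13; 376; 0; 39219; 20; 47160; 24; 37131; 18; 4752];
   [:: 24; 23; 178; 12; 241; 22; 290; 13; 59; 0; 78; 24; 264];
   [:: 91426; 24; 1390752; 10; 280036; 22; 427840; 13; 107109; 0; 424482; 12; 522747];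
   [:: 8904; 23; 45058; 12; 60253; 22; 78770; 13; 13439; 0; 20142; 24; 64680];
   [:: 3883; 23; 18613; 13; 2458; 0; 16939; 20; 15336; 24; 17582; 18; 10989];
   [:: 45713; 24; 487058; 10; 106035; 22; 130212; 13; 32415; 0; 154798; 12; 169633];
   [:: 3611; 22; 12688; 24; 38709; 12; 16389; 20; 2310; 0; 14623; 23; 1845];
   [:: 45713; 24; 451751; 10; 79457; 22; 120316; 13; 19647; 0; 143730; 12; 168058];
   [:: 5936; 23; 10362; 12; 27957; 22; 26938; 13; 3215; 0; 15814; 24; 47264];
   [:: 3611; 24; 21091; 23; 10008; 12; 6411; 20; 13323; 0; 12808; 22; 1343];
   [:: 745; 24; 4224; 18; 59; 12; 857; 20; 3445; 0; 2478; 23; 1621];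
   [:: 359; 23; 416; 18; 743; 0; 1493; 20; 160; 24; 1713; 22; 199];
   [:: 45713; 24; 339776; 10; 48282; 22; 81994; 13; 19390; 0; 99613; 12; 138779];
   [:: 3611; 22; 10727; 24; 21827; 12; 10206; 20; 7090; 0; 8553; 23; 5569];
   [:: 45713; 24; 311954; 10; 60591; 22; 79828; 13; 20993; 0; 92682; 12; 118451];
   [:: 1113; 23; 1247; 24; 8232; 12; 3629; 13; 211; 0; 3399; 22; 2374];
   [:: 359; 23; 398; 18; 754; 0; 757; 20; 374; 24; 1002; 22; 344];
   [:: 91426; 13; 28513; 10; 82546; 24; 528318; 22; 54952; 0; 159464; 12; 193963];
   [:: 3611; 23; 6535; 24; 14950; 12; 7584; 22; 7001; 0; 6897; 20; 2927];
   [:: 2226; 23; 3692; 12; 3887; 22; 5008; 13; 913; 0; 1188; 24; 3612];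
   [:: 3883; 20; 120; 23; 808; 0; 8014; 13; 80; 24; 8809; 18; 1672];
   [:: 3611; 24; 6601; 23; 4918; 12; 2239; 20; 6363; 0; 3546; 22; 678];
   [:: 3611; 23; 10441; 24; 1587; 12; 1221; 22; 2297; 0; 4440; 20; 7289];
   [:: 359; 23; 665; 18; 172; 0; 306; 20; 670; 24; 240; 22; 48];
   [:: 2968; 23; 2138; 12; 3957; 22; 5274; 13; 1207; 0; 614; 24; 3808];
   [:: 8753; 12; 2356; 20; 8888; 0; 9751; 13; 194; 24; 15455; 22; 3019];
   [:: 653; 12; 196; 23; 89; 0; 175; 13; 109; 24; 602; 18; 353];
   [:: 10606; 23; 808; 0; 6971; 19; 3883; 20; 120; 13; 80; 18; 1672];
   [:: 17808; 23; 1438; 24; 26544; 12; 11335; 13; 437; 0; 9714; 22; 7934];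
   [:: 91426; 24; 109996; 10; 29236; 22; 32736; 13; 6797; 0; 40678; 12; 29785];
   [:: 157; 23; 125; 24; 11; 12; 42; 22; 101; 0; 10; 20; 108];
   [:: 3611; 22; 717; 12; 51; 0; 842; 20; 961; 24; 989; 23; 791];
   [:: 13060; 23; 7422; 18; 1058; 0; 1886; 13; 865; 24; 428; 12; 519];
   [:: 45713; 24; 11222; 10; 3257; 22; 3772; 13; 543; 0; 4810; 12; 2097]];
   [::
   [:: 2900; 19; 7206838; 2; 2086; 9; 164193; 15; 7238311; 1; 814; 17; 5253808];
   [:: 8; 19; 15908; 22; 8; 24; 3479; 15; 9780; 9; 137; 17; 5268];
   [:: 1; 1; 1]; [:: 1; 2; 1];
   [:: 5579054; 15; 118740091; 8; 27764832; 4; 3107388; 3; 412688; 9; 178839685; 17; 2074453564];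
   [:: 1; 3; 1];
   [:: 206; 19; 22604; 16; 28; 9; 905; 15; 23155; 8; 782; 17; 23130];
   [:: 132; 19; 1073; 9; 60; 5; 74; 15; 1201; 8; 372; 17; 1843];
   [:: 58164; 8; 94626; 22; 151654; 15; 511421; 4; 1154; 9; 56595; 17; 1339778];
   [:: 4968028; 9; 15034194; 22; 20668395; 4; 8151; 17; 166240281; 6; 141239; 7; 383221];
   [:: 725555; 24; 168472; 22; 205415; 20; 4873; 17; 396228; 4; 51996; 7; 2947];
   [:: 34953; 23; 371264; 10; 540190; 20; 9997; 17; 951497; 11; 232384; 0; 697578];
   [:: 78048; 23; 574604; 10; 1023165; 20; 125893; 13; 47611; 17; 1468049; 0; 1053752];
   [:: 13073; 14; 17207; 6; 2070; 24; 71170; 17; 91059; 23; 21480; 7; 1427];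
   [:: 7447; 17; 23274; 10; 33234; 23; 96793; 22; 162288; 14; 29034; 0; 74472];
   [:: 13051; 14; 61577; 10; 9440; 23; 162670; 22; 358418; 11; 44731; 0; 103127];
   [:: 210318; 23; 906516; 20; 784045; 15; 1126145; 13; 56341; 10; 1814317; 0; 2098791];
   [:: 75543; 23; 315804; 10; 457177; 11; 67216; 17; 728265; 13; 2174; 0; 553891];
   [:: 1; 17; 8; 9; 1];
   [:: 7447; 17; 4629; 10; 20617; 23; 90017; 22; 152069; 14; 26526; 0; 58676];
   [:: 4878; 23; 20924; 10; 25569; 20; 16003; 13; 3475; 17; 25367; 0; 17492];
   [:: 7447; 17; 8742; 10; 15311; 23; 59120; 22; 97363; 14; 13169; 0; 39768];
   [:: 708; 19; 2051; 22; 30; 17; 1347; 9; 137; 14; 536; 16; 398];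
   [:: 35053; 23; 65400; 20; 52205; 15; 86409; 13; 173; 10; 136730; 0; 164831];
   [:: 59251; 14; 74006; 11; 101773; 23; 204213; 22; 513815; 7; 3151; 0; 149139];
   [:: 156096; 23; 248092; 10; 491625; 20; 246161; 13; 42383; 17; 570925; 0; 363736];
   [:: 13051; 14; 19619; 10; 6569; 23; 65735; 22; 129821; 11; 14303; 0; 40887];
   [:: 1985515; 22; 4432589; 0; 513132; 10; 306411; 6; 279800; 14; 1410308; 7; 9306];
   [:: 709387; 17; 54005; 22; 142947; 7; 7284; 6; 127117; 14; 42507; 0; 51327];
   [:: 1; 15; 1; 19; 2];
   [:: 156096; 23; 213988; 10; 350775; 20; 61007; 13; 10769; 17; 483955; 0; 356200];
   [:: 59251; 7; 3304; 14; 42455; 23; 149199; 22; 436734; 11; 56734; 0; 114636];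
   [:: 78048; 23; 123020; 10; 179469; 20; 92341; 13; 23275; 17; 188609; 0; 130424];
   [:: 13051; 14; 20224; 10; 2582; 23; 41092; 22; 96214; 11; 7559; 0; 26418];
   [:: 1; 15; 1; 17; 1];
   [:: 26016; 23; 26732; 10; 42837; 20; 7645; 13; 6115; 17; 55913; 0; 39704];
   [:: 13051; 14; 13625; 10; 2430; 23; 29514; 22; 91571; 11; 634; 0; 20809];
   [:: 7447; 17; 4585; 10; 4898; 23; 10663; 22; 18056; 14; 3151; 0; 9572];
   [:: 1; 24; 1; 19; 1];
   [:: 19873; 22; 17834; 0; 4317; 21; 2732; 6; 1073; 14; 3871; 11; 3015];
   [:: 4637; 23; 1966; 0; 1643; 22; 17008; 13; 519; 14; 1362; 19; 3240];
   [:: 10099; 17; 1972; 22; 1566; 8; 2442; 16; 1171; 6; 5; 21; 18];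
   [:: 34953; 23; 31241; 10; 12187; 20; 3931; 17; 22427; 11; 25363; 0; 23598];
   [:: 4247; 23; 382; 22; 320; 18; 19; 17; 173; 7; 254; 0; 26];
   [:: 332; 14; 160; 0; 1; 22; 112; 17; 54; 23; 56; 19; 13]; [:: 1; 24; 1];
   [:: 13051; 14; 3010; 10; 10; 23; 8661; 22; 17993; 11; 2688; 0; 5349];
   [:: 5378; 24; 6732; 10; 2112; 22; 2512; 13; 239; 0; 3266; 12; 715];
   [:: 7447; 17; 736; 10; 260; 23; 3841; 22; 12988; 14; 371; 0; 2883];
   [:: 849; 23; 82; 0; 67; 7; 5; 20; 77; 22; 190; 19; 95];
   [:: 38868; 23; 3050; 12; 683; 22; 4810; 10; 384; 13; 5497; 19; 4890];
   [:: 45713; 24; 11222; 10; 3257; 22; 3772; 13; 543; 0; 4810; 12; 2097]];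
   [::
   [:: 23; 39; 158553; 31; 58259; 46; 458751; 28; 16105; 27; 13641; 48; 141710];
   [:: 268; 49; 354513; 39; 1391482; 46; 530; 31; 477295; 26; 132511; 50; 199740];
   [:: 2145; 39; 6699346; 24; 151335; 46; 11198676; 28; 489287; 26; 864836; 31; 3274567];
   [:: 598; 39; 815375; 31; 332856; 46; 2252504; 28; 77353; 27; 65110; 48; 643679];
   [:: 2145; 39; 890161; 24; 518940; 46; 1693326; 28; 56087; 26; 210581; 31; 122347];
   [:: 429; 39; 222670; 24; 29682; 46; 416259; 28; 19886; 26; 22877; 31; 112348];
   [:: 52; 39; 13177; 31; 5684; 46; 39210; 28; 831; 27; 1428; 48; 9647];
   [:: 2145; 39; 160388; 24; 29715; 46; 209613; 28; 5971; 26; 20413; 31; 71186];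
   [:: 715; 39; 19824; 24; 10770; 46; 39349; 28; 1578; 26; 3049; 31; 6153];
   [:: 55; 39; 1046; 24; 655; 46; 1761; 28; 52; 26; 386; 31; 57];
   [:: 2145; 39; 29038; 24; 27675; 46; 109998; 28; 6221; 26; 9128; 31; 601];
   [:: 7073; 30; 76252; 35; 24876; 42; 16919; 25; 19790; 45; 1987; 11; 884];
   [:: 2520; 45; 443; 35; 4971; 32; 4239; 20; 319; 42; 7172; 25; 12974];
   [:: 98; 50; 155; 36; 325; 46; 1058; 39; 1209; 26; 415; 48; 101];
   [:: 7712; 40; 553; 35; 6573; 12; 2648; 48; 4157; 30; 36904; 11; 199];
   [:: 1; 11; 1]; [:: 1; 23; 1; 25; 1; 47; 11; 51; 5];
   [:: 481; 30; 1328; 35; 650; 32; 158; 45; 43; 42; 169; 25; 693];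
   [:: 195; 39; 1063; 24; 330; 46; 1398; 28; 41; 26; 398; 31; 181];
   [:: 1; 12; 1]; [:: 1; 16; 1];
   [:: 7073; 30; 5511; 35; 16283; 42; 8794; 25; 2656; 45; 519; 11; 416];
   [:: 2; 48; 10; 39; 12; 49; 1; 26; 3; 31; 1]; [:: 1; 47; 4; 23; 1];
   [:: 1; 14; 1]; [:: 1; 20; 1]; [:: 1; 17; 1];
   [:: 15344; 50; 4164; 40; 4076; 39; 8449; 29; 419; 26; 37785; 51; 13704];
   [:: 1; 15; 1];
   [:: 1199; 49; 1931; 39; 5200; 31; 968; 43; 102; 26; 533; 48; 1359];
   [:: 2520; 32; 1467; 35; 1023; 42; 676; 20; 347; 45; 79; 25; 1102];
   [:: 1; 19; 1]; [:: 1; 23; 1];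
   [:: 666; 40; 80; 35; 33; 37; 1707; 48; 670; 17; 164; 26; 193];
   [:: 170; 39; 331; 31; 162; 46; 586; 28; 27; 26; 26; 48; 25]; [:: 1; 25; 1];
   [:: 1; 21; 1]; [:: 1; 30; 1];
   [:: 36; 48; 32; 39; 77; 49; 16; 51; 26; 26; 5; 45; 1]; [:: 1; 26; 1];
   [:: 1152; 49; 263; 43; 376; 31; 533; 42; 1010; 26; 385; 48; 320];
   [:: 1; 24; 1]; [:: 1; 35; 1]; [:: 1; 33; 1]; [:: 1; 36; 1];
   [:: 1; 39; 1; 51; 1]; [:: 1; 37; 1]; [:: 1; 51; 1; 47; 1]; [:: 1; 42; 1];
   [:: 1; 46; 1]; [:: 1; 48; 1]; [:: 1; 51; 1]];
   [::
   [:: 14010; 29; 2231; 50; 3506; 49; 796; 28; 2805; 26; 1225; 48; 6693];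
   [:: 496; 50; 2016706; 39; 5176949; 44; 1113454; 29; 321661; 26; 311609; 49; 5377518];
   [:: 992; 50; 2432774; 39; 4936917; 44; 422210; 29; 294001; 26; 283937; 49; 3667914];
   [:: 1488; 50; 1120670; 39; 2891745; 44; 709386; 29; 175901; 26; 174253; 49; 3114274];
   [:: 496; 50; 65970; 39; 623773; 44; 308814; 29; 43813; 26; 44913; 49; 1085950];
   [:: 248; 50; 26526; 39; 68369; 44; 15106; 29; 4693; 26; 4029; 49; 74610];
   [:: 2304; 49; 151468; 39; 114159; 50; 112436; 29; 11981; 26; 7375; 43; 66696];
   [:: 9216; 39; 313449; 29; 22843; 50; 301036; 49; 444212; 26; 27785; 43; 254136];
   [:: 992; 50; 2986; 39; 10743; 44; 4734; 29; 1011; 26; 683; 49; 17894];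
   [:: 2976; 49; 29338; 50; 1142; 44; 2562; 29; 2765; 26; 1813; 39; 13833];
   [:: 2248; 51; 6075; 29; 3689; 49; 10489; 43; 1938; 26; 1578; 48; 8509];
   [:: 4763; 39; 6649; 29; 4356; 43; 2833; 49; 28623; 26; 2188; 48; 4489];
   [:: 1872; 40; 270; 45; 2477; 29; 1271; 48; 2070; 26; 1816; 43; 64];
   [:: 751; 50; 2472; 40; 1695; 39; 1344; 29; 76; 51; 460; 49; 1396];
   [:: 281; 50; 361; 39; 691; 49; 674; 29; 145; 48; 841; 41; 27];
   [:: 2976; 50; 6590; 39; 11637; 44; 858; 29; 617; 26; 721; 49; 7186];
   [:: 470; 50; 1034; 39; 1270; 49; 169; 29; 129; 51; 795; 48; 57];
   [:: 496; 50; 218; 39; 1127; 44; 430; 29; 67; 26; 59; 49; 1622];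
   [:: 77128; 29; 10925; 50; 3854; 48; 101315; 28; 44445; 26; 23459; 40; 4294];
   [:: 235; 50; 188; 39; 465; 49; 48; 29; 13; 51; 255; 48; 44];
   [:: 11370; 29; 1337; 44; 7359; 49; 2239; 28; 2448; 26; 4288; 50; 503];
   [:: 992; 50; 1190; 39; 845; 44; 386; 29; 153; 26; 57; 49; 554];
   [:: 24128; 44; 20004; 29; 1431; 43; 2248; 49; 41152; 26; 1769; 39; 2417];
   [:: 42202; 49; 14176; 29; 2217; 28; 3861; 43; 12466; 26; 263; 48; 61319];
   [:: 1; 39; 1; 51; 1]];
   [::
   [:: 14010; 29; 2231; 50; 3506; 49; 796; 28; 2805; 26; 1225; 48; 6693];
   [:: 1; 0; 1]; [:: 1; 1; 1];
   [:: 1242111; 5; 3607; 41; 691828; 29; 7442086; 3; 1167735; 34; 9933240; 7; 68605];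
   [:: 211951; 10; 2148; 41; 436915; 29; 36767; 5; 429225; 40; 13296; 34; 1087499];
   [:: 487043; 18; 69293; 7; 93837; 38; 2912335; 6; 258398; 3; 10541; 34; 1368370];
   [:: 59208632; 7; 114761; 13; 767713; 41; 6242046; 49; 3145291; 4; 6604865; 10; 719104];
   [:: 51; 45; 13; 43; 23; 41; 3; 49; 7; 50; 62; 10; 84];
   [:: 9779429; 4; 5053; 22; 141979; 29; 1319145; 7; 1277866; 41; 2244582; 49; 1293706];
   [:: 1; 18; 1];
   [:: 221; 51; 147; 40; 189; 50; 476; 28; 693; 48; 64; 49; 34];
   [:: 3236; 49; 4435; 41; 6005; 43; 1847; 28; 3533; 29; 621; 48; 941];
   [:: 43373; 40; 49122; 44; 22337; 28; 25823; 45; 11115; 26; 16820; 27; 21954];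
   [:: 6039; 26; 540; 44; 27991; 49; 16014; 43; 3854; 45; 4389; 28; 559];
   [:: 73192; 45; 9236; 28; 2607; 13; 21140; 43; 8879; 10; 167; 49; 14334];
   [:: 1; 29; 1]; [:: 868; 45; 79; 49; 202; 22; 407; 34; 39; 43; 79; 41; 89];
   [:: 1; 34; 1];
   [:: 4373; 45; 8358; 40; 1441; 48; 3532; 28; 288; 26; 741; 43; 2429];
   [:: 1; 38; 1];
   [:: 10148; 29; 275; 44; 1800; 28; 410; 45; 5479; 26; 1266; 40; 9126];
   [:: 215; 45; 80; 44; 96; 50; 167; 29; 5; 40; 10; 41; 171]; [:: 1; 41; 1];
   [:: 1; 43; 1]; [:: 1; 45; 1]]].

Lemma thin_check4 :
  thin_check 6 coef_f coef_g4 gens_T4 gens_B4 certs4.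
Proof. by vm_compute. Qed.

Definition gens_T5 : seq (seq Z) :=
  [::
   [:: 0; -10; 7; -30; 7; -10];
   [:: -6252; -40389; 9746; -159706; 32015; -60487];
   [:: -2033; -14384; 5867; -54348; 11590; -19881];
   [:: -1956; -12364; 2411; -49363; 9723; -18868];
   [:: -763; -6506; 3996; -21841; 5180; -7540];
   [:: -692; -4724; 1660; -18201; 3781; -6737];
   [:: -62; -483; 249; -1701; 372; -609]; [:: -23; -139; 15; -568; 106; -219];
   [:: -16; -150; 95; -475; 118; -157]; [:: -11; -78; 35; -298; 66; -110];
   [:: -10; -83; 33; -263; 53; -90]; [:: -1; -16; 5; -64; 15; -28];
   [:: -1; -14; 1; -53; 7; -25]; [:: -1; -16; 0; -53; 2; -18];
   [:: -2; -19; 8; -53; 12; -19]; [:: -2; -11; -2; -46; 8; -19];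
   [:: -1; -19; -6; -37; -11; -9]; [:: -1; -14; 2; -31; 3; -8];
   [:: -1; -13; 6; -31; 6; -9]; [:: -1; -9; 6; -31; 8; -10];
   [:: -1; -13; 5; -26; 4; -6]; [:: -1; -10; -1; -26; 1; -7];
   [:: -1; -5; -3; -20; 2; -9]].

Definition gens_B5 : seq (seq Z) :=
  [::
   [:: -15381; -67776; -87569; -235841; -25862; -121286];
   [:: -6252; -27041; -38267; -90374; -15998; -47139];
   [:: -4540; -20116; -25276; -70771; -6517; -36219];
   [:: -3454; -14579; -23144; -45824; -13421; -23916];
   [:: -1956; -8516; -11679; -28877; -4367; -15020];
   [:: -1329; -5667; -8590; -18201; -4518; -9531];
   [:: -1414; -5397; -10247; -12125; -8372; -4043];
   [:: -259; -1065; -2015; -2940; -1613; -1414];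
   [:: -94; -393; -658; -1181; -471; -583];
   [:: -47; -211; -249; -760; -38; -387];
   [:: -70; -265; -496; -578; -401; -179];
   [:: -43; -182; -294; -563; -181; -285];
   [:: -34; -147; -206; -494; -84; -259];
   [:: -37; -154; -255; -475; -160; -244];
   [:: -34; -110; -182; -183; -105; -32];
   [:: -26; -90; -157; -167; -104; -34]; [:: -29; -95; -159; -162; -95; -29];
   [:: -15; -64; -122; -159; -101; -70]; [:: -32; -94; -146; -138; -73; -23];
   [:: -21; -73; -128; -137; -87; -29]; [:: -29; -87; -137; -131; -70; -21];
   [:: -13; -54; -98; -132; -82; -56]; [:: -14; -51; -93; -104; -70; -26];
   [:: -11; -40; -73; -81; -55; -21]; [:: -13; -44; -76; -77; -46; -14];
   [:: -14; -43; -68; -64; -35; -10]; [:: -5; -21; -34; -66; -19; -34];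
   [:: -8; -28; -53; -58; -38; -13]; [:: -3; -14; -13; -54; 2; -26];
   [:: -4; -19; -26; -53; -18; -17]; [:: -4; -16; -31; -44; -22; -20];
   [:: -5; -19; -36; -42; -30; -14]; [:: -10; -26; -37; -32; -16; -5];
   [:: -4; -15; -29; -33; -23; -11]; [:: -4; -11; -22; -26; -19; -8];
   [:: -1; -5; -3; -20; 2; -9]; [:: -5; -10; -14; -13; -8; -4];
   [:: -1; -4; -8; -10; -6; -5]; [:: -1; -3; -7; -9; -5; -4]].

Definition certs5 : seq (seq (seq Z)) :=
  [:: [::
   [:: 1; 0; 1]; [:: 1; 1; 1; 0; 6252]; [:: 1; 2; 1; 0; 2033];
   [:: 1; 3; 1; 0; 1956]; [:: 1; 4; 1; 0; 763]; [:: 1; 5; 1; 0; 692];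
   [:: 1; 6; 1; 0; 62]; [:: 1; 7; 1; 0; 23]; [:: 1; 8; 1; 0; 16];
   [:: 1; 9; 1; 0; 11]; [:: 1; 10; 1; 0; 10]; [:: 1; 11; 1; 0; 1];
   [:: 1; 12; 1; 0; 1]; [:: 1; 13; 1; 0; 1]; [:: 1; 14; 1; 0; 2];
   [:: 1; 15; 1; 0; 2]; [:: 1; 16; 1; 0; 1]; [:: 1; 17; 1; 0; 1];
   [:: 1; 18; 1; 0; 1]; [:: 1; 19; 1; 0; 1]; [:: 1; 20; 1; 0; 1];
   [:: 1; 21; 1; 0; 1]; [:: 1; 22; 1; 0; 1]];
   [::
   [:: 11137; 16; 18071770; 11; 21211166; 0; 33574068; 12; 51235372; 22; 44321482; 17; 36458407];
   [:: 11137; 16; 8639450; 11; 2698975; 0; 15548093; 12; 25057930; 22; 20159401; 17; 13072768];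
   [:: 11137; 16; 5079819; 11; 7301984; 0; 9929804; 12; 14177645; 22; 13057459; 17; 10945073];
   [:: 12934135; 16; 9123564831; 12; 15371156632; 0; 11747362398; 4; 739179; 22; 16315013047; 20; 3300774203];
   [:: 1591; 16; 361621; 11; 234724; 0; 613834; 12; 1065506; 22; 812769; 17; 637376];
   [:: 2909; 16; 660493; 12; 1398263; 0; 1013808; 20; 232667; 22; 1354091; 17; 220547];
   [:: 3766402; 4; 783529; 21; 504685056; 22; 2274465048; 13; 499451221; 0; 1654024982; 16; 1449258476];
   [:: 29061752; 4; 1360341; 16; 2261860348; 22; 1302271526; 13; 669851399; 0; 559501402; 12; 2255070312];
   [:: 14530876; 4; 282755; 16; 359283220; 0; 207625722; 13; 69798045; 22; 287162182; 12; 433916832];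
   [:: 11137; 16; 46104; 17; 132528; 0; 68147; 11; 119628; 22; 99455; 12; 125724];
   [:: 1883201; 4; 17859; 21; 24997746; 22; 49961876; 13; 10592046; 0; 41156502; 16; 32645985];
   [:: 25868270; 16; 259697364; 12; 330165693; 0; 323120417; 4; 78861; 22; 434922893; 20; 27378717];
   [:: 11137; 16; 43527; 11; 11430; 0; 83882; 12; 142620; 22; 106312; 17; 74769];
   [:: 25868270; 16; 224679772; 12; 305198299; 0; 242496881; 4; 77503; 22; 337674049; 20; 30439081];
   [:: 8001; 20; 9643; 17; 82737; 0; 84071; 21; 100489; 22; 73783; 16; 5382];
   [:: 2667; 20; 1171; 17; 8661; 0; 24224; 21; 35023; 22; 18625; 16; 5862];
   [:: 8001; 20; 8387; 17; 59445; 0; 73831; 21; 94823; 22; 61823; 16; 7551];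
   [:: 29061752; 0; 75333782; 12; 85312944; 16; 143478612; 13; 35913789; 22; 138705690; 4; 42615];
   [:: 27; 20; 112; 17; 342; 0; 230; 15; 69; 22; 169; 21; 103];
   [:: 2667; 20; 2372; 17; 3660; 0; 20137; 21; 28622; 22; 15758; 16; 5595];
   [:: 63; 20; 166; 17; 747; 0; 488; 15; 135; 22; 334; 21; 310];
   [:: 14530876; 4; 37549; 16; 60666448; 22; 54676914; 13; 12866291; 0; 34889378; 12; 32041848];
   [:: 7532804; 4; 7725; 21; 47680364; 0; 36635094; 13; 2791447; 22; 30863082; 16; 18230188];
   [:: 3766402; 4; 3453; 21; 17426318; 0; 14953806; 13; 390619; 22; 13296724; 16; 7682122];
   [:: 237; 17; 824; 11; 251; 0; 563; 21; 1588; 22; 269; 16; 149];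
   [:: 189; 20; 116; 17; 1278; 0; 676; 15; 192; 22; 473; 21; 395];
   [:: 14545; 16; 13892; 17; 5654; 0; 20570; 12; 23172; 22; 28826; 20; 1181];
   [:: 15065608; 4; 1625; 21; 70170392; 0; 40251050; 13; 5901603; 22; 28798110; 16; 14414884];
   [:: 11137; 22; 15693; 16; 2025; 0; 13799; 11; 7698; 17; 5247; 12; 2748];
   [:: 15065608; 4; 51; 21; 18899600; 0; 21196222; 13; 15797825; 22; 17870010; 16; 7656084];
   [:: 18080; 16; 19695; 12; 9308; 22; 38939; 11; 237; 0; 24322; 13; 4141];
   [:: 15065608; 4; 13857; 21; 4849864; 22; 31733638; 13; 6639611; 0; 22686402; 16; 21532036];
   [:: 3248; 19; 3989; 11; 3565; 0; 1530; 17; 11721; 22; 4344; 20; 8861];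
   [:: 15065608; 4; 6351; 21; 8638496; 22; 27535490; 13; 3447541; 0; 20795902; 16; 15795092];
   [:: 3766402; 4; 8881; 16; 3447992; 0; 2341186; 21; 249178; 22; 2780412; 13; 1811823];
   [:: 1; 22; 1; 0; 1];
   [:: 12934135; 4; 26018; 12; 6798699; 0; 7509016; 20; 28324081; 22; 8281219; 16; 1414942];
   [:: 14545; 16; 4141; 12; 4051; 22; 4993; 20; 418; 0; 2465; 17; 942];
   [:: 29061752; 4; 6349; 16; 6087300; 0; 6044802; 13; 4110815; 22; 11294942; 12; 2724408]];
   [::
   [:: 72; 20; 72; 22; 6033; 15; 153654; 7; 24899; 10; 1628; 9; 18642];
   [:: 1; 1; 1];
   [:: 144; 9; 8880; 22; 13905; 20; 144; 7; 13945; 10; 628; 15; 107508];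
   [:: 352287546; 6; 71467333; 9; 131567220; 5; 25869316; 2; 586341109; 19; 981914383; 16; 8014166];
   [:: 1; 3; 1];
   [:: 1806748; 21; 277241; 9; 672359; 7; 61816; 5; 3456148; 19; 236953; 16; 181765];
   [:: 2923; 16; 202817; 20; 535695; 0; 409080; 19; 1498713; 14; 907751; 22; 80395];
   [:: 472949169; 6; 21036101; 12; 24814501; 0; 59367690; 4; 156936571; 8; 84342040; 16; 72705695];
   [:: 217575; 20; 15244; 22; 49620; 6; 326335; 14; 19614; 19; 113780; 12; 1408];
   [:: 1; 7; 1; 15; 12];
   [:: 20461; 16; 57414; 20; 311961; 0; 199204; 19; 442173; 14; 240855; 22; 139012];
   [:: 1; 10; 1; 9; 3]; [:: 1; 9; 1; 7; 1];
   [:: 835100; 6; 247721; 7; 273571; 13; 11619; 9; 589550; 19; 2709152; 12; 42044];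
   [:: 21; 20; 75; 17; 243; 0; 208; 15; 2; 22; 215; 21; 177];
   [:: 567; 20; 4451; 17; 3303; 0; 4045; 15; 1380; 22; 2981; 21; 1247];
   [:: 189; 20; 821; 17; 1710; 0; 1591; 15; 75; 22; 1619; 21; 1181];
   [:: 19315; 8; 12369; 20; 10350; 0; 1185; 19; 6629; 14; 2323; 4; 92];
   [:: 5451; 17; 49382; 11; 3056; 0; 49865; 21; 73783; 22; 41147; 16; 7064];
   [:: 81; 20; 622; 17; 207; 0; 494; 15; 141; 22; 382; 21; 208];
   [:: 5451; 17; 53968; 11; 2500; 0; 43825; 21; 57812; 22; 38962; 16; 4837];
   [:: 9501761; 4; 117110; 16; 1487793; 0; 3667009; 19; 14026518; 20; 17023721; 12; 1629931];
   [:: 17937; 16; 837; 19; 37593; 0; 66580; 21; 3290; 22; 90728; 20; 118670];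
   [:: 17937; 16; 1512; 19; 34929; 0; 50840; 21; 4786; 22; 67846; 20; 88234];
   [:: 1977; 20; 4895; 11; 2466; 0; 2631; 17; 9453; 15; 2053; 21; 4781];
   [:: 5451; 17; 27749; 11; 2750; 0; 18227; 21; 29797; 22; 14513; 16; 1505];
   [:: 2713139; 6; 12034; 14; 463285; 7; 203506; 9; 485127; 19; 1869255; 11; 6727];
   [:: 812; 19; 607; 11; 515; 0; 918; 17; 699; 22; 1632; 20; 3043];
   [:: 1; 22; 1; 15; 1];
   [:: 3727; 19; 448; 14; 4729; 11; 342; 20; 2786; 15; 410; 22; 1054];
   [:: 974934; 6; 854; 16; 17161; 12; 65457; 19; 2131599; 14; 677271; 22; 278029];
   [:: 9501761; 4; 6681; 20; 18276463; 0; 528142; 16; 248527; 19; 18674478; 12; 5211734];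
   [:: 5451; 21; 35813; 17; 3310; 0; 13660; 11; 3640; 22; 6187; 16; 5560];
   [:: 20461; 16; 2450; 20; 18104; 0; 11673; 19; 28664; 14; 11223; 22; 10180];
   [:: 1638261; 18; 598283; 12; 801193; 0; 262132; 20; 1181174; 4; 4231; 16; 744141];
   [:: 1; 22; 1];
   [:: 3766402; 4; 5483; 21; 4829504; 0; 3525608; 13; 3023211; 22; 3437994; 16; 3357772];
   [:: 266157; 6; 862; 22; 11497; 12; 6332; 16; 553; 20; 18362; 19; 175969];
   [:: 974934; 6; 1388; 16; 47299; 14; 197751; 12; 82413; 19; 362721; 22; 943]];
   [::
   [:: 190; 37; 1652872; 24; 38671; 33; 1158354; 34; 838026; 36; 62241; 17; 839468];
   [:: 8379; 34; 12781189; 24; 236542; 37; 42506793; 27; 1707077; 31; 23852619; 17; 11023425];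
   [:: 1197; 37; 3874185; 24; 113209; 33; 1730862; 34; 1664262; 36; 87406; 17; 1599381];
   [:: 18018; 34; 2995602; 24; 165607; 36; 1116589; 38; 24964884; 31; 48341412; 17; 9635220];
   [:: 753; 37; 471357; 36; 39192; 33; 726214; 34; 368568; 31; 78082; 17; 391547];
   [:: 2769; 34; 229397; 36; 97376; 37; 366522; 38; 1500339; 31; 2667537; 17; 652155];
   [:: 1062; 24; 16872; 23; 17349; 22; 257346; 33; 40003; 17; 7652; 31; 1171];
   [:: 1; 6; 1];
   [:: 6723; 34; 6121; 31; 488871; 38; 217758; 27; 40477; 29; 12804; 17; 57192];
   [:: 5586; 36; 319; 24; 9679; 37; 331506; 34; 91026; 31; 35910; 17; 77280];
   [:: 2193; 24; 5089; 37; 231; 22; 22560; 29; 567; 31; 1551; 27; 37];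
   [:: 3003; 34; 11129; 24; 2480; 38; 37611; 27; 2281; 31; 85617; 17; 19677];
   [:: 753; 34; 6460; 36; 418; 37; 8583; 33; 10711; 31; 3967; 17; 6389];
   [:: 9009; 34; 22328; 24; 4022; 38; 106848; 27; 2980; 31; 250425; 17; 44919];
   [:: 1; 18; 1]; [:: 1; 14; 1]; [:: 1; 20; 1]; [:: 1; 10; 1];
   [:: 21; 36; 22; 37; 21; 32; 30; 24; 4]; [:: 1; 16; 1];
   [:: 1; 32; 2; 38; 1];
   [:: 75277; 22; 18208; 10; 22209; 27; 70134; 29; 23117; 31; 347381; 17; 1035];
   [:: 1; 15; 1]; [:: 1; 19; 1]; [:: 1; 25; 1]; [:: 1; 32; 1];
   [:: 2769; 36; 407; 37; 2535; 34; 203; 38; 5349; 31; 10995; 17; 1896];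
   [:: 1; 24; 1];
   [:: 342; 36; 119; 17; 414; 34; 18; 37; 378; 24; 47; 38; 1026];
   [:: 28017; 38; 20391; 30; 17955; 27; 3013; 29; 4629; 24; 16096; 17; 8814];
   [:: 1706; 38; 141; 24; 160; 37; 2029; 27; 395; 31; 4691; 17; 217];
   [:: 1; 22; 1]; [:: 1; 36; 1]; [:: 1; 23; 1]; [:: 1; 27; 1];
   [:: 7570; 32; 648; 35; 813; 24; 42; 38; 10515; 17; 2885; 37; 6501];
   [:: 1; 34; 1]; [:: 1; 31; 1]; [:: 1; 33; 1]];
   [::
   [:: 7570; 32; 648; 35; 8383; 24; 42; 38; 10515; 17; 2885; 37; 6501];
   [:: 15140; 32; 1759144; 35; 51975899; 24; 5426196; 38; 169472975; 17; 22719845; 37; 265394643];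
   [:: 45420; 32; 1266888; 35; 62041813; 24; 5380272; 38; 182374765; 17; 22193175; 37; 243068401];
   [:: 757; 32; 30906; 35; 768082; 24; 82876; 38; 2586222; 17; 358285; 37; 4168049];
   [:: 45420; 32; 1293624; 35; 30994619; 24; 908976; 38; 78636995; 17; 9592365; 37; 64196783];
   [:: 22710; 32; 198888; 35; 9857543; 24; 959982; 38; 30016715; 17; 3727035; 37; 42748841];
   [:: 45420; 32; 74144; 35; 2171549; 24; 118636; 38; 6139745; 17; 784815; 37; 5293553];
   [:: 7570; 32; 2832; 35; 82197; 24; 11118; 38; 288615; 17; 40225; 37; 510789];
   [:: 11355; 32; 10828; 35; 182298; 24; 842; 38; 399510; 17; 48465; 37; 354726];
   [:: 7570; 32; 1206; 35; 56711; 24; 4494; 38; 171285; 17; 21035; 37; 218697];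
   [:: 15140; 32; 9408; 35; 117363; 24; 2292; 38; 283455; 17; 41185; 37; 220131];
   [:: 20148; 32; 1528; 35; 22999; 37; 75823; 38; 71407; 17; 23733; 36; 4528];
   [:: 102627; 34; 61202; 35; 81396; 25; 9362; 27; 297; 17; 123732; 38; 250047];
   [:: 133977; 38; 130337; 25; 10041; 37; 150545; 27; 77400; 17; 70167; 9; 6775];
   [:: 14335; 36; 3189; 35; 12223; 38; 29476; 34; 6338; 17; 10673; 12; 861];
   [:: 3785; 32; 413; 35; 2288; 24; 202; 38; 11100; 17; 2160; 37; 19371];
   [:: 96138; 38; 36834; 34; 19553; 25; 21237; 27; 1994; 17; 714; 29; 106554];
   [:: 666219; 36; 116129; 25; 51070; 12; 5727; 38; 368958; 17; 182319; 35; 735666];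
   [:: 205254; 36; 41850; 35; 263214; 25; 2213; 34; 1241; 17; 69678; 38; 293706];
   [:: 22710; 32; 252; 35; 23657; 24; 1278; 38; 46355; 17; 3435; 37; 86429];
   [:: 68418; 36; 12654; 35; 89082; 25; 619; 34; 8035; 17; 12348; 38; 32130];
   [:: 390981; 12; 14695; 25; 33502; 24; 28669; 38; 266838; 17; 68144; 35; 106514];
   [:: 7570; 32; 648; 35; 813; 24; 42; 38; 10515; 17; 2885; 37; 6501]];
   [::
   [:: 7570; 32; 648; 35; 8383; 24; 42; 38; 10515; 17; 2885; 37; 6501];
   [:: 1; 0; 1]; [:: 1; 1; 1]; [:: 1; 2; 1]; [:: 1; 3; 1]; [:: 1; 4; 1];
   [:: 323064891; 8; 155625; 5; 57038412; 9; 974935; 38; 15519530; 37; 40225127; 36; 897];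
   [:: 1; 9; 1];
   [:: 9052618; 38; 4071513; 26; 26406556; 7; 454770; 13; 2281075; 8; 429610; 3; 115765];
   [:: 1; 12; 1]; [:: 1; 11; 1];
   [:: 11403; 36; 342; 25; 1181; 38; 11655; 34; 2306; 17; 4032; 35; 37233];
   [:: 181575; 36; 32878; 32; 10762; 29; 15444; 21; 59106; 17; 19737; 35; 417531];
   [:: 239129; 30; 35310; 12; 21092; 37; 693883; 24; 47590; 17; 18777; 29; 104243];
   [:: 3564225; 8; 401157; 35; 79550; 34; 24249; 38; 23247; 17; 54158; 12; 14281];
   [:: 1; 28; 1];
   [:: 102627; 36; 9281; 24; 11225; 38; 3969; 35; 2016; 34; 11610; 17; 86310];
   [:: 4901895; 29; 711053; 30; 729221; 38; 5644212; 7; 16857; 17; 1484747; 8; 116771];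
   [:: 602772; 36; 23184; 34; 3177; 7; 16815; 35; 117241; 17; 24580; 12; 13391];
   [:: 1; 26; 1];
   [:: 852105; 36; 897; 7; 28929; 38; 16649; 37; 13280; 17; 8362; 12; 485];
   [:: 3551; 24; 12; 35; 1658; 29; 23; 30; 2849; 17; 480; 37; 804];
   [:: 1; 35; 1]]].

Lemma thin_check5 :
  thin_check 6 coef_f coef_g5 gens_T5 gens_B5 certs5.
Proof. by vm_compute. Qed.

Definition gens_T6 : seq (seq Z) :=
  [::
   [:: 0; -9; 10; -26; 10; -9];
   [:: -4400; -24068; 20143; -94870; 35768; -38175];
   [:: -3314; -16591; 11343; -67764; 25210; -28424];
   [:: -554; -3373; 3268; -12600; 4823; -4863];
   [:: -213; -1143; 947; -4592; 1732; -1845];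
   [:: -113; -593; 420; -2343; 886; -973];
   [:: -69; -482; 519; -1673; 656; -611]; [:: -25; -124; 84; -508; 185; -212];
   [:: -17; -135; 150; -436; 174; -151]; [:: -13; -77; 76; -298; 117; -117];
   [:: -9; -68; 74; -222; 88; -80]; [:: -10; -56; 46; -222; 85; -86];
   [:: -9; -70; 69; -222; 90; -82]; [:: -9; -62; 54; -198; 71; -72];
   [:: -5; -30; 29; -113; 41; -43]; [:: -3; -34; 32; -81; 26; -23];
   [:: -1; -15; 13; -58; 24; -27]; [:: -1; -19; 5; -41; 2; -16];
   [:: -1; -21; 13; -41; 9; -11]; [:: -1; -12; 8; -41; 15; -19];
   [:: -1; -13; 10; -41; 14; -15]; [:: -2; -9; 4; -38; 14; -17];
   [:: -1; -15; 6; -30; 3; -8]; [:: -1; -9; 9; -30; 10; -9];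
   [:: -1; -9; 10; -30; 10; -13]; [:: -1; -10; 3; -30; 6; -13];
   [:: -1; -8; 7; -30; 8; -11]; [:: -1; -8; 4; -21; 7; -8];
   [:: -1; -4; 0; -16; 5; -8]].

Definition gens_B6 : seq (seq Z) :=
  [::
   [:: -10868; -37004; -29365; -122976; 14130; -74747];
   [:: -3312; -11009; -10363; -34573; 1398; -21627];
   [:: -1527; -5227; -3981; -17640; 2408; -10679];
   [:: -695; -2238; -2576; -6428; -626; -4106];
   [:: -440; -1469; -1377; -4592; 243; -2916];
   [:: -243; -790; -858; -2343; -102; -1493];
   [:: -500; -1300; -1940; -2126; -1479; -811];
   [:: -501; -1175; -1662; -1756; -1143; -554];
   [:: -184; -589; -700; -1673; -187; -1069];
   [:: -328; -843; -1250; -1362; -949; -501];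
   [:: -106; -360; -300; -1195; 136; -715];
   [:: -200; -560; -874; -1021; -689; -500];
   [:: -216; -532; -770; -824; -554; -275];
   [:: -239; -555; -781; -823; -531; -257];
   [:: -205; -518; -758; -822; -562; -289];
   [:: -141; -390; -606; -691; -483; -328];
   [:: -151; -400; -605; -670; -467; -269];
   [:: -162; -414; -611; -664; -460; -239];
   [:: -49; -172; -108; -604; 113; -356];
   [:: -116; -310; -472; -526; -373; -216];
   [:: -97; -267; -408; -463; -326; -205];
   [:: -38; -127; -112; -410; 30; -255];
   [:: -72; -199; -308; -350; -247; -162];
   [:: -35; -114; -130; -326; -31; -204];
   [:: -40; -126; -179; -311; -100; -200];
   [:: -33; -106; -120; -311; -26; -194];
   [:: -53; -150; -236; -288; -184; -151];
   [:: -72; -172; -246; -262; -174; -85];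
   [:: -68; -163; -234; -250; -167; -82];
   [:: -26; -84; -105; -222; -52; -127];
   [:: -38; -108; -170; -207; -132; -116];
   [:: -44; -114; -170; -186; -131; -72];
   [:: -41; -106; -158; -173; -122; -68];
   [:: -35; -97; -150; -172; -117; -80]; [:: -24; -77; -119; -159; -86; -97];
   [:: -17; -52; -82; -113; -54; -72]; [:: -18; -50; -78; -89; -60; -44];
   [:: -17; -47; -73; -83; -55; -41]; [:: -9; -29; -30; -81; -8; -53];
   [:: -18; -40; -56; -59; -38; -19]; [:: -6; -20; -21; -58; 2; -38];
   [:: -19; -39; -56; -58; -38; -19]; [:: -19; -38; -56; -58; -37; -19];
   [:: -18; -39; -56; -57; -38; -19]; [:: -14; -34; -49; -52; -35; -18];
   [:: -15; -34; -51; -52; -35; -18]; [:: -3; -11; -4; -42; 11; -23];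
   [:: -13; -28; -39; -41; -26; -13]; [:: -13; -28; -39; -41; -26; -14];
   [:: -11; -24; -38; -40; -27; -15]; [:: -11; -26; -37; -39; -25; -13];
   [:: -11; -26; -37; -39; -26; -13]; [:: -8; -21; -32; -35; -24; -14];
   [:: -9; -22; -32; -34; -23; -11]; [:: -11; -24; -33; -34; -21; -10];
   [:: -3; -11; -5; -30; 2; -12]; [:: -4; -12; -19; -30; -10; -17];
   [:: -7; -18; -27; -30; -20; -11]; [:: -7; -18; -27; -29; -20; -11];
   [:: -9; -17; -26; -28; -18; -11]; [:: -10; -19; -26; -27; -16; -9];
   [:: -5; -13; -20; -22; -16; -9]; [:: -1; -4; 0; -16; 5; -8];
   [:: -3; -8; -13; -16; -10; -8]; [:: -3; -8; -12; -15; -10; -7];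
   [:: -3; -8; -13; -15; -10; -7]; [:: -2; -5; -8; -9; -6; -5];
   [:: -1; -2; -2; -5; -1; -3]; [:: -1; -3; -3; -5; -2; -3];
   [:: -1; -2; -3; -4; -1; -2]; [:: -1; -2; -3; -3; -2; -1]].

Definition certs6 : seq (seq (seq Z)) :=
  [:: [::
   [:: 1; 0; 1]; [:: 1; 1; 1; 0; 4400]; [:: 1; 2; 1; 0; 3314];
   [:: 1; 3; 1; 0; 554]; [:: 1; 4; 1; 0; 213]; [:: 1; 5; 1; 0; 113];
   [:: 1; 6; 1; 0; 69]; [:: 1; 7; 1; 0; 25]; [:: 1; 8; 1; 0; 17];
   [:: 1; 9; 1; 0; 13]; [:: 1; 10; 1; 0; 9]; [:: 1; 11; 1; 0; 10];
   [:: 1; 12; 1; 0; 9]; [:: 1; 13; 1; 0; 9]; [:: 1; 14; 1; 0; 5];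
   [:: 1; 15; 1; 0; 3]; [:: 1; 16; 1; 0; 1]; [:: 1; 17; 1; 0; 1];
   [:: 1; 18; 1; 0; 1]; [:: 1; 19; 1; 0; 1]; [:: 1; 20; 1; 0; 1];
   [:: 1; 21; 1; 0; 2]; [:: 1; 22; 1; 0; 1]; [:: 1; 23; 1; 0; 1];
   [:: 1; 24; 1; 0; 1]; [:: 1; 25; 1; 0; 1]; [:: 1; 26; 1; 0; 1];
   [:: 1; 27; 1; 0; 1]; [:: 1; 28; 1; 0; 1]];
   [::
   [:: 349; 17; 606549; 27; 366971; 0; 1192594; 19; 1238102; 28; 1446355; 24; 134955];
   [:: 2443; 17; 1626555; 27; 566267; 0; 2113609; 19; 2408621; 28; 3010528; 24; 479245];
   [:: 2443; 17; 546161; 27; 426366; 0; 1179491; 19; 1308661; 28; 1361417; 24; 87856];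
   [:: 20213; 24; 1415673; 17; 3854488; 0; 2490876; 16; 1860648; 28; 6464510; 18; 452716];
   [:: 2443; 17; 207893; 27; 129659; 0; 200122; 19; 403076; 28; 274166; 24; 60126];
   [:: 20213; 24; 471671; 17; 1213243; 0; 422988; 16; 959401; 28; 1937458; 18; 329986];
   [:: 35383; 15; 71046; 22; 7726715; 0; 4339808; 26; 1440364; 28; 7695524; 24; 615759];
   [:: 8355; 24; 215186; 27; 1144874; 0; 797975; 23; 556820; 28; 893966; 22; 1375009];
   [:: 20213; 24; 332202; 17; 1033082; 0; 749015; 16; 439353; 28; 1810428; 18; 104127];
   [:: 35383; 15; 168496; 22; 4878710; 0; 2852614; 26; 982264; 28; 5063025; 24; 176137];
   [:: 239; 17; 3600; 27; 1587; 0; 8905; 22; 795; 28; 11418; 19; 7934];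
   [:: 21461; 24; 85043; 22; 1235020; 0; 886502; 26; 566373; 28; 1790783; 17; 614981];
   [:: 2785; 24; 26896; 27; 79544; 0; 129505; 23; 67410; 28; 197331; 22; 230379];
   [:: 557; 24; 7043; 27; 40313; 0; 24766; 23; 18163; 28; 25370; 22; 42234];
   [:: 34367; 15; 68434; 22; 2926419; 0; 1679861; 23; 571598; 28; 3070839; 24; 271077];
   [:: 21461; 24; 87922; 22; 955402; 0; 621186; 26; 372551; 28; 1245467; 17; 364659];
   [:: 21461; 24; 99493; 22; 1353478; 0; 768492; 26; 316421; 28; 1389911; 17; 81308];
   [:: 4781; 24; 40663; 22; 334959; 0; 181699; 23; 61097; 28; 331977; 26; 5826];
   [:: 2443; 17; 13524; 27; 15648; 0; 45295; 19; 42648; 28; 46999; 24; 888];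
   [:: 21461; 24; 63897; 22; 989026; 0; 556445; 26; 293486; 28; 1028429; 17; 114638];
   [:: 21461; 24; 46215; 22; 736242; 0; 442620; 26; 261205; 28; 852686; 17; 185369];
   [:: 7329; 17; 51142; 27; 22748; 0; 73079; 19; 91030; 28; 97738; 24; 15844];
   [:: 21461; 24; 37835; 22; 505941; 0; 316869; 26; 199258; 28; 629270; 17; 172888];
   [:: 20213; 24; 53356; 17; 193206; 0; 191767; 16; 65936; 28; 381693; 18; 13264];
   [:: 20171; 24; 49489; 17; 274221; 0; 192491; 26; 42495; 28; 412218; 16; 28417];
   [:: 20213; 24; 54134; 17; 181326; 0; 215027; 16; 48915; 28; 381839; 18; 815];
   [:: 21461; 24; 26269; 22; 261341; 0; 228707; 26; 160784; 28; 475791; 17; 213248];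
   [:: 2785; 24; 10516; 27; 41134; 0; 39955; 23; 25070; 28; 52931; 22; 70869];
   [:: 8355; 24; 30991; 27; 104464; 0; 114295; 23; 69640; 28; 158236; 22; 204809];
   [:: 3666; 22; 2984; 17; 24428; 0; 32202; 25; 8119; 28; 48098; 26; 11687];
   [:: 1951; 24; 4284; 22; 14884; 0; 14523; 26; 7733; 28; 31596; 17; 15641];
   [:: 35383; 15; 3210; 22; 683578; 0; 373295; 26; 120306; 28; 665925; 24; 77413];
   [:: 863; 15; 23; 22; 15569; 0; 8424; 26; 2538; 28; 15075; 24; 2132];
   [:: 21461; 24; 13742; 22; 246431; 0; 164567; 26; 89102; 28; 320498; 17; 81362];
   [:: 21461; 24; 975; 22; 32647; 0; 115828; 26; 51602; 28; 255509; 17; 174331];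
   [:: 1951; 24; 1127; 17; 10787; 0; 8459; 22; 1480; 28; 17914; 26; 1859];
   [:: 21461; 24; 13564; 22; 117890; 0; 84959; 26; 36121; 28; 170002; 17; 48721];
   [:: 21461; 24; 15027; 22; 115679; 0; 84343; 26; 26804; 28; 166064; 17; 41263];
   [:: 2443; 27; 1485; 17; 5628; 0; 3203; 24; 3775; 28; 5759; 19; 5340];
   [:: 8355; 24; 12302; 27; 52493; 0; 25205; 23; 20780; 28; 20822; 22; 43993];
   [:: 1047; 17; 1211; 27; 1696; 0; 358; 19; 2993; 28; 335; 24; 47];
   [:: 8355; 24; 17731; 27; 60904; 0; 22705; 23; 24490; 28; 13756; 22; 41864];
   [:: 8355; 24; 16808; 27; 60362; 0; 23030; 23; 26180; 28; 14708; 22; 40687];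
   [:: 8355; 24; 13934; 27; 53741; 0; 24395; 23; 19910; 28; 19709; 22; 43096];
   [:: 8355; 24; 7108; 27; 19852; 0; 24445; 23; 11815; 28; 35023; 22; 43172];
   [:: 8355; 24; 8281; 27; 29104; 0; 24385; 23; 14845; 28; 31351; 22; 41744];
   [:: 141; 28; 204; 27; 15; 0; 189; 22; 53; 16; 38; 19; 113];
   [:: 8355; 24; 9778; 27; 43027; 0; 16915; 23; 16105; 28; 10318; 22; 29387];
   [:: 1671; 24; 2290; 27; 8599; 0; 3430; 23; 2797; 28; 2155; 22; 5882];
   [:: 34367; 15; 9752; 22; 133073; 0; 84504; 23; 33338; 28; 160486; 24; 21884];
   [:: 8355; 24; 4807; 27; 24973; 0; 18430; 23; 10615; 28; 21157; 22; 30353];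
   [:: 8355; 24; 5942; 27; 22073; 0; 17795; 23; 10655; 28; 21842; 22; 31393];
   [:: 21461; 24; 5100; 22; 73369; 0; 42931; 26; 14037; 28; 76913; 17; 2269];
   [:: 8355; 24; 2912; 27; 10418; 0; 15920; 23; 9260; 28; 24062; 22; 28543];
   [:: 8355; 24; 5893; 27; 42022; 0; 14635; 23; 14275; 28; 6133; 22; 23582];
   [:: 1499; 23; 425; 27; 184; 0; 1944; 20; 652; 28; 2077; 22; 1159];
   [:: 422; 22; 436; 23; 27; 0; 98; 25; 994; 28; 74; 16; 157];
   [:: 4781; 24; 896; 22; 14472; 0; 8281; 23; 1580; 28; 14696; 26; 1823];
   [:: 35383; 15; 3265; 22; 104251; 0; 63173; 26; 16549; 28; 112695; 24; 4391];
   [:: 34367; 15; 22546; 22; 78456; 0; 65089; 23; 15460; 28; 126024; 24; 21725];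
   [:: 32062; 15; 4657; 27; 161769; 0; 41578; 23; 45328; 24; 38861; 22; 60691];
   [:: 21461; 24; 4525; 22; 43110; 0; 23047; 26; 12770; 28; 42888; 17; 4012];
   [:: 1; 28; 1; 0; 1];
   [:: 21461; 24; 520; 22; 15981; 0; 13130; 26; 11783; 28; 26105; 17; 9994];
   [:: 21461; 24; 4073; 22; 19809; 0; 11634; 26; 10617; 28; 22673; 17; 7211];
   [:: 611; 26; 286; 22; 570; 0; 386; 25; 50; 28; 736; 17; 191];
   [:: 21461; 24; 6308; 22; 12764; 0; 9050; 26; 799; 28; 18696; 17; 4355];
   [:: 19457; 27; 584; 17; 2370; 0; 4322; 15; 1715; 28; 7021; 24; 4337];
   [:: 7661; 18; 208; 19; 69; 0; 981; 27; 4239; 24; 1576; 17; 1569];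
   [:: 8355; 23; 445; 24; 721; 0; 2335; 27; 3664; 28; 1981; 22; 1544];
   [:: 2785; 24; 298; 27; 1047; 0; 405; 23; 435; 28; 278; 22; 727]];
   [::
   [:: 41452; 1; 32316; 13; 208824; 9; 3183697; 2; 4568; 21; 47384691; 7; 6205389];
   [:: 16944746; 1; 11528918; 13; 23860993; 4; 4789896; 3; 417288; 7; 87850495; 9; 133178680];
   [:: 87906; 2; 37956; 7; 94993; 9; 47545; 13; 5592; 21; 1424159; 4; 11994];
   [:: 10172; 3; 9108; 28; 1021; 10; 4782; 13; 30073; 9; 100774; 14; 79786];
   [:: 204807; 11; 183350; 14; 130726; 9; 149526; 26; 35577; 7; 140885; 4; 385570];
   [:: 1612725; 3; 220312; 7; 299683; 13; 2562220; 14; 3119371; 4; 528934; 9; 8540575];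
   [:: 32062; 24; 1238861; 15; 1248755; 0; 1669072; 23; 2476202; 27; 7584321; 22; 985351];
   [:: 16031; 15; 144502; 27; 4143314; 0; 1019345; 23; 1342716; 24; 583476; 22; 1528519];
   [:: 638266; 8; 305851; 13; 1731988; 14; 2741238; 11; 158043; 15; 325400; 9; 6183905];
   [:: 16031; 15; 383135; 27; 2522597; 0; 570527; 23; 780791; 24; 397228; 22; 408147];
   [:: 20278; 5; 16086; 21; 92243; 13; 3354; 11; 4695; 10; 2683; 9; 3537];
   [:: 74968; 12; 404893; 27; 3693822; 0; 698361; 23; 2307029; 24; 1337628; 15; 1337028];
   [:: 32062; 15; 317559; 27; 3531713; 0; 849044; 23; 1048872; 24; 454375; 22; 937755];
   [:: 1886; 15; 5463; 27; 233095; 0; 57552; 23; 77216; 24; 33313; 22; 90741];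
   [:: 16031; 15; 200657; 27; 1626391; 0; 378410; 23; 487949; 24; 229676; 22; 340368];
   [:: 37484; 12; 93353; 27; 1578546; 0; 300365; 23; 882873; 24; 499452; 15; 494732];
   [:: 1394; 24; 17361; 15; 18687; 0; 20314; 23; 33432; 27; 96997; 22; 6643];
   [:: 16031; 15; 179478; 27; 1264912; 0; 290345; 23; 380372; 24; 187451; 22; 225853];
   [:: 1; 7; 1; 21; 12];
   [:: 16031; 24; 172123; 15; 181320; 0; 166422; 23; 291681; 27; 823134; 22; 28698];
   [:: 18742; 12; 15385; 15; 182728; 0; 130475; 23; 293155; 27; 672324; 24; 165846];
   [:: 1; 7; 1; 9; 1];
   [:: 74968; 12; 83277; 15; 525804; 0; 332129; 23; 862645; 27; 1705470; 24; 502676];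
   [:: 1; 13; 1; 9; 2];
   [:: 4118; 24; 90; 9; 453; 8; 671; 14; 2267; 10; 1702; 6; 1749];
   [:: 8978; 13; 976; 10; 6723; 11; 613; 14; 9394; 28; 26099; 9; 11368];
   [:: 37484; 12; 80305; 15; 155888; 0; 43501; 23; 299597; 27; 299498; 24; 197148];
   [:: 32062; 15; 70107; 27; 1173745; 0; 285052; 23; 366696; 24; 171427; 22; 386275];
   [:: 32062; 15; 73177; 27; 1100063; 0; 265542; 23; 341782; 24; 167255; 22; 351585];
   [:: 12850; 15; 1098; 27; 6180; 24; 3591; 8; 1921; 10; 26416; 28; 50634];
   [:: 100057; 28; 182065; 24; 351331; 15; 249882; 23; 681504; 18; 91287; 12; 194037];
   [:: 16031; 15; 54117; 27; 324225; 0; 70540; 23; 113439; 24; 59948; 22; 45401];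
   [:: 16031; 15; 49210; 27; 297383; 0; 63866; 23; 110139; 24; 58815; 22; 43304];
   [:: 18742; 12; 10811; 15; 60550; 0; 42189; 23; 106515; 27; 216080; 24; 54426];
   [:: 55888; 28; 36181; 15; 24686; 8; 69382; 13; 639; 23; 4202; 9; 3202];
   [:: 13678; 15; 4668; 23; 13934; 24; 4095; 8; 7195; 12; 3004; 9; 3934];
   [:: 74968; 12; 27409; 27; 396230; 0; 73709; 23; 257169; 24; 113332; 15; 112004];
   [:: 74968; 12; 20217; 27; 420726; 0; 76501; 23; 266361; 24; 103580; 15; 100612];
   [:: 59089; 24; 1956; 15; 1247; 28; 1700; 26; 21963; 9; 7257; 14; 81620];
   [:: 1671; 24; 2846; 27; 14201; 0; 3752; 23; 5474; 28; 584; 22; 6973];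
   [:: 2525; 26; 52; 21; 492; 23; 415; 16; 19; 11; 1251; 9; 90];
   [:: 8355; 24; 17159; 27; 59156; 0; 21965; 23; 25655; 28; 14699; 22; 42076];
   [:: 8355; 24; 17164; 27; 58996; 0; 23140; 23; 23410; 28; 16984; 22; 42191];
   [:: 15; 24; 26; 27; 119; 0; 35; 23; 50; 28; 11; 22; 64];
   [:: 32062; 15; 15859; 27; 222745; 0; 52998; 23; 77906; 24; 33267; 22; 67373];
   [:: 16031; 15; 3641; 27; 121967; 0; 29915; 23; 42482; 24; 21746; 22; 43347];
   [:: 1; 28; 1; 21; 1];
   [:: 8355; 24; 9698; 27; 45587; 0; 14825; 23; 18605; 28; 7178; 22; 27547];
   [:: 1671; 24; 1982; 27; 8429; 0; 2903; 23; 4067; 28; 1763; 22; 5482];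
   [:: 16031; 15; 3691; 27; 85363; 0; 19728; 23; 27664; 24; 23819; 22; 28422];
   [:: 16031; 15; 2927; 27; 91282; 0; 22129; 23; 32214; 24; 12022; 22; 32042];
   [:: 697; 15; 167; 27; 3816; 0; 923; 23; 1361; 24; 609; 22; 1380];
   [:: 16031; 24; 9320; 15; 10510; 0; 13259; 23; 20920; 27; 61637; 22; 4841];
   [:: 16031; 15; 6619; 27; 74597; 0; 18248; 23; 20466; 24; 9271; 22; 20088];
   [:: 8355; 24; 5321; 27; 40274; 0; 13895; 23; 15440; 28; 7076; 22; 23794];
   [:: 70; 15; 5; 27; 107; 24; 13; 23; 10; 28; 48; 22; 17];
   [:: 107708; 24; 3033; 27; 32196; 12; 32357; 8; 5413; 21; 6057; 16; 255];
   [:: 32062; 24; 15943; 15; 16895; 0; 25318; 23; 29938; 27; 113245; 22; 14623];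
   [:: 16031; 24; 7522; 15; 7760; 0; 12459; 23; 18329; 27; 54951; 22; 8135];
   [:: 34367; 15; 20798; 22; 79568; 0; 60317; 23; 22453; 28; 123195; 24; 21693];
   [:: 8355; 24; 6142; 27; 15673; 0; 14665; 23; 12760; 28; 21337; 22; 27638];
   [:: 1886; 15; 863; 27; 4061; 0; 834; 23; 1454; 24; 1021; 22; 305];
   [:: 1; 28; 1];
   [:: 9371; 12; 830; 27; 6888; 0; 1085; 23; 3411; 24; 3648; 15; 2232];
   [:: 74968; 12; 607; 27; 75986; 0; 8979; 23; 39335; 24; 39068; 15; 21684];
   [:: 18742; 12; 1173; 27; 18270; 0; 3735; 23; 6819; 24; 5562; 15; 5006];
   [:: 32062; 15; 3029; 27; 22381; 0; 2630; 23; 19940; 24; 11121; 22; 1595];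
   [:: 35383; 15; 967; 24; 4725; 0; 1620; 22; 6612; 28; 9969; 26; 11176];
   [:: 34367; 15; 979; 23; 16393; 0; 392; 24; 3085; 28; 7463; 22; 4489];
   [:: 8355; 24; 149; 27; 1916; 0; 1595; 23; 1610; 28; 2924; 22; 1756];
   [:: 2785; 24; 298; 27; 1047; 0; 405; 23; 435; 28; 278; 22; 727]];
   [::
   [:: 292; 66; 2906313; 34; 341491; 35; 18571; 65; 510824; 30; 76125; 63; 1025595];
   [:: 683; 66; 1076448; 22; 11710; 65; 585756; 63; 450035; 30; 126222; 34; 161309];
   [:: 292; 66; 307371; 34; 29173; 65; 80468; 63; 73965; 30; 25351; 35; 22161];
   [:: 3415; 66; 221209; 22; 48612; 65; 808217; 63; 211483; 30; 127092; 34; 91288];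
   [:: 683; 66; 93439; 22; 288; 65; 64507; 63; 52659; 30; 27554; 34; 16061];
   [:: 3415; 66; 140876; 22; 10788; 65; 286873; 63; 62082; 30; 56063; 34; 35952];
   [:: 48; 54; 348; 68; 433; 50; 75; 53; 2008; 13; 27; 51; 847];
   [:: 1572; 47; 7289; 68; 2058; 60; 28065; 54; 44060; 64; 2660; 55; 261];
   [:: 3415; 66; 56852; 22; 13056; 65; 241721; 63; 4904; 30; 35196; 34; 21649];
   [:: 1; 7; 1];
   [:: 73; 66; 9124; 34; 955; 65; 1958; 63; 1278; 30; 28; 35; 15];
   [:: 1; 6; 1]; [:: 62; 47; 77; 68; 140; 54; 1097; 28; 43; 43; 21; 60; 54];
   [:: 1572; 60; 16809; 68; 1302; 54; 17908; 47; 2617; 64; 1084; 55; 117];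
   [:: 1535; 54; 22665; 55; 90; 68; 4124; 53; 11394; 27; 1183; 47; 168];
   [:: 1; 9; 1]; [:: 99; 51; 143; 50; 132; 53; 1568; 68; 314; 44; 621; 17; 3];
   [:: 1; 13; 1];
   [:: 146; 63; 2509; 34; 689; 66; 7757; 30; 125; 35; 445; 65; 28];
   [:: 1; 12; 1]; [:: 1; 14; 1];
   [:: 3415; 66; 75651; 22; 43; 65; 35673; 63; 29142; 30; 6993; 34; 10677];
   [:: 1; 17; 1];
   [:: 3415; 66; 41487; 65; 26816; 30; 2361; 63; 18304; 22; 3116; 34; 6844];
   [:: 1; 11; 1];
   [:: 3415; 66; 41576; 65; 46288; 30; 2048; 63; 7682; 22; 2363; 34; 7062];
   [:: 1; 16; 1];
   [:: 384; 55; 31; 60; 486; 54; 1971; 53; 295; 68; 26; 41; 175];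
   [:: 57; 55; 6; 60; 34; 54; 289; 53; 49; 41; 28; 70; 164];
   [:: 247755; 37; 803853; 17; 20189; 56; 244805; 63; 1544121; 20; 47191; 34; 180819];
   [:: 1; 19; 1]; [:: 1; 27; 1]; [:: 1; 28; 1];
   [:: 241; 32; 88; 51; 65; 58; 436; 17; 71; 68; 131; 37; 16]; [:: 1; 20; 1];
   [:: 1; 22; 1]; [:: 1; 31; 1]; [:: 1; 32; 1]; [:: 1; 26; 1];
   [:: 114; 41; 47; 60; 53; 54; 23; 53; 11; 70; 373; 55; 6]; [:: 1; 30; 1];
   [:: 1; 42; 1]; [:: 1; 69; 1; 70; 18]; [:: 1; 41; 1]; [:: 1; 39; 1];
   [:: 1; 43; 1];
   [:: 1807; 67; 13; 34; 478; 66; 8374; 56; 669; 63; 43; 35; 619];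
   [:: 23; 41; 4; 42; 2; 55; 1; 70; 92; 60; 9];
   [:: 677; 59; 158; 19; 4; 67; 175; 64; 72; 41; 379]; [:: 1; 45; 1];
   [:: 1; 48; 1]; [:: 1; 47; 1]; [:: 1; 44; 1]; [:: 1; 54; 1]; [:: 1; 60; 1];
   [:: 2352; 70; 231; 50; 181; 69; 9144; 62; 311; 34; 655; 68; 827];
   [:: 1; 37; 1]; [:: 1; 50; 1]; [:: 1; 51; 1]; [:: 1; 49; 1]; [:: 1; 59; 1];
   [:: 1; 53; 1];
   [:: 5418; 59; 402; 35; 1512; 56; 35; 49; 295; 34; 358; 69; 2045];
   [:: 1; 52; 1]; [:: 1; 57; 1]; [:: 1; 58; 1]; [:: 1; 61; 1]; [:: 1; 63; 1];
   [:: 1; 64; 1]; [:: 1; 66; 1]; [:: 1; 70; 1]];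
   [::
   [:: 2509; 56; 665; 62; 1825; 40; 109; 67; 1883; 34; 531; 69; 2815];
   [:: 7129; 67; 13936162; 40; 2225145; 56; 14801880; 35; 5986180; 34; 1931795; 69; 37526883];
   [:: 21387; 69; 95904575; 40; 3367331; 56; 21872729; 67; 18485505; 34; 3924954; 35; 17154130];
   [:: 7129; 67; 2962991; 40; 376949; 69; 3710780; 56; 2607588; 34; 298269; 35; 479062];
   [:: 21387; 67; 1506171; 40; 339448; 56; 1972984; 35; 970268; 34; 235560; 69; 5876224];
   [:: 21387; 67; 964059; 40; 134893; 56; 770548; 35; 567599; 34; 138438; 69; 2982247];
   [:: 7129; 67; 577174; 40; 66622; 69; 290352; 56; 415339; 34; 44152; 35; 21621];
   [:: 7129; 69; 252387; 40; 8721; 56; 58213; 67; 37547; 34; 10923; 35; 39652];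
   [:: 7527; 67; 194304; 62; 3755; 69; 43152; 56; 116851; 34; 12304; 40; 22111];
   [:: 7129; 67; 62270; 40; 8005; 69; 89027; 56; 58058; 34; 5276; 35; 16230];
   [:: 2509; 67; 34769; 62; 652; 69; 6443; 56; 20832; 34; 2399; 40; 2992];
   [:: 21387; 69; 303794; 40; 24329; 56; 68681; 67; 44838; 34; 6456; 35; 53824];
   [:: 21387; 67; 330102; 40; 27572; 69; 37202; 56; 145283; 34; 22863; 35; 5362];
   [:: 7527; 67; 75687; 62; 4151; 69; 50898; 56; 43705; 34; 8035; 40; 7258];
   [:: 21387; 67; 65442; 40; 10675; 69; 120676; 56; 77494; 34; 10224; 35; 6713];
   [:: 1267; 62; 3406; 34; 308; 69; 2017; 56; 2399; 70; 883; 67; 5847];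
   [:: 21387; 69; 42146; 40; 2432; 35; 1894; 56; 21794; 34; 14322; 67; 57609];
   [:: 21808; 70; 47842; 64; 33479; 55; 20069; 53; 314; 34; 4189; 56; 9270];
   [:: 558; 62; 895; 68; 177; 34; 102; 55; 131; 70; 1198; 67; 1027];
   [:: 1267; 70; 859; 62; 293; 69; 1272; 56; 886; 34; 644; 67; 2649];
   [:: 15054; 69; 42789; 62; 7223; 56; 4756; 67; 11988; 34; 5254; 40; 3115];
   [:: 7129; 69; 20662; 40; 174; 56; 1571; 67; 2017; 34; 755; 35; 4298];
   [:: 1072; 62; 939; 68; 396; 34; 115; 69; 1197; 70; 2147; 55; 379];
   [:: 38712; 62; 7771; 34; 3650; 40; 11705; 57; 606; 69; 86325; 56; 23060];
   [:: 891; 64; 883; 29; 77; 56; 1064; 63; 117; 34; 68; 67; 693];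
   [:: 12596; 70; 36135; 62; 7191; 53; 675; 64; 77; 34; 3960; 56; 4769];
   [:: 32997; 50; 6309; 62; 2800; 40; 5990; 56; 38690; 34; 3326; 69; 20244];
   [:: 15054; 69; 11067; 62; 2861; 56; 1888; 67; 23358; 34; 2896; 40; 1015];
   [:: 5418; 59; 402; 35; 1512; 56; 35; 49; 295; 34; 358; 69; 2045]];
   [::
   [:: 2509; 56; 665; 62; 1825; 40; 109; 67; 1883; 34; 531; 69; 2815];
   [:: 1; 0; 1];
   [:: 117492; 21; 2038589; 24; 20244; 46; 66571711; 23; 141756; 18; 4107269; 2; 194496];
   [:: 249072200; 21; 2201308622; 3; 5300204; 23; 597941301; 4; 53897433; 5; 9178515; 1; 88150957];
   [:: 252842; 18; 6091; 21; 10950; 40; 263; 2; 82962; 67; 26856; 69; 6401];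
   [:: 266266; 24; 89122; 25; 162436; 46; 8185939; 23; 63319; 10; 95926; 21; 572741];
   [:: 1533680; 21; 46752; 38; 50003; 8; 28227; 62; 38485; 5; 1704642; 55; 25046];
   [:: 1; 18; 1];
   [:: 6528961; 10; 42347; 34; 194579; 56; 348277; 24; 31155; 8; 2910588; 40; 181091];
   [:: 1; 21; 1];
   [:: 410954; 62; 18001; 38; 10857; 25; 3042; 34; 26; 3; 22114; 8; 6865];
   [:: 11401; 69; 493; 46; 944; 40; 562; 56; 997; 10; 2684; 67; 1237];
   [:: 122632; 29; 35015; 38; 50968; 56; 11465; 24; 5526; 67; 10738; 25; 109892];
   [:: 1; 23; 1];
   [:: 137739; 67; 4474; 38; 2205; 40; 14248; 8; 115; 21; 5361; 4; 3935];
   [:: 189584; 67; 53906; 38; 33696; 56; 63637; 24; 85462; 29; 171; 35; 41468];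
   [:: 1267; 62; 4090; 34; 259; 69; 606; 56; 195; 70; 2244; 67; 1268];
   [:: 2780; 70; 3580; 68; 2302; 55; 1451; 64; 509; 34; 1265; 67; 2358];
   [:: 37336; 67; 20610; 29; 3407; 63; 41980; 24; 2234; 34; 13216; 56; 7593];
   [:: 1806; 62; 3725; 55; 88; 34; 312; 63; 561; 70; 1325; 67; 1769];
   [:: 5018; 62; 6811; 34; 952; 40; 701; 56; 2090; 69; 7055; 67; 900];
   [:: 1; 46; 1];
   [:: 1267; 70; 780; 62; 446; 69; 773; 56; 393; 34; 483; 67; 41];
   [:: 7129; 67; 1040; 34; 103; 56; 3217; 35; 152; 69; 326; 40; 3914];
   [:: 16773; 62; 614; 34; 229; 38; 8430; 67; 4208; 40; 1181; 68; 7364];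
   [:: 15309; 62; 18671; 40; 273; 69; 5193; 34; 2350; 50; 1495; 68; 8816];
   [:: 26948; 62; 3655; 53; 1366; 40; 16273; 34; 196; 69; 3403; 68; 13046];
   [:: 2388; 67; 252; 62; 90; 56; 25; 64; 56; 34; 16; 29; 421]; [:: 1; 62; 1]]].

Lemma thin_check6 :
  thin_check 6 coef_f coef_g6 gens_T6 gens_B6 certs6.
Proof. by vm_compute. Qed.

Definition gens_T7 : seq (seq Z) :=
  [::
   [:: 0; -9; 11; -24; 11; -9];
   [:: -5765; -29328; 26510; -107072; 49839; -49486];
   [:: -652; -3523; 3523; -12639; 5896; -5646];
   [:: -62; -323; 305; -1181; 555; -535];
   [:: -44; -315; 380; -984; 464; -389]; [:: -40; -238; 264; -820; 384; -351];
   [:: -39; -248; 282; -820; 384; -344]; [:: -16; -95; 104; -330; 145; -137];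
   [:: -16; -92; 101; -330; 152; -138]; [:: -17; -90; 88; -330; 155; -147];
   [:: -9; -61; 64; -181; 79; -72]; [:: -9; -44; 37; -162; 74; -76];
   [:: -5; -29; 33; -104; 50; -45]; [:: -4; -30; 37; -92; 43; -35];
   [:: -4; -29; 36; -92; 43; -36]; [:: -2; -21; 19; -44; 14; -14];
   [:: -1; -15; 13; -44; 20; -21]; [:: -2; -15; 17; -44; 20; -18];
   [:: -1; -16; 8; -37; 10; -19]; [:: -2; -9; 6; -34; 16; -17];
   [:: -1; -14; 9; -26; 5; -9]; [:: -1; -12; 5; -26; 6; -12];
   [:: -1; -8; 8; -26; 12; -10]; [:: -1; -8; 9; -23; 11; -9];
   [:: -1; -7; 8; -22; 9; -9]; [:: -1; -7; 6; -21; 8; -10];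
   [:: -1; -8; 5; -18; 5; -9]; [:: -1; -8; 4; -18; 6; -9];
   [:: -1; -4; 1; -14; 6; -8]].

Definition gens_B7 : seq (seq Z) :=
  [::
   [:: -12033; -41864; -15941; -121031; 35880; -85669];
   [:: -5765; -19694; -9484; -54348; 13845; -39852];
   [:: -1019; -3403; -2081; -8777; 1626; -6721];
   [:: -2443; -6525; -7495; -6991; -6924; -5097];
   [:: -302; -1038; -464; -2940; 824; -2117];
   [:: -804; -2277; -2781; -2848; -2232; -2443];
   [:: -413; -1105; -1272; -1187; -1173; -868];
   [:: -132; -445; -257; -1181; 274; -895];
   [:: -135; -435; -368; -984; 31; -804];
   [:: -263; -686; -766; -710; -726; -487];
   [:: -196; -528; -613; -574; -563; -425];
   [:: -134; -380; -465; -479; -371; -413];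
   [:: -115; -308; -355; -332; -327; -241];
   [:: -103; -286; -342; -326; -302; -263];
   [:: -39; -125; -109; -275; -7; -220]; [:: -34; -111; -91; -251; 9; -202];
   [:: -60; -171; -210; -221; -163; -196];
   [:: -76; -186; -195; -183; -192; -113]; [:: -17; -60; -19; -178; 58; -124];
   [:: -22; -71; -57; -165; 11; -134]; [:: -22; -71; -57; -165; 9; -133];
   [:: -37; -105; -128; -133; -104; -115];
   [:: -39; -109; -131; -128; -112; -104]; [:: -14; -47; -26; -126; 28; -95];
   [:: -42; -109; -121; -112; -115; -76];
   [:: -46; -110; -114; -109; -114; -65]; [:: -18; -58; -65; -92; -37; -81];
   [:: -9; -30; -19; -77; 16; -60]; [:: -28; -70; -75; -70; -73; -46];
   [:: -29; -68; -69; -66; -69; -38]; [:: -32; -68; -66; -67; -67; -33];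
   [:: -33; -67; -64; -66; -65; -32]; [:: -32; -63; -61; -64; -62; -31];
   [:: -28; -62; -61; -61; -63; -32]; [:: -31; -61; -61; -63; -60; -31];
   [:: -17; -47; -56; -53; -50; -42]; [:: -22; -51; -51; -49; -52; -28];
   [:: -19; -47; -50; -47; -49; -29]; [:: -15; -40; -46; -43; -43; -31];
   [:: -8; -25; -28; -44; -13; -39]; [:: -7; -23; -20; -44; -8; -34];
   [:: -6; -20; -15; -44; 4; -37]; [:: -14; -37; -42; -39; -38; -28];
   [:: -15; -37; -39; -36; -38; -22]; [:: -3; -11; -1; -36; 14; -23];
   [:: -10; -26; -29; -27; -28; -19]; [:: -8; -21; -24; -22; -23; -15];
   [:: -4; -13; -11; -21; -6; -17]; [:: -4; -12; -15; -18; -9; -17];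
   [:: -5; -14; -17; -18; -14; -14]; [:: -5; -14; -17; -17; -14; -15];
   [:: -2; -7; -4; -15; 1; -12]; [:: -1; -4; 1; -14; 6; -8];
   [:: -4; -11; -13; -12; -11; -10]; [:: -3; -8; -10; -9; -9; -8];
   [:: -1; -3; -2; -6; -1; -5]; [:: -1; -3; -4; -5; -2; -4];
   [:: -1; -2; -3; -3; -1; -3]; [:: -1; -2; -2; -2; -2; -1]].

Definition certs7 : seq (seq (seq Z)) :=
  [:: [::
   [:: 1; 0; 1]; [:: 1; 1; 1; 0; 5765]; [:: 1; 2; 1; 0; 652];
   [:: 1; 3; 1; 0; 62]; [:: 1; 4; 1; 0; 44]; [:: 1; 5; 1; 0; 40];
   [:: 1; 6; 1; 0; 39]; [:: 1; 7; 1; 0; 16]; [:: 1; 8; 1; 0; 16];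
   [:: 1; 9; 1; 0; 17]; [:: 1; 10; 1; 0; 9]; [:: 1; 11; 1; 0; 9];
   [:: 1; 12; 1; 0; 5]; [:: 1; 13; 1; 0; 4]; [:: 1; 14; 1; 0; 4];
   [:: 1; 15; 1; 0; 2]; [:: 1; 16; 1; 0; 1]; [:: 1; 17; 1; 0; 2];
   [:: 1; 18; 1; 0; 1]; [:: 1; 19; 1; 0; 2]; [:: 1; 20; 1; 0; 1];
   [:: 1; 21; 1; 0; 1]; [:: 1; 22; 1; 0; 1]; [:: 1; 23; 1; 0; 1];
   [:: 1; 24; 1; 0; 1]; [:: 1; 25; 1; 0; 1]; [:: 1; 26; 1; 0; 1];
   [:: 1; 27; 1; 0; 1]; [:: 1; 28; 1; 0; 1]];
   [::
   [:: 650; 26; 388409; 27; 1566843; 0; 2850631; 18; 917116; 28; 2963921; 16; 1985161];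
   [:: 325; 26; 138243; 27; 370161; 0; 619587; 18; 283282; 28; 649267; 16; 432672];
   [:: 325; 26; 33348; 27; 58471; 0; 114057; 18; 69027; 28; 121262; 16; 49067];
   [:: 1316; 20; 1457838; 18; 408268; 0; 320865; 22; 480874; 28; 743687; 24; 124321];
   [:: 650; 26; 3439; 27; 46403; 0; 69651; 18; 26786; 28; 73441; 16; 46231];
   [:: 2632; 20; 740394; 18; 560336; 0; 107561; 22; 272106; 28; 413539; 24; 129753];
   [:: 658; 20; 122562; 18; 35742; 0; 25937; 22; 41660; 28; 61369; 24; 10421];
   [:: 650; 26; 2491; 27; 24107; 0; 22819; 18; 14084; 28; 23529; 16; 21589];
   [:: 1786; 20; 10173; 27; 26070; 0; 90974; 18; 72828; 28; 111102; 26; 20937];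
   [:: 2632; 24; 25133; 20; 335690; 0; 99789; 22; 85882; 28; 196119; 18; 49392];
   [:: 329; 20; 28289; 18; 9898; 0; 4721; 22; 10991; 28; 12635; 24; 2671];
   [:: 376; 20; 17358; 18; 13640; 0; 2475; 22; 6366; 28; 9753; 24; 3267];
   [:: 1316; 20; 67938; 18; 20664; 0; 13007; 22; 25478; 28; 32025; 24; 5235];
   [:: 2632; 20; 107578; 18; 59248; 0; 11301; 22; 43562; 28; 45535; 24; 15173];
   [:: 724; 20; 3233; 18; 9124; 0; 9051; 24; 1437; 28; 13419; 26; 1023];
   [:: 1786; 20; 3455; 27; 6160; 0; 23184; 18; 18090; 28; 28784; 26; 4235];
   [:: 329; 20; 6522; 18; 5523; 0; 1334; 22; 1686; 28; 4438; 24; 1571];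
   [:: 1848; 23; 10136; 22; 9018; 0; 27285; 24; 4509; 28; 45759; 20; 71026];
   [:: 325; 26; 202; 27; 1254; 0; 1843; 18; 448; 28; 1863; 16; 1758];
   [:: 1786; 20; 383; 27; 6152; 0; 15880; 18; 11398; 28; 17576; 26; 3783];
   [:: 893; 20; 650; 27; 1597; 0; 7829; 18; 5767; 28; 9362; 26; 2270];
   [:: 1316; 20; 16258; 18; 13972; 0; 1455; 22; 6330; 28; 7805; 24; 4327];
   [:: 658; 20; 9896; 18; 5908; 0; 1047; 22; 4304; 28; 4375; 24; 1179];
   [:: 325; 26; 508; 27; 766; 0; 1372; 18; 792; 28; 1477; 16; 1007];
   [:: 2632; 24; 3863; 20; 54414; 0; 17431; 22; 12598; 28; 33285; 18; 6384];
   [:: 616; 23; 2520; 22; 2050; 0; 5149; 24; 1333; 28; 8351; 20; 14082];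
   [:: 329; 20; 1443; 18; 2184; 0; 698; 22; 347; 28; 1820; 24; 128];
   [:: 325; 26; 159; 27; 868; 0; 606; 18; 491; 28; 596; 16; 811];
   [:: 1848; 23; 896; 22; 2022; 0; 11379; 24; 2859; 28; 19425; 20; 26542];
   [:: 343; 15; 28; 27; 2765; 0; 1207; 22; 2283; 24; 970; 20; 3873];
   [:: 1372; 15; 3521; 27; 10444; 20; 12379; 22; 10274; 0; 5454; 24; 3765];
   [:: 343; 15; 1267; 27; 2751; 20; 2565; 22; 2427; 0; 1513; 24; 1042];
   [:: 343; 15; 1197; 27; 2527; 20; 2462; 22; 2281; 0; 1460; 24; 1312];
   [:: 588; 15; 679; 27; 3976; 20; 5589; 22; 3694; 0; 1982; 24; 1847];
   [:: 4116; 15; 12481; 27; 29512; 0; 16550; 22; 28570; 24; 14285; 20; 30267];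
   [:: 2632; 20; 18050; 18; 9464; 0; 1693; 22; 7786; 28; 7119; 24; 2325];
   [:: 1372; 15; 455; 27; 8316; 20; 11229; 22; 6486; 0; 3750; 24; 3243];
   [:: 231; 23; 119; 22; 366; 0; 867; 24; 183; 28; 1470; 20; 2251];
   [:: 2632; 20; 17622; 18; 5544; 0; 2983; 22; 6886; 28; 7581; 24; 1847];
   [:: 1316; 20; 2026; 18; 3920; 0; 1765; 22; 54; 28; 3815; 24; 713];
   [:: 1316; 20; 1646; 18; 3416; 0; 1293; 22; 1026; 28; 2079; 24; 1045];
   [:: 325; 26; 258; 27; 691; 0; 272; 18; 392; 28; 127; 16; 482];
   [:: 2632; 20; 17746; 18; 2744; 0; 6053; 22; 3826; 28; 12047; 24; 485];
   [:: 504; 24; 353; 27; 1064; 0; 1257; 22; 1210; 28; 1435; 20; 3498];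
   [:: 15; 28; 24; 27; 6; 0; 23; 21; 2; 16; 13];
   [:: 94; 24; 65; 20; 446; 0; 129; 22; 98; 28; 253; 18; 78];
   [:: 1316; 20; 4846; 18; 1288; 0; 731; 22; 2122; 28; 1841; 24; 431];
   [:: 1786; 20; 1787; 18; 1494; 0; 2000; 26; 1185; 28; 2578; 27; 100];
   [:: 724; 20; 747; 18; 960; 0; 419; 24; 97; 28; 1063; 26; 29];
   [:: 108; 20; 152; 18; 116; 22; 120; 21; 83; 28; 17; 24; 52];
   [:: 658; 20; 1202; 18; 770; 0; 319; 22; 160; 28; 861; 24; 297];
   [:: 325; 26; 196; 27; 142; 0; 189; 18; 129; 28; 99; 16; 84];
   [:: 1; 28; 1; 0; 1];
   [:: 2632; 20; 4762; 18; 1232; 0; 2005; 22; 162; 28; 4207; 24; 165];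
   [:: 1316; 20; 1490; 18; 868; 0; 275; 22; 206; 28; 833; 24; 551];
   [:: 173; 24; 45; 26; 64; 0; 35; 18; 54; 25; 10];
   [:: 424; 22; 72; 21; 271; 0; 64; 18; 28; 28; 45; 24; 8];
   [:: 112; 24; 1; 22; 2; 0; 41; 20; 18; 28; 35; 27; 56];
   [:: 147; 15; 14; 27; 35; 0; 19; 22; 32; 24; 16; 20; 36]];
   [::
   [:: 64; 10; 980; 28; 32525; 12; 22780; 11; 40267; 15; 16; 19; 126216];
   [:: 1; 1; 1];
   [:: 79991; 10; 93880; 11; 1638535; 5; 97463; 2; 77987; 8; 74835; 12; 1995138];
   [:: 2445; 23; 1605531; 27; 470279; 0; 689770; 15; 1214720; 22; 616730; 24; 851155];
   [:: 3020; 11; 23871; 10; 4040; 12; 29599; 19; 208533; 8; 1664; 9; 4068];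
   [:: 871; 13; 40796; 22; 22371; 0; 52258; 15; 83578; 24; 133337; 23; 214236];
   [:: 815; 23; 93129; 27; 25546; 0; 38595; 15; 67970; 22; 33735; 24; 48245];
   [:: 2512; 11; 1665; 10; 804; 12; 5637; 19; 22691; 9; 8604; 3; 1444];
   [:: 14619; 10; 30972; 13; 19358; 8; 967; 5; 11569; 7; 4363; 12; 213869];
   [:: 163; 23; 7624; 15; 9574; 0; 5461; 22; 5936; 27; 5237; 24; 4924];
   [:: 2445; 23; 148794; 27; 30341; 0; 53515; 15; 93740; 22; 40025; 24; 72580];
   [:: 1742; 13; 14959; 22; 6517; 0; 17138; 15; 26869; 24; 44403; 23; 68934];
   [:: 815; 23; 27042; 27; 7278; 0; 10745; 15; 18885; 22; 8990; 24; 12645];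
   [:: 1742; 13; 413; 22; 8453; 0; 16734; 15; 29645; 24; 38447; 23; 71584];
   [:: 230; 10; 19; 23; 39; 4; 7; 6; 211; 12; 16; 28; 143];
   [:: 1; 10; 1; 12; 5];
   [:: 26; 23; 342; 22; 41; 0; 106; 13; 141; 24; 303; 15; 155];
   [:: 4116; 24; 32629; 15; 73073; 0; 44434; 22; 65258; 27; 59864; 20; 8919];
   [:: 1; 19; 4; 11; 1];
   [:: 1140; 10; 392; 28; 587; 19; 105; 7; 220; 12; 3435; 22; 60];
   [:: 2445; 10; 241; 5; 1035; 28; 391; 7; 50; 12; 1710; 24; 480];
   [:: 871; 13; 2399; 22; 188; 0; 2437; 15; 3624; 24; 6512; 23; 8683];
   [:: 1742; 13; 599; 22; 3145; 0; 5914; 15; 10459; 24; 13739; 23; 27740];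
   [:: 1; 12; 1; 11; 1];
   [:: 815; 23; 5352; 15; 7775; 0; 4430; 22; 5085; 27; 4478; 24; 3765];
   [:: 1372; 24; 6945; 15; 13825; 0; 9022; 22; 12518; 27; 12684; 20; 3315];
   [:: 940; 23; 1212; 12; 134; 22; 223; 24; 801; 15; 137; 13; 3435];
   [:: 2866; 0; 6; 8; 503; 22; 161; 19; 3203; 9; 432; 12; 767];
   [:: 2445; 23; 942; 15; 16615; 0; 9710; 22; 13300; 27; 11893; 24; 9095];
   [:: 343; 24; 922; 15; 1946; 0; 1346; 22; 2187; 27; 1974; 20; 972];
   [:: 1372; 24; 3539; 15; 5663; 20; 9053; 22; 9822; 0; 5694; 27; 10164];
   [:: 343; 15; 1015; 27; 2562; 20; 2988; 22; 2607; 0; 1381; 24; 1132];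
   [:: 343; 15; 861; 27; 2618; 20; 2977; 22; 2325; 0; 1382; 24; 1334];
   [:: 4116; 24; 11759; 15; 18319; 20; 18189; 22; 23518; 0; 15590; 27; 25144];
   [:: 4116; 15; 11263; 27; 32200; 0; 16598; 22; 27382; 24; 13691; 20; 31797];
   [:: 246; 23; 1662; 15; 730; 0; 419; 24; 829; 22; 182; 28; 49];
   [:: 1372; 24; 3261; 15; 5481; 20; 3699; 22; 6522; 0; 3998; 27; 5740];
   [:: 2445; 23; 519; 15; 11555; 0; 6850; 22; 9020; 27; 9296; 24; 4510];
   [:: 163; 23; 693; 15; 497; 0; 288; 22; 211; 27; 197; 24; 350];
   [:: 7; 17; 2; 12; 2; 14; 3; 24; 2; 13; 7];
   [:: 293; 23; 78; 10; 52; 24; 153; 13; 118; 12; 42; 17; 335];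
   [:: 59426; 10; 1270; 19; 5271; 7; 2406; 8; 15871; 22; 9917; 12; 6447];
   [:: 2445; 23; 7017; 27; 3533; 0; 4000; 15; 7265; 22; 5285; 24; 3865];
   [:: 2058; 24; 2389; 15; 7511; 0; 4408; 22; 6836; 27; 6062; 20; 561];
   [:: 1; 28; 1; 19; 1];
   [:: 163; 23; 271; 15; 359; 0; 210; 22; 198; 27; 181; 24; 262];
   [:: 2445; 23; 5058; 15; 4235; 0; 2500; 22; 1775; 27; 2147; 24; 2110];
   [:: 1903; 8; 34; 22; 963; 23; 645; 13; 490; 24; 2414; 15; 543];
   [:: 1742; 23; 388; 15; 85; 0; 142; 24; 843; 13; 1301; 22; 363];
   [:: 74; 17; 18; 15; 49; 0; 30; 24; 53; 23; 180; 26; 3];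
   [:: 871; 23; 895; 22; 220; 0; 350; 13; 287; 24; 986; 15; 553];
   [:: 45; 10; 1; 7; 5; 28; 1]; [:: 1; 28; 1];
   [:: 984; 23; 1080; 15; 718; 0; 371; 24; 781; 22; 578; 28; 61];
   [:: 134; 13; 13; 22; 13; 0; 42; 15; 61; 24; 121; 23; 94]; [:: 1; 24; 1];
   [:: 1; 23; 1]; [:: 11; 23; 1; 22; 4; 0; 1; 24; 2; 28; 2; 20; 2];
   [:: 147; 15; 14; 27; 35; 0; 19; 22; 32; 24; 16; 20; 36]];
   [::
   [:: 6; 55; 7180; 35; 7567; 56; 6173; 48; 60956; 49; 1204; 54; 40726];
   [:: 862; 26; 107785; 35; 368812; 49; 501404; 48; 3190373; 21; 31696; 54; 3233742];
   [:: 56; 21; 3402; 35; 4901; 49; 2352; 48; 27268; 56; 2265; 54; 14696];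
   [:: 18; 43; 3977; 47; 138; 53; 38; 46; 1065; 45; 2161; 54; 419];
   [:: 215; 55; 2878; 35; 6377; 49; 1871; 48; 50755; 26; 628; 54; 40063];
   [:: 1; 3; 1];
   [:: 252; 43; 9209; 47; 282; 53; 824; 46; 2703; 45; 5353; 54; 341];
   [:: 124; 26; 31; 35; 60; 21; 1536; 48; 7337; 53; 2114; 54; 4922];
   [:: 1; 5; 1]; [:: 24; 43; 242; 55; 16; 17; 73; 37; 32; 36; 38; 45; 105];
   [:: 336; 43; 4678; 53; 613; 24; 1037; 46; 946; 47; 104; 45; 1864];
   [:: 1; 6; 1];
   [:: 112; 43; 1142; 53; 205; 24; 53; 46; 130; 47; 24; 45; 568];
   [:: 1; 9; 1];
   [:: 786; 47; 273; 53; 819; 13; 1081; 56; 8402; 48; 8268; 54; 5245];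
   [:: 377; 21; 460; 48; 3600; 56; 1640; 11; 9; 13; 362; 54; 1534];
   [:: 1; 10; 1];
   [:: 461; 33; 506; 43; 268; 37; 223; 52; 24; 36; 1250; 46; 268];
   [:: 6; 47; 4; 35; 7; 56; 17; 48; 88; 55; 6; 54; 78]; [:: 1; 11; 1];
   [:: 1131; 21; 201; 48; 2409; 56; 2618; 11; 744; 13; 268; 54; 1144];
   [:: 1; 12; 1];
   [:: 2154; 9; 584; 47; 46; 24; 435; 3; 14; 53; 3097; 45; 538];
   [:: 862; 26; 3; 35; 876; 49; 838; 48; 6807; 21; 648; 54; 3850];
   [:: 1; 17; 1];
   [:: 6385; 30; 2273; 43; 8452; 33; 5642; 52; 203; 36; 2523; 46; 228];
   [:: 50; 35; 189; 53; 112; 56; 51; 46; 8; 47; 26; 49; 34]; [:: 1; 16; 1];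
   [:: 1; 25; 1]; [:: 303; 58; 327; 36; 223; 33; 186; 31; 32; 55; 16; 52; 1];
   [:: 1; 31; 1]; [:: 1; 32; 1]; [:: 1; 34; 1]; [:: 1; 30; 1];
   [:: 1; 57; 1; 58; 30]; [:: 1; 24; 1]; [:: 1; 33; 1]; [:: 1; 29; 1];
   [:: 269; 55; 2; 47; 12; 43; 399; 46; 186; 45; 62; 53; 49]; [:: 1; 22; 1];
   [:: 1967; 46; 2253; 53; 1200; 13; 270; 56; 3776; 47; 400; 48; 2717];
   [:: 1; 21; 1]; [:: 1; 28; 1]; [:: 1; 36; 1];
   [:: 6; 55; 1; 43; 1; 48; 23; 54; 10]; [:: 1; 37; 1]; [:: 1; 43; 1];
   [:: 845; 49; 604; 55; 282; 46; 590; 35; 143; 54; 782; 26; 87];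
   [:: 1; 35; 1]; [:: 1; 42; 1]; [:: 1; 38; 1];
   [:: 65; 21; 14; 49; 44; 57; 4; 54; 2; 55; 14; 26; 1];
   [:: 27; 58; 22; 53; 3; 46; 1; 51; 1; 48; 43]; [:: 1; 45; 1]; [:: 1; 46; 1];
   [:: 1; 49; 1]; [:: 1; 53; 1]; [:: 1; 54; 1]; [:: 1; 58; 1]];
   [::
   [:: 813; 44; 203; 55; 577; 41; 190; 56; 1337; 50; 717; 57; 69];
   [:: 256; 55; 572994; 50; 648821; 41; 236461; 56; 2182902; 57; 1299941; 48; 987427];
   [:: 128; 55; 48554; 50; 33913; 41; 14225; 56; 156910; 57; 77993; 48; 46079];
   [:: 256; 55; 6062; 50; 6627; 41; 2795; 56; 23386; 57; 14835; 48; 10693];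
   [:: 256; 41; 2183; 50; 3295; 56; 36578; 55; 19142; 57; 12335; 48; 489];
   [:: 64; 55; 2486; 50; 919; 41; 447; 56; 6386; 57; 2535; 48; 945];
   [:: 32; 41; 215; 50; 431; 56; 3490; 55; 1574; 57; 1247; 48; 313];
   [:: 128; 55; 1190; 50; 975; 41; 503; 56; 5378; 57; 2079; 48; 249];
   [:: 256; 55; 1942; 50; 1639; 41; 975; 56; 8658; 57; 4407; 48; 1569];
   [:: 256; 55; 1566; 50; 1787; 41; 835; 56; 6698; 57; 4235; 48; 2797];
   [:: 271; 44; 110; 50; 1048; 56; 6023; 55; 3028; 57; 2431; 41; 410];
   [:: 256; 55; 550; 50; 1103; 41; 375; 56; 3074; 57; 1951; 48; 1529];
   [:: 32; 55; 142; 50; 51; 41; 27; 56; 378; 57; 163; 48; 85];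
   [:: 813; 44; 104; 50; 912; 56; 10469; 55; 5494; 57; 3816; 41; 634];
   [:: 813; 44; 28; 50; 996; 56; 11230; 55; 5294; 57; 3654; 41; 671];
   [:: 29; 44; 24; 50; 25; 57; 20; 56; 64; 58; 61; 55; 64];
   [:: 16; 55; 26; 48; 7; 56; 62; 57; 1; 50; 33; 41; 9];
   [:: 813; 44; 80; 50; 639; 56; 5489; 55; 3163; 57; 1497; 41; 175];
   [:: 26; 46; 14; 47; 18; 52; 21; 56; 14; 48; 40; 49; 23];
   [:: 295; 51; 37; 56; 40; 43; 34; 52; 78; 48; 970; 57; 433];
   [:: 225; 44; 126; 51; 65; 50; 110; 46; 95; 58; 147; 55; 60];
   [:: 4193; 44; 948; 47; 1953; 56; 5392; 50; 4540; 43; 566; 41; 513];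
   [:: 163; 56; 185; 41; 22; 48; 137; 53; 56; 57; 281; 51; 130];
   [:: 64; 41; 13; 50; 21; 56; 182; 55; 130; 57; 69; 48; 3];
   [:: 813; 44; 124; 50; 462; 56; 2695; 55; 797; 57; 735; 41; 68];
   [:: 271; 44; 31; 50; 251; 56; 877; 55; 267; 57; 116; 41; 17];
   [:: 246; 56; 776; 46; 78; 52; 25; 49; 47; 47; 10; 55; 514];
   [:: 37; 58; 9; 46; 12; 52; 8; 56; 30; 48; 34; 55; 54];
   [:: 27; 58; 22; 53; 3; 46; 1; 51; 1; 48; 43]];
   [::
   [:: 813; 44; 203; 55; 577; 41; 190; 56; 1337; 50; 717; 57; 69];
   [:: 1; 0; 1];
   [:: 219783; 15; 132201; 7; 24768; 23; 2330537; 1; 46958; 18; 1637326; 2; 5359];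
   [:: 240; 23; 340; 44; 840; 4; 80; 18; 25; 52; 607; 15; 12];
   [:: 3265; 52; 3563; 8; 1690; 20; 13510; 15; 1218; 23; 1345; 51; 4160];
   [:: 10208; 15; 1384; 41; 1279; 23; 16354; 2; 882; 51; 2459; 20; 781];
   [:: 3315; 52; 561; 7; 10; 23; 12900; 15; 1571; 51; 8270; 20; 8265];
   [:: 12820; 55; 4897; 7; 2784; 57; 5764; 27; 9901; 41; 22030; 20; 141];
   [:: 7827; 52; 299; 56; 977; 57; 1736; 44; 668; 7; 2537; 20; 204];
   [:: 4503; 23; 336; 44; 3487; 57; 330; 4; 443; 7; 199; 56; 68];
   [:: 1; 15; 1]; [:: 1; 18; 1]; [:: 1; 23; 1];
   [:: 3901; 20; 286; 56; 195; 8; 459; 40; 38; 41; 164; 48; 129];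
   [:: 8072; 27; 859; 8; 231; 57; 766; 19; 593; 41; 2166; 20; 3250];
   [:: 514; 41; 80; 39; 600; 56; 518; 55; 198; 26; 67; 48; 127];
   [:: 528; 44; 443; 46; 137; 50; 199; 56; 1069; 55; 839; 47; 252];
   [:: 763; 40; 25; 51; 228; 20; 194; 55; 294; 39; 102; 14; 22];
   [:: 11; 44; 4; 47; 17; 50; 5; 56; 10; 46; 3; 55; 4]; [:: 1; 44; 1];
   [:: 143; 49; 15; 56; 201; 55; 3; 26; 11; 48; 160; 47; 114];
   [:: 698; 44; 101; 47; 843; 53; 49; 46; 85; 50; 43; 56; 1516];
   [:: 787; 52; 97; 43; 5; 57; 200; 56; 1574; 44; 267; 41; 198];
   [:: 739; 52; 6; 14; 69; 20; 29; 56; 175; 40; 18; 55; 59];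
   [:: 462; 52; 9; 41; 183; 57; 53; 20; 27; 23; 1; 55; 80];
   [:: 68352; 21; 1085; 47; 3293; 43; 586; 41; 24820; 52; 26617; 55; 35764];
   [:: 22; 48; 7; 40; 4; 55; 16; 47; 5; 51; 9];
   [:: 68; 52; 11; 49; 9; 40; 30; 56; 22; 47; 6; 55; 28]; [:: 1; 52; 1]]].

Lemma thin_check7 :
  thin_check 6 coef_f coef_g7 gens_T7 gens_B7 certs7.
Proof. by vm_compute. Qed.

End ConeData.

Lemma thin_case (R : realType) (b : 6.-tuple rat) g CT CB certs s :
  thin_check 6 coef_f g CT CB certs ->
  exp_poly_seq R s = Poly (map (@ZK R[i]) g) -> (b : seq rat) = s ->
  thin (hypergeometric_group (nseq_tuple 6 (0 : R[i]))
                             (map_tuple (ratr : rat -> R[i]) b)).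
Proof.
move=> chk gE bs; rewrite /hypergeometric_group exp_poly_map exp_poly_zeros bs gE.
exact: thin_of_check chk.
Qed.

Theorem theorem1p2 (R : realType) (beta : 6.-tuple rat) :
  (beta : seq rat) \in
    [:: [:: 1 / 2; 1 / 2; 1 / 2; 1 / 2; 1 / 2; 1 / 2];
        [:: 1 / 2; 1 / 2; 1 / 2; 1 / 2; 1 / 3; 2 / 3];
        [:: 1 / 2; 1 / 2; 1 / 2; 1 / 2; 1 / 4; 3 / 4];
        [:: 1 / 2; 1 / 2; 1 / 2; 1 / 2; 1 / 6; 5 / 6];
        [:: 1 / 2; 1 / 2; 1 / 3; 2 / 3; 1 / 3; 2 / 3];
        [:: 1 / 2; 1 / 2; 1 / 3; 2 / 3; 1 / 4; 3 / 4];
        [:: 1 / 2; 1 / 2; 1 / 5; 2 / 5; 3 / 5; 4 / 5]] ->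
  thin (hypergeometric_group (nseq_tuple 6 (0 : R[i]))
                             (map_tuple (ratr : rat -> R[i]) beta)).
Proof.
rewrite !inE; case/or4P => [/eqP|/eqP|/eqP|/or4P[] /eqP].
- exact: thin_case thin_check1 (exp_poly_g1 R).
- exact: thin_case thin_check2 (exp_poly_g2 R).
- exact: thin_case thin_check3 (exp_poly_g3 R).
- exact: thin_case thin_check4 (exp_poly_g4 R).
- exact: thin_case thin_check5 (exp_poly_g5 R).
- exact: thin_case thin_check6 (exp_poly_g6 R).
- exact: thin_case thin_check7 (exp_poly_g7 R).
Qed.
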